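(* Let $\mathbb{G}_{1/2}$ be a random variable with the arc sine law, i.e. with density $\frac{1}{\pi}\frac{1}{\sqrt{x(1-x)}}1_{[0,1]}(x)$, and let $(\Gamma_t(\mathbb{G}_{1/2}),\,t\ge0)$ be the subordinator characterized by $$E(e^{-\lambda\Gamma_t(\mathbb{G}_{1/2})})=\exp\left\{-t\int_0^\infty(1-e^{-\lambda x})\frac{dx}{x}E(e^{-x\mathbb{G}_{1/2}})\right\}\qquad(\lambda,t\ge0).$$ Then: 1. (Laplace transform) For $\lambda,t\ge0$, $$E(e^{-\lambda\Gamma_t(\mathbb{G}_{1/2})})=\exp\left\{-t\int_0^\infty(1-e^{-\lambda x})\frac{dx}{x}I_0\left(\frac x2\right)e^{-x/2}\right\}$$ $$=\left(\sqrt{1+\lambda}-\sqrt\lambda\right)^{2t}=\left(\frac{1}{\sqrt{1+\lambda}+\sqrt\lambda}\right)^{2t}=\left(1+2\lambda+2\sqrt{\lambda(1+\lambda)}\right)^{-t}.$$ 2. (Laws) For $t>0$, $$\Gamma_t(\mathbb{G}_{1/2})\stackrel{(law)}{=}\frac{\gamma_t}{\beta_{1/2,\,1/2+t}},\qquad D_t(\mathbb{G}_{1/2})\stackrel{(law)}{=}\frac{1}{\beta_{1/2,\,1/2+t}}\stackrel{(law)}{=}1+\frac{\gamma_{t+1/2}}{\gamma_{1/2}},$$ and the density of $\Gamma_t(\mathbb{G}_{1/2})$ equals $$f_{\Gamma_t(\mathbb{G}_{1/2})}(x)=\frac{2^{2t}\,\Gamma(1+t)}{2\pi\,\Gamma(2t)}\,x^{t-1}\left(\int_0^1e^{-xy}\left(y(1-y)\right)^{t-1/2}dy\right)1_{[0,\infty[}(x).$$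 3. (Wiener-Gamma representation) For every $t>0$, $$\Gamma_t(\mathbb{G}_{1/2})\stackrel{(law)}{=}\int_0^t\frac{d\gamma_u}{\sin^2\left(\frac{\pi u}{2t}\right)}\stackrel{(law)}{=}\int_0^t\frac{d\gamma_u}{\cos^2\left(\frac{\pi u}{2t}\right)} .$$
   Context: $(\gamma_t,\,t\ge0)$ is the standard gamma process, i.e. the subordinator without drift and with Lévy measure $\frac{dx}{x}e^{-x}$, $x>0$. For fixed $t>0$, $\gamma_t$ is a gamma variable with density $e^{-a}a^{t-1}/\Gamma(t)$ on $(0,\infty)$. Integrals $\int_0^t h(u)\,d\gamma_u$ with $h\ge0$ are pathwise Stieltjes integrals. $\beta_{a,b}$ is a beta variable with parameters $a,b$. Whenever several random variables (gamma or beta variables of different index) occur on one side of an equality in law, they are assumed independent. For $t>0$, $D_t(\mathbb{G}_{1/2})$ is the random variable whose law is characterized by $\Gamma_t(\mathbb{G}_{1/2})\stackrel{(law)}{=}\gamma_t\cdot D_t(\mathbb{G}_{1/2})$, with independent factors. $I_0$ is the modified Bessel function of the first kind with index $0$. *)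

(* Defs.v *)
From HB Require Import structures.
From mathcomp Require Import all_boot all_order all_algebra.
From mathcomp Require Import all_classical all_reals all_analysis.
Set Implicit Arguments.
Unset Strict Implicit.
Unset Printing Implicit Defensive.
Import Order.TTheory GRing.Theory Num.Theory.
Import numFieldNormedType.Exports.
Local Open Scope classical_set_scope.
Local Open Scope ring_scope.

Definition eq_law (R : realType)
    d1 (T1 : measurableType d1) (P : probability T1 R) (X : T1 -> R)
    d2 (T2 : measurableType d2) (Q : probability T2 R) (Y : T2 -> R) : Prop :=
  forall A : set R, measurable A -> P (X @^-1` A) = Q (Y @^-1` A).

Definition has_density (R : realType) d (T : measurableType d)
    (P : probability T R) (X : T -> R) (f : R -> R) : Prop :=
  forall A : set R, measurable A ->
    P (X @^-1` A) = (\int[lebesgue_measure]_(x in A) (f x)%:E)%E.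

Definition independent2 (R : realType) d (T : measurableType d)
    (P : probability T R) (X Y : T -> R) : Prop :=
  forall A B : set R, measurable A -> measurable B ->
    P (X @^-1` A `&` Y @^-1` B) = (P (X @^-1` A) * P (Y @^-1` B))%E.

(* Independence of X 0, ..., X (n - 1); the product rule for the subfamilies
   is recovered by taking some of the B i equal to setT. *)
Definition mutually_independent (R : realType) d (T : measurableType d)
    (P : probability T R) (n : nat) (X : nat -> T -> R) : Prop :=
  forall B : nat -> set R, (forall i, measurable (B i)) ->
    P [set w | forall i, (i < n)%N -> B i (X i w)] =
    (\prod_(0 <= i < n) P (X i @^-1` B i))%E.

Section special_functions.
Variable R : realType.
Implicit Types a b x : R.

Definition gamma_fun a : R :=
  \int[lebesgue_measure]_(x in `]0, +oo[) (x `^ (a - 1) * expR (- x)).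

Definition gamma_pdf a x : R :=
  x `^ (a - 1) * expR (- x) / gamma_fun a * \1_(`]0, +oo[%classic : set R) x.

(* The beta_fun and beta_pdf of MathComp-Analysis have parameters in nat. *)
Definition rbeta_fun a b : R :=
  \int[lebesgue_measure]_(x in `]0, 1[) (x `^ (a - 1) * (1 - x) `^ (b - 1)).

Definition rbeta_pdf a b x : R :=
  x `^ (a - 1) * (1 - x) `^ (b - 1) / rbeta_fun a b
  * \1_(`]0, 1[%classic : set R) x.

Definition arcsine_pdf x : R :=
  pi^-1 * (Num.sqrt (x * (1 - x)))^-1 * \1_(`[0, 1]%classic : set R) x.

Definition bessel_I0 x : R :=
  limn (series (fun k => (x / 2) ^+ (2 * k) / (k`!%:R) ^+ 2)).

End special_functions.

Section processes.
Variable R : realType.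

(* A function on [0, +oo[, extended to R by its value at 0. Times are indexed by R;
   only the nonnegative ones are relevant. *)
Definition extend_below0 (F : R -> R) (u : R) : R := F (Num.max 0 u).

Definition is_cumulative (F : R -> R) : Prop :=
  nondecreasing F /\ right_continuous F.

Definition cumulative_of (F : R -> R) (H : is_cumulative F) : cumulative R R :=
  HB.pack F (isCumulative.Build R _ R F H.1 H.2).

(* Integral of h over ]0, t] with respect to dF (0 by convention if F is not
   nondecreasing and right-continuous on [0, +oo[). *)
Definition stieltjes_integral (F : R -> R) (t : R) (h : R -> \bar R) : \bar R :=
  match pselect (is_cumulative (extend_below0 F)) with
  | left H =>
      (\int[lebesgue_stieltjes_measure (cumulative_of H)]_(u in `]0%R, t]) h u)%E
  | right _ => 0%E
  end.

Definition subordinator d (T : measurableType d) (P : probability T R)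
    (X : R -> {RV P >-> R}) : Prop :=
  [/\ {ae P, forall w, X 0 w = 0},
      {ae P, forall w, is_cumulative (extend_below0 (fun u => X u w))},
      (forall (n : nat) (s : nat -> R), s 0%N = 0 ->
         (forall i, s i <= s i.+1) ->
         mutually_independent P n (fun i w => X (s i.+1) w - X (s i) w)) &
      (forall s t, 0 <= s -> 0 <= t ->
         eq_law P (fun w => X (s + t) w - X s w) P (X t))].

Definition laplace_transform d (T : measurableType d) (P : probability T R)
    (X : T -> R) (l : R) : \bar R :=
  ('E_P[fun w => expR (- (l * X w))])%E.

Definition laplace_exponent (n : R -> \bar R) (l : R) : \bar R :=
  (\int[lebesgue_measure]_(x in `]0%R, +oo[) ((1 - expR (- (l * x)))%:E * n x))%E.

(* Subordinator without drift whose Levy measure has density n on ]0, +oo[. *)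
Definition driftless_subordinator d (T : measurableType d)
    (P : probability T R) (X : R -> {RV P >-> R}) (n : R -> \bar R) : Prop :=
  subordinator X /\
  forall l t, 0 <= l -> 0 <= t ->
    laplace_transform P (X t) l = expeR (- (t%:E * laplace_exponent n l))%E.

Definition gamma_process d (T : measurableType d)
    (P : probability T R) (X : R -> {RV P >-> R}) : Prop :=
  driftless_subordinator X (fun x => (x^-1 * expR (- x))%:E).

(* X, defined up to a negligible set and almost surely finite, is a random
   variable with the same law as Y. *)
Definition ae_eq_law d1 (T1 : measurableType d1) (P : probability T1 R)
    (Y : T1 -> R) d2 (T2 : measurableType d2) (Q : probability T2 R)
    (X : T2 -> \bar R) : Prop :=
  exists X' : {RV Q >-> R},
    {ae Q, forall w, X w = (X' w)%:E} /\ eq_law P Y Q X'.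

End processes.

(* Main.v *)
Require Import Defs.
From HB Require Import structures.
From mathcomp Require Import all_boot all_order all_algebra.
From mathcomp Require Import all_classical all_reals all_analysis.
From mathcomp Require Import measurable_realfun ring lra.
Set Implicit Arguments.
Unset Strict Implicit.
Unset Printing Implicit Defensive.
Import Order.TTheory GRing.Theory Num.Theory.
Import numFieldNormedType.Exports.
Local Open Scope classical_set_scope.
Local Open Scope ring_scope.

(** Write kappa(l) = (sqrt (1 + l) + sqrt l)^2, so that
    1 / kappa(l) = (sqrt (1 + l) - sqrt l)^2. Every part of the theorem comes
    from one invariance of the arc sine law ([arcsine_quotient_law]): for
    p, q >= 0 with p + q > 0, the variable
      (sqrt (p + q) + sqrt q)^2 G (1 - G) / (p G + q)
    has the law of G. The reason is that G = cos^2 of an angle uniform on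
    [0, pi/2], and the superlevel sets of the quotient are intervals of G whose
    angular length can be read off. The case (p, q) = (1, l) gives
      E ln (1 + l / G) = ln kappa(l)  and
      E [(G (1 - G) / (G + l))^t] = kappa(l)^(-t) E [G^t],
    while (1, 0) and (0, 1) give the symmetry of G and the law of 4 G (1 - G),
    that is, the moments of G and the duplication formula.

    Laplace transform. By a Frullani integral the Laplace exponent is
    E ln (1 + l / G) ([arcsine_exponent]). Moreover 2 G - 1 is symmetric, with
    square 1 - 4 G (1 - G) distributed as G; expanding the hyperbolic cosine and
    inserting the moments of G gives E e^(-x G) = I_0(x/2) e^(-x/2)
    ([arcsine_bessel]).

    Laws. A beta variable b of parameters 1/2, 1/2 + t is G biased by
    (1 - G)^t, so E (1 + l / b)^(-t) is a ratio of the expectations above and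
    equals kappa(l)^(-t) ([beta_stieltjes]); this is the Laplace transform of
    gamma_t / b, and Laplace transforms determine laws on the half-line
    ([laplace_unique]). The law of D_t is unique because
    l |-> E (1 + l D)^(-t) is, up to a change of variable and an explicit factor,
    the Laplace transform of x^(t-1) e^(-x) E e^(-x D)
    ([gamma_mixture_unique]). The relation between
    1 / b and a ratio of gamma variables is the beta-gamma algebra
    ([integral_gamma_beta]), and the density is recognised by its Laplace
    transform ([laplace_subordinator_density]).

    Wiener-Gamma representation. The pathwise Stieltjes integral of h is the
    increasing limit of dyadic sums of independent gamma increments, so its
    Laplace transform is exp (- int_0^t ln (1 + l h(u)) du). For
    h = 1 / sin^2 (pi u / (2 t)) or h = 1 / cos^2 (pi u / (2 t)) the inverse of h
    has, under the uniform law on [0, t], the arc sine law, and the exponent is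
    again - t E ln (1 + l / G) ([wiener_gamma_representation]). *)

(** * Densities, laws and independence *)

Section density_measure.
Local Open Scope ereal_scope.
Context d (T : measurableType d) (R : realType).
Variables (mu : {measure set T -> \bar R}) (f : T -> R).

(** The measure with real density f with respect to mu; it serves both for
    reweighted probabilities and for laws on the line. *)
Definition density_measure of measurable_fun [set: T] f &
    (forall x, 0 <= f x)%R :=
  fun A : set T => \int[mu]_(x in A) (f x)%:E.

Variables (mf : measurable_fun [set: T] f) (f0 : (forall x, 0 <= f x)%R).

Let density_measure0 : density_measure mf f0 set0 = 0.
Proof. by rewrite /density_measure integral_set0. Qed.

Let density_measure_ge0 A : 0 <= density_measure mf f0 A.
Proof. by apply: integral_ge0 => x _; rewrite lee_fin. Qed.

Let density_measure_sigma_additive : semi_sigma_additive (density_measure mf f0).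
Proof.
by apply: semi_sigma_additive_nng_induced => //; exact/measurable_EFinP.
Qed.

HB.instance Definition _ := isMeasure.Build _ _ _ (density_measure mf f0)
  density_measure0 density_measure_ge0 density_measure_sigma_additive.

Import HBNNSimple.

Lemma ge0_integral_density_measure (h : T -> \bar R) :
  measurable_fun [set: T] h -> (forall x, 0 <= h x) ->
  \int[density_measure mf f0]_x h x = \int[mu]_x ((f x)%:E * h x).
Proof.
move=> mh h0; pose h_ := nnsfun_approx measurableT mh.
have hcvg x : EFin \o h_ ^~ x @ \oo --> h x by exact: cvg_nnsfun_approx.
have mfE : measurable_fun [set: T] (EFin \o f) by exact/measurable_EFinP.
transitivity (limn (fun n => \int[density_measure mf f0]_x (h_ n x)%:E)).
  rewrite -monotone_convergence//=.
  - by apply: eq_integral => x _; apply/esym/cvg_lim => //; exact: hcvg.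
  - by move=> n; apply/measurable_EFinP.
  - by move=> n x _; rewrite lee_fin.
  - by move=> x _ a b ab; rewrite lee_fin; exact/lefP/nd_nnsfun_approx.
transitivity (limn (fun n => \int[mu]_x ((f x)%:E * (h_ n x)%:E))); last first.
  rewrite -monotone_convergence//=.
  - apply: eq_integral => x _; apply/cvg_lim => //.
    by apply: cvgeZl => //; exact: hcvg.
  - by move=> n; apply: emeasurable_funM => //; apply/measurable_EFinP.
  - by move=> n x _; rewrite mule_ge0// lee_fin.
  - move=> x _ a b ab; apply: lee_wpmul2l; first by rewrite lee_fin.
    by rewrite lee_fin; exact/lefP/nd_nnsfun_approx.
congr (limn _); apply/funext => n.
have key (r : R) :
    \int[density_measure mf f0]_x (r * \1_(h_ n @^-1` [set r]) x)%:E =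
    \int[mu]_x ((f x)%:E * (r * \1_(h_ n @^-1` [set r]) x)%:E).
  rewrite integralZl_indic_nnsfun//= integral_indic// setIT.
  have [r0|r0] := ltP r 0%R.
    rewrite preimage_nnfun0// measure0 mule0 integral0_eq// => x _.
    by rewrite indic0 mulr0 mule0.
  under eq_integral do rewrite EFinM muleCA.
  rewrite ge0_integralZl//; last 2 first.
  - by apply: emeasurable_funM => //; exact/measurable_EFinP.
  - by move=> x _; rewrite mule_ge0// lee_fin.
  congr (_ * _).
  transitivity (\int[mu]_(x in h_ n @^-1` [set r]) (f x)%:E) => //.
  rewrite integral_mkcond.
  by apply: eq_integral => x _; rewrite epatch_indic.
rewrite [LHS](eq_integral (fun x => \sum_(r \in range (h_ n))
    (r * \1_(h_ n @^-1` [set r]) x)%:E)); last first.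
  by move=> x _; rewrite [in LHS]fimfunE -fsumEFin.
rewrite ge0_integral_fsum//; last 2 first.
  - by move=> r; apply/measurable_EFinP; do 2 apply/measurableT_comp => //.
  - by move=> r x _; rewrite EFinM nnfun_muleindic_ge0.
rewrite [RHS](eq_integral (fun x => \sum_(r \in range (h_ n))
    ((f x)%:E * (r * \1_(h_ n @^-1` [set r]) x)%:E))); last first.
  move=> x _; rewrite [in LHS]fimfunE -fsumEFin// ge0_mule_fsumr//.
  by move=> r; rewrite EFinM nnfun_muleindic_ge0.
rewrite [RHS]ge0_integral_fsum//; last 2 first.
  - move=> r; apply: emeasurable_funM => //.
    by apply/measurable_EFinP; do 2 apply/measurableT_comp => //.
  - move=> r x _; rewrite mule_ge0// ?lee_fin// -lee_fin EFinM.
    exact: nnfun_muleindic_ge0.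
by apply: eq_fsbigr => r _; exact: key.
Qed.

End density_measure.

Section laws.
Local Open Scope ereal_scope.
Context (R : realType).
Notation mu := (@lebesgue_measure R).

Lemma integral_density d (T : measurableType d) (P : probability T R)
    (X : {RV P >-> R}) (f : R -> R) (h : R -> \bar R) :
  has_density P X f -> measurable_fun [set: R] f -> (forall x, 0 <= f x)%R ->
  measurable_fun [set: R] h -> (forall x, 0 <= h x) ->
  \int[P]_w h (X w) = \int[mu]_x ((f x)%:E * h x).
Proof.
move=> Xf mf f0 mh h0.
have mX : measurable_fun [set: T] (X : T -> measurableTypeR R).
  exact: (measurable_funPT X).
rewrite -(ge0_integral_density_measure mu mf f0)//.
transitivity (\int[pushforward P (X : T -> measurableTypeR R)]_y h y).
  by rewrite ge0_integral_pushforward.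
by apply: eq_measure_integral => A mA _; exact: Xf.
Qed.

Lemma integral_eq_law d1 (T1 : measurableType d1) (P : probability T1 R)
    d2 (T2 : measurableType d2) (Q : probability T2 R)
    (X : {RV P >-> R}) (Y : {RV Q >-> R}) (h : R -> \bar R) :
  eq_law P X Q Y -> measurable_fun [set: R] h -> (forall x, 0 <= h x) ->
  \int[P]_w h (X w) = \int[Q]_w h (Y w).
Proof.
move=> XY mh h0.
rewrite -(@ge0_integral_distribution _ _ _ _ _ P X h)//.
rewrite -(@ge0_integral_distribution _ _ _ _ _ Q Y h)//.
by apply: eq_measure_integral => A mA _; exact: XY.
Qed.

(** The law of the pair is the product of the marginal laws: both agree on
    rectangles. *)
Lemma integral_independent2 d (T : measurableType d) (P : probability T R)
    (X Y : {RV P >-> R}) (h : R * R -> \bar R) :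
  independent2 P X Y ->
  measurable_fun [set: R * R] h -> (forall x, 0 <= h x) ->
  \int[P]_w h (X w, Y w) = \int[P]_w \int[P]_w' h (X w, Y w').
Proof.
move=> XY mh h0.
have mXY : measurable_fun [set: T] (fun w => (X w, Y w)).
  by apply: measurable_fun_pair.
pose XYm : {mfun T >-> (R * R)%type} :=
  HB.pack (fun w => (X w, Y w)) (isMeasurableFun.Build _ _ _ _ _ mXY).
transitivity (\int[distribution P XYm]_z h z).
  by rewrite ge0_integral_distribution.
transitivity (\int[(distribution P X \x distribution P Y)%E]_z h z).
  apply: eq_measure_integral => A mA _; apply/esym.
  have rect B C : measurable B -> measurable C -> distribution P XYm (B `*` C) =
      distribution P X B * distribution P Y C by move=> mB mC; exact: XY.
  exact: (@product_measure_unique _ _ _ _ _ (distribution P X) (distribution P Y)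
    (distribution P XYm) rect A mA).
rewrite fubini_tonelli1//.
have mF : measurable_fun [set: R] (fubini_F (distribution P Y) h).
  exact: measurable_fun_fubini_tonelli_F.
rewrite [LHS](@ge0_integral_distribution _ _ _ _ _ P X)//; last first.
  by move=> x; apply: integral_ge0.
apply: eq_integral => w _ /=.
rewrite /fubini_F (@ge0_integral_distribution _ _ _ _ _ P Y (fun y => h (X w, y)))//.
by apply: measurableT_comp => //; exact: pair1_measurable.
Qed.

End laws.

(** The rays ]a, +oo[ generate the Borel sets, are stable under intersection and
    exhaust the line. *)
Lemma measure_ray_unique (R : realType) (m1 m2 : {measure set R -> \bar R}) :
  (m1 [set: R] < +oo)%E ->
  (forall a : R, m1 `]a, +oo[%classic = m2 `]a, +oo[%classic) ->
  forall A, measurable A -> m1 A = m2 A.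
Proof.
move=> m1y m12 A mA.
apply: (measure_unique (@RGenOInfty.G R)
  (fun n => `](- n%:R : R), +oo[%classic)) => //.
- exact: RGenOInfty.measurableE.
- move=> _ _ [x ->] [y ->]; exists (Num.max x y).
  apply/seteqP; split => z /=; rewrite !in_itv/= !andbT gt_max.
    by move=> [-> ->].
  by move=> /andP[].
- by move=> n; exists (- n%:R).
- apply/seteqP; split => // x _; exists (Num.truncn `|x|).+1 => //=.
  rewrite in_itv/= andbT ltrNl.
  by rewrite (le_lt_trans (ler_norm _))// normrN truncnS_gt.
- by move=> _ [x ->].
- by move=> n; rewrite (le_lt_trans _ m1y)// le_measure ?inE.
Qed.

(** * Uniqueness of Laplace transforms on the half-line *)

Section soft_threshold.
Context (R : realType).
Implicit Types (a x e : R) (n : nat).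

Let bernoulli e n : 0 <= e <= 1 -> 1 - n%:R * e <= (1 - e) ^+ n.
Proof.
move=> /andP[e0 e1]; elim: n => [|n ih]; first by rewrite mul0r subr0 expr0.
have ne0 : 0 <= n%:R * e by rewrite mulr_ge0.
rewrite exprS -natr1.
have : (1 - e) * (1 - n%:R * e) <= (1 - e) * (1 - e) ^+ n.
  by rewrite ler_wpM2l// subr_ge0.
by apply: le_trans; nra.
Qed.

(** With N about n e^(n a), the quantity (1 - e^(-n x))^N is close to
    exp (- n e^(n (a - x))), which switches from 0 to 1 at x = a, and it is a
    polynomial in e^(-x). *)
Definition soft_threshold a n x : R :=
  (1 - expR (- x) ^+ n) ^+ Num.truncn (n%:R * expR (n%:R * a)).

Lemma soft_threshold_bounds a n x : 0 <= x -> 0 <= soft_threshold a n x <= 1.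
Proof.
move=> x0; have e1 : expR (- x) ^+ n <= 1.
  by rewrite exprn_ile1 ?expR_ge0// expR_le1 oppr_le0.
have e0 : 0 <= expR (- x) ^+ n by rewrite exprn_ge0 ?expR_ge0.
by rewrite /soft_threshold exprn_ge0 ?subr_ge0//= exprn_ile1 ?subr_ge0// gerBl.
Qed.

(** For x > a, Bernoulli's inequality bounds 1 - (1 - e)^N by N e, which is at
    most n e^(- n (x - a)); for x <= a, (1 - e)^N <= e^(- N e) <= 1 / (1 + N e)
    with N e of order at least n. *)
Lemma cvg_soft_threshold a x : 0 <= a -> 0 <= x ->
  soft_threshold a n x @[n --> \oo] --> ((a < x)%R%:R : R).
Proof.
move=> a0 x0.
have e01 n : 0 <= expR (- x) ^+ n <= 1.
  by rewrite exprn_ge0 ?expR_ge0//= exprn_ile1 ?expR_ge0// expR_le1 oppr_le0.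
have cvg_harm (k : R) : k * n.+1%:R^-1 @[n --> \oo] --> (0 : R).
  by rewrite -(mulr0 k); apply: cvgMr; exact: cvg_harmonic.
rewrite -(cvg_shiftS (fun n => soft_threshold a n x)).
have expE n : expR (- x) ^+ n = expR (- (n%:R * x)).
  by rewrite -expRM_natl mulrN.
case: ltP => [ax|xa] /=.
  (* n e^(- n (x - a)) <= k / n, since e^y >= y^2 / 2 *)
  pose k := 2 / (x - a) ^+ 2.
  have xa0 : 0 < x - a by rewrite subr_gt0.
  apply: (@squeeze_cvgr _ _ _ _ (fun n => 1 - k * n.+1%:R^-1) (cst 1)).
  - apply: nearW => n /=.
    have /andP[_ ->] := soft_threshold_bounds a n.+1 x0; rewrite andbT.
    apply: (le_trans _ (bernoulli _ (e01 _))); rewrite lerD2l lerN2 expE.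
    have n0 : 0 < (n.+1%:R : R) by [].
    apply: (@le_trans _ _ (n.+1%:R * expR (n.+1%:R * a) * expR (- (n.+1%:R * x)))).
      rewrite ler_wpM2r ?expR_ge0// truncn_le.
      by rewrite mulr_ge0 ?expR_ge0.
    rewrite -mulrA -expRD -mulrBr -opprB mulrN expRN.
    rewrite ler_pdivrMr ?expR_gt0//.
    have : (n.+1%:R * (x - a)) ^+ 2 / 2 <= expR (n.+1%:R * (x - a)).
      apply: le_trans (@expR_ge1Dxn R _ 1%N _); last by rewrite mulr_ge0// ltW.
      by rewrite lerDr.
    move=> h; apply: le_trans (ler_wpM2l _ h); last first.
      by rewrite /k !mulr_ge0 ?invr_ge0 ?exprn_ge0// ltW.
    rewrite le_eqVlt; apply/orP; left; apply/eqP; rewrite /k; field.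
    by rewrite gt_eqF//= lt0r_neq0.
  - by rewrite -[X in _ --> X]subr0; apply: cvgB; [exact: cvg_cst|exact: cvg_harm].
  - exact: cvg_cst.
apply: (@squeeze_cvgr _ _ _ _ (cst 0) (fun n => 1 * n.+1%:R^-1)).
- apply: nearW => n /=.
  have /andP[-> _] /= := soft_threshold_bounds a n.+1 x0; rewrite mul1r.
  have n0 : 0 < (n.+1%:R : R) by [].
  set N := Num.truncn (n.+1%:R * expR (n.+1%:R * a)).
  set e := expR (- x) ^+ n.+1.
  have Ne : n.+1%:R <= 1 + N%:R * e.
    have : n.+1%:R * expR (n.+1%:R * a) - 1 <= N%:R.
      rewrite lerBlDr natr1 ltW// truncnS_gt//.
    have /andP[e0 e1] := e01 n.+1; rewrite -/e in e0 e1.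
    move=> /(ler_wpM2r e0); rewrite mulrBl mul1r.
    suff : n.+1%:R <= n.+1%:R * expR (n.+1%:R * a) * e.
      move: (n.+1%:R * expR _ * e) => u; lra.
    rewrite -mulrA ler_peMr// /e expE -expRD -mulrBr.
    by rewrite -expR0 ler_expR mulr_ge0// subr_ge0.
  have : (1 - e) ^+ N <= expR (- (N%:R * e)).
    rewrite -mulrN expRM_natl lerXn2r ?nnegrE ?subr_ge0 ?expR_ge0//.
      by have /andP[] := e01 n.+1.
    exact: expR_ge1Dx.
  move=> /le_trans; apply; rewrite expRN lef_pV2 ?posrE ?expR_gt0//.
  by rewrite (le_trans Ne)// expR_ge1Dx.
- exact: cvg_cst.
- exact: cvg_harm.
Qed.

End soft_threshold.

Section laplace_unique.
Context (R : realType).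

Let integrable_expR_pow d (T : measurableType d) (m : {measure set T -> \bar R})
    (X : {mfun T >-> R}) n : (m [set: T] < +oo)%E -> (forall w, 0 <= X w) ->
  m.-integrable [set: T] (fun w => (expR (- X w) ^+ n)%:E).
Proof.
move=> my X0.
apply: measurable_bounded_integrable => //.
- by apply: measurable_funX; apply: measurableT_comp => //; exact: measurable_funN.
- exists 1; split => // M M1 w _ /=.
  rewrite ger0_norm ?exprn_ge0 ?expR_ge0// (le_trans _ (ltW M1))//.
  by rewrite exprn_ile1 ?expR_ge0// expR_le1 oppr_le0.
Qed.

Let integral_poly_expR d (T : measurableType d) (m : {measure set T -> \bar R})
    (X : {mfun T >-> R}) (p : {poly R}) :
  (m [set: T] < +oo)%E -> (forall w, 0 <= X w) ->
  (\int[m]_w (p.[expR (- X w)])%:E =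
   \sum_(i < size p) (p`_i)%:E * \int[m]_w (expR (- X w) ^+ i)%:E)%E.
Proof.
move=> my X0.
transitivity (\int[m]_w (\sum_(i < size p) (p`_i)%:E * (expR (- X w) ^+ i)%:E))%E.
  by apply: eq_integral => w _; rewrite horner_coef -sumEFin.
rewrite integral_sum//; last first.
  by move=> i; apply: integrableZl => //; exact: integrable_expR_pow.
by apply: eq_bigr => i _; rewrite integralZl//; exact: integrable_expR_pow.
Qed.

Let cvg_integral_soft_threshold d (T : measurableType d)
    (m : {measure set T -> \bar R}) (X : {mfun T >-> R}) (a : R) :
  (m [set: T] < +oo)%E -> (forall w, 0 <= X w) -> 0 <= a ->
  (\int[m]_w (soft_threshold a n (X w))%:E)%E @[n --> \oo] -->
  m (X @^-1` `]a, +oo[%classic).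
Proof.
move=> my X0 a0.
have mA : measurable (X @^-1` `]a, +oo[%classic).
  by rewrite -[_ @^-1` _]setTI; exact: measurable_funPT.
have -> : m (X @^-1` `]a, +oo[%classic) = (\int[m]_w ((a < X w)%R%:R : R)%:E)%E.
  rewrite -[X in m X]setIT -integral_indic//; apply: eq_integral => w _.
  rewrite indicE; congr (_%:R%:E); congr nat_of_bool.
  by apply/idP/idP; rewrite inE/= in_itv/= andbT.
have mst n : measurable_fun [set: T] (fun w => soft_threshold a n (X w)).
  apply: measurable_funX; apply: measurable_funB => //.
  by apply: measurable_funX; apply: measurableT_comp => //; exact: measurable_funN.
have mlim : measurable_fun [set: T] (fun w => ((a < X w)%R%:R : R)%:E).
  have := @measurable_indic _ T R [set: T] _ mA; move/measurable_EFinP.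
  apply: eq_measurable_fun => w _; rewrite /= indicE; congr (_%:R%:E).
  by congr nat_of_bool; apply/idP/idP; rewrite inE/= in_itv/= andbT.
have mfn n : measurable_fun [set: T] (fun w => (soft_threshold a n (X w))%:E).
  exact/measurable_EFinP.
have cvgf : {ae m, forall w, [set: T] w ->
    (fun n => (soft_threshold a n (X w))%:E) @ \oo --> ((a < X w)%R%:R : R)%:E}.
  apply: aeW => w _; apply: cvg_EFin; first exact: nearW.
  exact: cvg_soft_threshold.
have int1 : m.-integrable [set: T] (cst 1%E : T -> \bar R).
  apply: measurable_bounded_integrable => //.
  by exists 1; split => // M M1 w _ /=; rewrite normr1 ltW.
have bnd : {ae m, forall w n, [set: T] w ->
    (`|(soft_threshold a n (X w))%:E| <= (cst 1%E : T -> \bar R) w)%E}.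
  apply: aeW => w n _; rewrite lee_fin.
  have /andP[h0 h1] := soft_threshold_bounds a n (X0 w).
  by rewrite ger0_norm.
by have [] := dominated_convergence measurableT mfn mlim cvgf int1 bnd.
Qed.

(** Soft thresholds are polynomials in e^(-X), and their integrals converge to
    the masses of the rays. Hence the integer points of the Laplace transform
    already determine the law. *)
Lemma laplace_unique_ge0 d1 (T1 : measurableType d1)
    (m1 : {measure set T1 -> \bar R}) d2 (T2 : measurableType d2)
    (m2 : {measure set T2 -> \bar R}) (X : {mfun T1 >-> R}) (Y : {mfun T2 >-> R}) :
  (m1 [set: T1] < +oo)%E -> (forall w, 0 <= X w) -> (forall w, 0 <= Y w) ->
  (forall n : nat, \int[m1]_w (expR (- X w) ^+ n)%:E =
                   \int[m2]_w (expR (- Y w) ^+ n)%:E)%E ->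
  forall A, measurable A -> m1 (X @^-1` A) = m2 (Y @^-1` A).
Proof.
move=> m1y X0 Y0 XY.
have m12 : m1 [set: T1] = m2 [set: T2].
  have := XY 0%N; under eq_integral do rewrite expr0.
  under [in RHS]eq_integral do rewrite expr0.
  by rewrite !integral_cst// !mul1e.
have m2y : (m2 [set: T2] < +oo)%E by rewrite -m12.
suff : forall A, measurable A -> pushforward m1 X A = pushforward m2 Y A by [].
apply: measure_ray_unique => // a.
rewrite /pushforward; have [a0|a0] := leP 0 a; last first.
  transitivity (m1 [set: T1]).
    congr (m1 _); apply/seteqP; split => // w _ /=.
    by rewrite in_itv/= andbT (lt_le_trans a0).
  rewrite m12; congr (m2 _); apply/seteqP; split => // w _ /=.
  by rewrite in_itv/= andbT (lt_le_trans a0).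
have := cvg_integral_soft_threshold m1y X0 a0.
suff -> : (fun n => \int[m1]_w (soft_threshold a n (X w))%:E)%E =
          (fun n => \int[m2]_w (soft_threshold a n (Y w))%:E)%E.
  by move/cvg_unique; apply => //; exact: cvg_integral_soft_threshold.
apply/funext => n.
pose p : {poly R} := (1 - 'X ^+ n) ^+ Num.truncn (n%:R * expR (n%:R * a)).
have pE x : soft_threshold a n x = p.[expR (- x)].
  by rewrite /p /soft_threshold !hornerE.
under eq_integral do rewrite pE; under [in RHS]eq_integral do rewrite pE.
by rewrite !integral_poly_expR//; apply: eq_bigr => i _; rewrite XY.
Qed.

Lemma laplace_unique d1 (T1 : measurableType d1)
    (m1 : {measure set T1 -> \bar R}) d2 (T2 : measurableType d2)
    (m2 : {measure set T2 -> \bar R}) (X : {mfun T1 >-> R}) (Y : {mfun T2 >-> R}) :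
  (m1 [set: T1] < +oo)%E ->
  {ae m1, forall w, 0 <= X w} -> {ae m2, forall w, 0 <= Y w} ->
  (forall l : R, (0 <= l)%R -> \int[m1]_w (expR (- (l * X w)))%:E =
                          \int[m2]_w (expR (- (l * Y w)))%:E)%E ->
  forall A, measurable A -> m1 (X @^-1` A) = m2 (Y @^-1` A).
Proof.
move=> m1y X0 Y0 XY.
pose X' := max_mfun (cst 0) X; pose Y' := max_mfun (cst 0) Y.
have aeX : {ae m1, forall w, X' w = X w}.
  by apply: filterS X0 => w Xw; rewrite /X' /=; exact/max_r.
have aeY : {ae m2, forall w, Y' w = Y w}.
  by apply: filterS Y0 => w Yw; rewrite /Y' /=; exact/max_r.
have preim d (T : measurableType d) (m : {measure set T -> \bar R})
    (Z Z' : {mfun T >-> R}) A : measurable A -> {ae m, forall w, Z' w = Z w} ->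
    m (Z @^-1` A) = m (Z' @^-1` A).
  move=> mA ZZ'.
  have mZ (U : {mfun T >-> R}) : measurable (U @^-1` A).
    by rewrite -[_ @^-1` _]setTI; exact: measurable_funPT.
  rewrite -[X in m X]setIT -[X in _ = m X]setIT.
  rewrite -!integral_indic//; apply: ae_eq_integral => //.
  - by apply/measurable_EFinP; exact: measurable_indic.
  - by apply/measurable_EFinP; exact: measurable_indic.
  - apply: filterS ZZ' => w ZZ _; rewrite !indicE; congr (_%:R%:E).
    by congr nat_of_bool; apply/idP/idP; rewrite !inE/= ZZ.
move=> A mA; rewrite (preim _ _ _ _ X')// (preim _ _ _ _ Y')//.
apply: laplace_unique_ge0 => //.
- by move=> w; rewrite /X' /= le_max lexx.
- by move=> w; rewrite /Y' /= le_max lexx.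
move=> n; have aei d (T : measurableType d) (m : {measure set T -> \bar R})
    (Z Z' : {mfun T >-> R}) : {ae m, forall w, Z' w = Z w} ->
    (\int[m]_w (expR (- Z' w) ^+ n)%:E = \int[m]_w (expR (- (n%:R * Z w)))%:E)%E.
  move=> ZZ'; apply: ae_eq_integral => //.
  - apply/measurable_EFinP; apply: measurable_funX; apply: measurableT_comp => //.
    exact: measurable_funN.
  - apply/measurable_EFinP; apply: measurableT_comp => //.
    by apply: measurable_funN => //; exact: measurable_funM.
  - by apply: filterS ZZ' => w ZZ _; rewrite ZZ -expRM_natl mulrN.
by rewrite (aei _ _ _ X X')// (aei _ _ _ Y Y')// XY.
Qed.

End laplace_unique.

(** * Changes of variable and improper integrals *)

Section lebesgue_tools.
Context (R : realType).
Notation mu := (@lebesgue_measure R).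

Lemma measurable_invr : measurable_fun [set: R] (GRing.inv : R -> R).
Proof.
rewrite (_ : GRing.inv = (fun x : R =>
    if 0 <= x then x `^ (-1) else - ((- x) `^ (-1)))); last first.
  apply/funext => x; case: ifPn => [x0|]; first by rewrite powR_inv1.
  by rewrite -ltNge => x0; rewrite powR_inv1 ?oppr_ge0 1?ltW// invrN opprK.
apply: measurable_fun_ifT.
- by apply: measurable_fun_ler.
- exact: measurable_powR.
- apply: measurable_funN; apply: (measurableT_comp (@measurable_powR R (-1))).
  exact: measurable_funN.
Qed.

Lemma measurable_affine (c b : R) :
  measurable_fun [set: R] (fun x : R => c * x + b).
Proof. by apply: measurable_funD => //; exact: measurable_funM. Qed.

Lemma lebesgue_measure_affine (c b : R) (A : set R) : 0 < c -> measurable A ->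
  mu A = (c%:E * mu ((fun x : R => (c * x + b)%R) @^-1` A))%E.
Proof.
move=> c0 mA.
have mf : measurable_fun [set: measurableTypeR R]
    ((fun x => (c * x + b)%R) : measurableTypeR R -> measurableTypeR R).
  exact: measurable_affine.
pose k : {nonneg R} := NngNum (ltW c0).
pose pf := measure_function_pushforward__canonical__measure_function_Measure mu mf.
transitivity (mscale k pf A) => //.
apply: lebesgue_measure_unique => // _ [[u v]] _ <- /=.
rewrite /mscale /= /pushforward.
rewrite (_ : _ @^-1` _ = `](u - b) / c, (v - b) / c]%classic); last first.
  apply/seteqP; split => x /=; rewrite !in_itv/= ltr_pdivrMr// ler_pdivlMr//;
  by rewrite ltrBlDr lerBrDr (mulrC x).
rewrite !lebesgue_measure_itv/= !lte_fin ltr_pM2r ?invr_gt0// ltrD2r.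
case: ifPn => // uv; last by rewrite mule0.
rewrite -!EFinB -EFinM; congr (_%:E); field.
by rewrite gt_eqF.
Qed.

Lemma ge0_integral_affine (c b : R) (h : R -> \bar R) : 0 < c ->
  measurable_fun [set: R] h -> (forall x, 0 <= h x)%E ->
  (\int[mu]_x h x = c%:E * \int[mu]_x h (c * x + b)%R)%E.
Proof.
move=> c0 mh h0.
have mf : measurable_fun [set: measurableTypeR R]
    ((fun x => (c * x + b)%R) : measurableTypeR R -> measurableTypeR R).
  exact: measurable_affine.
pose k : {nonneg R} := NngNum (ltW c0).
pose pf := measure_function_pushforward__canonical__measure_function_Measure mu mf.
transitivity (\int[mscale k pf]_x h x)%E.
  by apply: eq_measure_integral => A mA _; exact: lebesgue_measure_affine.
by rewrite ge0_integral_mscale//= ge0_integral_pushforward.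
Qed.

(** The integrand may be unbounded at a, as arc sine and power densities are;
    monotone convergence reduces this to the compact intervals [s n, b] with
    s n decreasing to a. *)
Lemma ge0_improper_FTC (f F : R -> R) (a b : R) : a < b ->
  {in `]a, b], forall x, 0 <= f x} ->
  {in `]a, b], continuous f} ->
  F x @[x --> a^'+] --> F a ->
  {in `]a, b], forall x, derivable F x 1 /\ F^`()%classic x = f x} ->
  (\int[mu]_(x in `]a, b]) (f x)%:E = (F b - F a)%:E)%E.
Proof.
move=> ab f0 cf Fa dF.
(* n.+2 rather than n.+1 keeps s n strictly below b *)
pose s n : R := a + (b - a) / n.+2%:R.
have ba0 : 0 < b - a by rewrite subr_gt0.
have as_ n : a < s n by rewrite ltrDl divr_gt0.
have sb n : s n < b.
  by rewrite /s -ltrBrDl ltr_pdivrMr// ltr_pMr// ltr1n.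
have sub n x : s n <= x <= b -> x \in `]a, b].
  by move=> /andP[sx xb]; rewrite in_itv/= xb andbT (lt_le_trans (as_ n)).
have cF n x : s n <= x <= b -> {for x, continuous F}.
  move=> /sub /dF [dFx _].
  exact/differentiable_continuous/derivable1_diffP.
have ss : `]a, b]%classic = \bigcup_n `[s n, b]%classic.
  apply/seteqP; split => x /=; last by move=> [n _]; rewrite /= in_itv/= => /sub.
  rewrite in_itv/= => /andP[ax xb].
  exists (Num.truncn ((b - a) / (x - a))) => //=; rewrite in_itv/= xb andbT.
  rewrite /s -lerBrDl ler_pdivrMr// mulrC -ler_pdivrMr ?subr_gt0//.
  by rewrite ltW// (lt_trans (truncnS_gt _))// ltr_nat.
have ms n : measurable_fun `[s n, b] (EFin \o f).
  apply/measurable_EFinP; apply: subspace_continuous_measurable_fun => //.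
  apply: continuous_in_subspaceT => x; rewrite inE/= in_itv/= => xs.
  by apply: cf; exact: sub xs.
have ints n : (\int[mu]_(x in `[s n, b]) (f x)%:E = (F b - F (s n))%:E)%E.
  rewrite EFinB; apply: continuous_FTC2 => //.
  - apply: continuous_in_subspaceT => x; rewrite inE/= in_itv/= => xs.
    by apply: cf; exact: sub xs.
  - split.
    + move=> x; rewrite in_itv/= => /andP[x1 x2].
      by have /dF [] : x \in `]a, b] by apply: (sub n); rewrite !ltW.
    + by apply: cvg_at_right_filter; apply: (cF n); rewrite lexx ltW.
    + by apply: cvg_at_left_filter; apply: (cF n); rewrite lexx ltW.
  - move=> x; rewrite in_itv/= => /andP[x1 x2].
    by have /dF [] : x \in `]a, b] by apply: (sub n); rewrite !ltW.
rewrite ss.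
have snd : nondecreasing_seq (fun n => `[s n, b]%classic).
  move=> m n mn; apply/subsetPset => x /=; rewrite !in_itv/= => /andP[smx ->].
  rewrite andbT (le_trans _ smx)// lerD2l ler_pM2l// lef_pV2 ?posrE//.
  by rewrite ler_nat !ltnS.
have := @ge0_nondecreasing_set_cvg_integral _ (measurableTypeR R) R (fun n => `[s n, b]%classic)
  (EFin \o f) mu snd (fun n => measurable_itv _) ms.
move=> /(_ (fun n x xs => f0 x (sub n x xs))) h.
apply: (cvg_unique _ h) => //.
have -> : (fun n => \int[mu]_(x in `[s n, b]) (EFin \o f) x)%E =
  (fun n => (F b - F (s n))%:E) by apply/funext => n; exact: ints.
apply: cvg_EFin; first exact: nearW.
apply: cvgB; first exact: cvg_cst.
apply: (proj1 (cvg_at_rightP _ _ _) Fa s); split => //.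
rewrite /s -[X in _ --> X]addr0; apply: cvgD; first exact: cvg_cst.
rewrite -(mulr0 (b - a)); apply: cvgMr.
rewrite (cvg_shiftS (fun n => n.+1%:R^-1 : R)); exact: cvg_harmonic.
Qed.

End lebesgue_tools.

(** * Beta-gamma algebra *)

Section gamma_beta.
Context (R : realType).
Notation mu := (@lebesgue_measure R).
Implicit Types a b c x : R.

Lemma integral_gt0_itv01 (f : R -> R) : measurable_fun [set: R] f ->
  (forall x, 0 <= f x) -> (forall x, 0 < x < 1 -> 0 < f x) ->
  (0 < \int[mu]_x (f x)%:E)%E.
Proof.
move=> mf f0 fp; rewrite lt0e integral_ge0 ?andbT//; last first.
  by move=> x _; rewrite lee_fin.
apply/negP => /eqP h.
have : (\int[mu]_x `|(f x)%:E| = 0)%E.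
  by rewrite -[RHS]h; apply: eq_integral => x _; rewrite gee0_abs ?lee_fin.
move=> /(ae_eq_integral_abs mu measurableT (proj2 (measurable_EFinP _ _) mf)).
move=> [N [mN N0 sN]].
have : (mu `]0%R, 1%R[%classic <= mu N)%E.
  apply: le_measure; rewrite ?inE//; move=> x; rewrite /= in_itv/= => x01.
  by apply: sN => /= /(_ I) [] /eqP; rewrite gt_eqF// fp.
by rewrite N0 lebesgue_measure_itv/= lte01 oppr0 adde0 lee_fin ler10.
Qed.

Lemma integral_expRN c : 0 < c ->
  (\int[mu]_(x in `]0%R, +oo[) (expR (- (c * x)))%:E = (c^-1)%:E)%E.
Proof.
move=> c0; have mE D : measurable_fun D (fun x : R => (expR (- (c * x)))%:E).
  apply: measurable_funTS; apply/measurable_EFinP; apply: measurableT_comp => //.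
  by apply: measurable_funN; exact: measurable_funM.
have := integral_exponential_pdf c0; rewrite /exponential_pdf => h.
rewrite integral_itv_obnd_cbnd; last exact: mE.
have -> : (\int[mu]_(x in `[0%R, +oo[) (expR (- (c * x)))%:E =
    (c^-1)%:E * \int[mu]_(x in `[0%R, +oo[) (c * expR (- c * x))%:E)%E.
  rewrite -ge0_integralZl//; first last.
  - by rewrite lee_fin invr_ge0 ltW.
  - by move=> x _; rewrite lee_fin mulr_ge0 ?expR_ge0 ?ltW.
  - apply: measurable_funTS; apply/measurable_EFinP; apply: measurable_funM => //.
    by apply: measurableT_comp => //; exact: measurable_funM.
  by apply: eq_integral => x _; rewrite -EFinM mulKf ?gt_eqF// mulNr.
rewrite -[RHS]mule1 -h; congr (_ * _)%E; rewrite [LHS]integral_mkcond.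
by apply: eq_integral => x _; rewrite /patch; case: ifPn.
Qed.

Lemma integral_powRB1 a : 0 < a ->
  (\int[mu]_(x in `]0%R, 1%R]) (x `^ (a - 1))%:E = (a^-1)%:E)%E.
Proof.
move=> a0; rewrite (@ge0_improper_FTC R (@powR R ^~ (a - 1)) (fun x => a^-1 * x `^ a) 0 1)//.
- by rewrite powR1 powR0 ?gt_eqF// mulr0 subr0 mulr1.
- by move=> x _; exact: powR_ge0.
- move=> x; rewrite in_itv/= => /andP[x0 _].
  apply/differentiable_continuous/derivable1_diffP.
  by apply: derivable_powR; rewrite in_itv/= x0.
- rewrite powR0 ?gt_eqF// mulr0 -[X in _ --> X](mulr0 a^-1).
  by apply: cvgMr; exact: powR_cvg0.
- move=> x; rewrite in_itv/= => /andP[x0 _].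
  have x0' : x \in `]0, +oo[ by rewrite in_itv/= x0.
  have dpow : derivable (@powR R ^~ a) x 1 by exact: derivable_powR.
  split; first exact: derivableZ.
  by rewrite derive1E deriveZ// -derive1E powR_derive1// /GRing.scale/= mulKf ?gt_eqF.
Qed.

(** The gamma density without its normalising constant, since
    integrals against it are computed before Gamma (a) is known to be positive. *)
Definition gamma_kernel a x : R :=
  x `^ (a - 1) * expR (- x) * \1_(`]0, +oo[%classic : set R) x.

Lemma measurable_gamma_kernel a : measurable_fun [set: R] (gamma_kernel a).
Proof.
apply: measurable_funM; last exact: measurable_indic.
apply: measurable_funM; first exact: measurable_powR.
by apply: measurableT_comp => //; exact: measurable_funN.
Qed.

Lemma gamma_kernel_ge0 a x : 0 <= gamma_kernel a x.
Proof. by rewrite !mulr_ge0 ?powR_ge0 ?expR_ge0. Qed.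

Lemma gamma_kernel_gt0 a x : 0 < x ->
  gamma_kernel a x = x `^ (a - 1) * expR (- x).
Proof.
by move=> x0; rewrite /gamma_kernel indicE mem_set ?mulr1//= in_itv/= x0.
Qed.

Lemma gamma_kernel_le0 a x : x <= 0 -> gamma_kernel a x = 0.
Proof.
move=> x0; rewrite /gamma_kernel indicE memNset ?mulr0//= in_itv/= andbT.
by apply/negP; rewrite -leNgt.
Qed.

(** Near 0 the kernel is bounded by x^(a-1); beyond 1, x^n is bounded by
    2^n n! e^(x/2), which leaves e^(-x/2). *)
Lemma gamma_kernel_lty a : 0 < a -> (\int[mu]_x (gamma_kernel a x)%:E < +oo)%E.
Proof.
move=> a0; pose n := (Num.truncn (a - 1)).+1.
(* from (x / 2)^n / n! <= e^(x/2) *)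
pose C : R := 2 ^+ n * n`!%:R.
pose f1 x : R := x `^ (a - 1) * \1_(`]0, 1]%classic : set R) x.
pose f2 x : R := C * (expR (- (2^-1 * x)) * \1_(`]0, +oo[%classic : set R) x).
have mf1 : measurable_fun [set: R] f1.
  apply: measurable_funM; last exact: measurable_indic.
  exact: measurable_powR.
have mf2 : measurable_fun [set: R] f2.
  apply: measurable_funM => //.
  apply: measurable_funM; last exact: measurable_indic.
  apply: measurableT_comp => //; apply: measurable_funN; exact: measurable_funM.
have f10 x : 0 <= f1 x by rewrite mulr_ge0 ?powR_ge0.
have C0 : 0 <= C by rewrite mulr_ge0 ?exprn_ge0.
have f20 x : 0 <= f2 x by rewrite !mulr_ge0 ?expR_ge0.
have le12 x : gamma_kernel a x <= f1 x + f2 x.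
  have [x0|x0] := leP x 0.
    by rewrite gamma_kernel_le0// addr_ge0.
  have e1 : expR (- x) <= 1 by rewrite expR_le1 oppr_le0 ltW.
  rewrite gamma_kernel_gt0//; have [x1|x1] := leP x 1.
    rewrite ler_wpDr// /f1 indicE mem_set; last by rewrite /= in_itv/= x0.
    by rewrite ler_wpM2l ?powR_ge0.
  rewrite ler_wpDl// /f2 indicE mem_set; last by rewrite /= in_itv/= x0.
  rewrite mulr1.
  have -> : expR (- x) = expR (- (2^-1 * x)) * expR (- (2^-1 * x)).
    by rewrite -expRD; congr expR; lra.
  rewrite mulrA ler_wpM2r ?expR_ge0// expRN ler_pdivrMr ?expR_gt0//.
  apply: (@le_trans _ _ (x ^+ n)).
    have -> : x ^+ n = x `^ n%:R by rewrite powR_mulrn// ltW.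
    apply: ler_powR; first exact: ltW.
    by rewrite /n ltW// truncnS_gt.
  apply: (@le_trans _ _ (C * ((2^-1 * x) ^+ n / n`!%:R))); last first.
    rewrite ler_wpM2l//; apply: le_trans (@expR_ge1Dxn R _ (Num.truncn (a - 1)) _); last first.
      by rewrite mulr_ge0// ltW.
    by rewrite lerDr.
  rewrite le_eqVlt; apply/orP; left; apply/eqP; rewrite /C exprMn exprVn.
  by field; rewrite !lt0r_neq0 ?exprn_gt0 ?ltr0n ?fact_gt0.
apply: (@le_lt_trans _ _ (\int[mu]_x ((f1 x)%:E + (f2 x)%:E))%E).
  apply: ge0_le_integral => //.
  - by move=> x _; rewrite lee_fin gamma_kernel_ge0.
  - by apply/measurable_EFinP; exact: measurable_gamma_kernel.
  - by apply: emeasurable_funD; exact/measurable_EFinP.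
  - by move=> x _; rewrite -EFinD lee_fin.
rewrite ge0_integralD//; try exact/measurable_EFinP; try by move=> x _; rewrite lee_fin.
have -> : (\int[mu]_x (f1 x)%:E = (a^-1)%:E)%E.
  rewrite -integral_powRB1// [RHS]integral_mkcond.
  by apply: eq_integral => x _; rewrite epatch_indic -EFinM.
have -> : (\int[mu]_x (f2 x)%:E = (C * 2)%R%:E)%E.
  under eq_integral do rewrite EFinM.
  rewrite ge0_integralZl//.
  - have := @integral_expRN 2^-1; rewrite invrK invr_gt0 => /(_ (ltr0Sn _ 1)) e2.
    rewrite [RHS]EFinM -e2.
    congr (_ * _)%E; rewrite [RHS]integral_mkcond.
    by apply: eq_integral => x _; rewrite epatch_indic -EFinM.
  - apply/measurable_EFinP; apply: measurable_funM; last exact: measurable_indic.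
    apply: measurableT_comp => //; apply: measurable_funN; exact: measurable_funM.
by rewrite lte_add_pinfty ?ltry.
Qed.

Lemma integral_gamma_kernel a : 0 < a ->
  (\int[mu]_x (gamma_kernel a x)%:E = (gamma_fun a)%:E)%E.
Proof.
move=> a0; rewrite /gamma_fun /Rintegral.
have -> : (\int[mu]_(x in `]0%R, +oo[) (x `^ (a - 1) * expR (- x))%:E =
    \int[mu]_x (gamma_kernel a x)%:E)%E.
  by rewrite integral_mkcond; apply: eq_integral => x _; rewrite epatch_indic -EFinM.
rewrite fineK// ge0_fin_numE ?gamma_kernel_lty//.
by apply: integral_ge0 => x _; rewrite lee_fin gamma_kernel_ge0.
Qed.

Lemma gamma_fun_gt0 a : 0 < a -> 0 < gamma_fun a.
Proof.
move=> a0; rewrite -lte_fin -integral_gamma_kernel//.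
apply: integral_gt0_itv01; first exact: measurable_gamma_kernel.
  exact: gamma_kernel_ge0.
by move=> x /andP[x0 _]; rewrite gamma_kernel_gt0// mulr_gt0 ?powR_gt0 ?expR_gt0.
Qed.

Definition beta_kernel a b x : R :=
  x `^ (a - 1) * (1 - x) `^ (b - 1) * \1_(`]0, 1[%classic : set R) x.

Lemma measurable_beta_kernel a b : measurable_fun [set: R] (beta_kernel a b).
Proof.
apply: measurable_funM; last exact: measurable_indic.
apply: measurable_funM; first exact: measurable_powR.
apply: (measurableT_comp (@measurable_powR R _)).
exact: measurable_funB.
Qed.

Lemma beta_kernel_ge0 a b x : 0 <= beta_kernel a b x.
Proof. by rewrite !mulr_ge0 ?powR_ge0. Qed.

Lemma beta_kernel_in a b x : 0 < x < 1 ->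
  beta_kernel a b x = x `^ (a - 1) * (1 - x) `^ (b - 1).
Proof.
by move=> x0; rewrite /beta_kernel indicE mem_set ?mulr1//= in_itv/= x0.
Qed.

Lemma beta_kernel_out a b x : ~~ (0 < x < 1) -> beta_kernel a b x = 0.
Proof.
move=> x0; rewrite /beta_kernel indicE memNset ?mulr0//= in_itv/=.
exact/negP.
Qed.

(** The Jacobian identity of the change of variable
    (x, y) = (s (1 - v), s v). *)
Lemma gamma_beta_kernel a c s v :
  s * (gamma_kernel a (s * (1 - v)) * gamma_kernel c (s * v)) =
  gamma_kernel (a + c) s * beta_kernel c a v.
Proof.
have [s0|s0] := leP s 0.
  rewrite [gamma_kernel (a + c) s]gamma_kernel_le0// mul0r.
  have [v0|v0] := leP v 0.
    rewrite [gamma_kernel a _]gamma_kernel_le0 ?mul0r ?mulr0//.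
    by rewrite mulr_le0_ge0// subr_ge0 (le_trans v0).
  by rewrite [gamma_kernel c _]gamma_kernel_le0 ?mulr0// mulr_le0_ge0// ltW.
have [/andP[v0 v1]|vN] := boolP (0 < v < 1); last first.
  rewrite [beta_kernel _ _ _]beta_kernel_out// mulr0.
  move: vN; rewrite negb_and -!leNgt => /orP[v0|v1].
    by rewrite [gamma_kernel c _]gamma_kernel_le0 ?mulr0// mulr_ge0_le0// ltW.
  rewrite [gamma_kernel a _]gamma_kernel_le0 ?mul0r ?mulr0//.
  by rewrite mulr_ge0_le0 ?subr_le0// ltW.
have v10 : 0 < 1 - v by rewrite subr_gt0.
rewrite !gamma_kernel_gt0 ?mulr_gt0// beta_kernel_in ?v0//.
rewrite !powRM ?ltW//.
have -> : expR (- s) = expR (- (s * (1 - v))) * expR (- (s * v)).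
  by rewrite -expRD; congr expR; ring.
have -> : s `^ (a + c - 1) = s * (s `^ (a - 1) * s `^ (c - 1)).
  rewrite -{2}(powRr1 (ltW s0)) -!powRD; last 2 first.
  - by rewrite (gt_eqF s0) implybT.
  - by rewrite (gt_eqF s0) implybT.
  by congr powR; ring.
ring.
Qed.

(** For independent gamma variables x and y, the fraction y / (x + y) is a beta
    variable independent of x + y. The substitution is done one variable at a
    time, first s = x + y, then y = s v, with Tonelli in between. *)
Lemma integral_gamma_beta a c (h : R -> \bar R) : 0 < a -> 0 < c ->
  measurable_fun [set: R] h -> (forall x, 0 <= h x)%E ->
  (\int[mu]_y \int[mu]_x
     (h (y / (x + y))%R * (gamma_kernel a x * gamma_kernel c y)%:E) =
   (gamma_fun (a + c))%:E * \int[mu]_v (h v * (beta_kernel c a v)%:E))%E.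
Proof.
move=> a0 c0 mh h0.
have mg e := measurable_gamma_kernel e.
have mkt d (T : measurableType d) (f g k : T -> R) :
    measurable_fun [set: T] f -> measurable_fun [set: T] g ->
    measurable_fun [set: T] k ->
    measurable_fun [set: T] (fun z => h (f z) *
      (gamma_kernel a (g z) * gamma_kernel c (k z))%:E)%E.
  move=> mf mg' mk; apply: emeasurable_funM; first exact: measurableT_comp.
  apply/measurable_EFinP; apply: measurable_funM.
    by apply: (measurableT_comp (mg a)).
  by apply: (measurableT_comp (mg c)).
have ge0 x y z : (0 <= h x * (gamma_kernel a y * gamma_kernel c z)%:E)%E.
  by rewrite mule_ge0// lee_fin mulr_ge0 ?gamma_kernel_ge0.
transitivity (\int[mu]_y \int[mu]_s
     (h (y / s)%R * (gamma_kernel a (s - y) * gamma_kernel c y)%:E))%E.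
  apply: eq_integral => y _.
  rewrite (@ge0_integral_affine R 1 (- y) (fun x =>
    h (y / (x + y))%R * (gamma_kernel a x * gamma_kernel c y)%:E)%E)//.
  - by rewrite mul1e; apply: eq_integral => s _; rewrite mul1r subrK.
  - apply: (mkt _ _ (fun x => y / (x + y)) id (cst y)) => //.
    apply: measurable_funM => //; apply: (measurableT_comp (@measurable_invr R)).
    exact: measurable_funD.
transitivity (\int[mu]_s \int[mu]_y
     (h (y / s)%R * (gamma_kernel a (s - y) * gamma_kernel c y)%:E))%E.
  apply: (@fubini_tonelli _ _ _ _ R mu mu (fun z : R * R =>
    h (z.1 / z.2)%R * (gamma_kernel a (z.2 - z.1) * gamma_kernel c z.1)%:E)%E) => //.
  apply: (mkt _ _ (fun z : R * R => z.1 / z.2) (fun z => z.2 - z.1) fst) => //.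
    by apply: measurable_funM => //; apply: (measurableT_comp (@measurable_invr R)).
  exact: measurable_funB.
transitivity (\int[mu]_s ((gamma_kernel (a + c) s)%:E *
    \int[mu]_v (h v * (beta_kernel c a v)%:E)))%E.
  apply: eq_integral => s _; have [s0|s0] := leP s 0.
    rewrite gamma_kernel_le0// mul0e; apply: integral0_eq => y _.
    have [y0|y0] := leP y 0.
      by rewrite [gamma_kernel c _]gamma_kernel_le0// mulr0 mule0.
    rewrite [gamma_kernel a _]gamma_kernel_le0 ?mul0r ?mule0//.
    by rewrite subr_le0 (le_trans s0)// ltW.
  rewrite (@ge0_integral_affine R s 0 (fun y =>
    h (y / s)%R * (gamma_kernel a (s - y) * gamma_kernel c y)%:E)%E)//; last first.
    apply: (mkt _ R (fun y : R => y / s) (fun y : R => s - y) (fun y : R => y)) => //.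
      exact: measurable_funM.
    exact: measurable_funB.
  rewrite -!ge0_integralZl//.
  - apply: eq_integral => v _; rewrite addr0 muleCA -EFinM.
    rewrite [(s * v / s)%R]mulrAC mulfV ?gt_eqF// mul1r.
    rewrite -{2}(mulr1 s) -mulrBr gamma_beta_kernel.
    by rewrite EFinM muleCA.
  - apply: emeasurable_funM => //.
    by apply/measurable_EFinP; exact: measurable_beta_kernel.
  - by move=> x _; rewrite mule_ge0// lee_fin beta_kernel_ge0.
  - by rewrite lee_fin gamma_kernel_ge0.
  - apply: (mkt _ R (fun y : R => (s * y + 0) / s) (fun y : R => s - (s * y + 0))
      (fun y : R => s * y + 0)); last exact: measurable_affine.
      by apply: measurable_funM => //; exact: measurable_affine.
    by apply: measurable_funB => //; exact: measurable_affine.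
  - by rewrite lee_fin ltW.
rewrite ge0_integralZr//.
- by rewrite integral_gamma_kernel// addr_gt0.
- by apply/measurable_EFinP; exact: mg.
- by move=> x _; rewrite lee_fin gamma_kernel_ge0.
- by apply: integral_ge0 => x _; rewrite mule_ge0// lee_fin beta_kernel_ge0.
Qed.

End gamma_beta.

Section gamma_beta_functions.
Context (R : realType).
Notation mu := (@lebesgue_measure R).
Implicit Types a b c x t : R.

Lemma integral_beta_kernel_gamma a c : 0 < a -> 0 < c ->
  ((gamma_fun (a + c))%:E * \int[mu]_v (beta_kernel c a v)%:E =
   (gamma_fun a * gamma_fun c)%:E)%E.
Proof.
move=> a0 c0; have mg e := @measurable_gamma_kernel R e.
have := @integral_gamma_beta R a c (cst 1%E) a0 c0 (@measurable_cst _ _ _ _ _ _)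
  (fun=> @lee01 R).
under [X in (_ * X)%E]eq_integral do rewrite mul1e.
move=> <-.
transitivity (\int[mu]_y ((gamma_fun a)%:E * (gamma_kernel c y)%:E))%E.
  apply: eq_integral => y _; under eq_integral do rewrite mul1e EFinM.
  rewrite ge0_integralZr//.
  - by rewrite integral_gamma_kernel.
  - by apply/measurable_EFinP; exact: mg.
  - by move=> x _; rewrite lee_fin gamma_kernel_ge0.
  - by rewrite lee_fin gamma_kernel_ge0.
rewrite ge0_integralZl//.
- by rewrite integral_gamma_kernel.
- by apply/measurable_EFinP; exact: mg.
- by move=> x _; rewrite lee_fin gamma_kernel_ge0.
- by rewrite lee_fin ltW// gamma_fun_gt0.
Qed.

Lemma integral_beta_kernel c a : 0 < a -> 0 < c ->
  (\int[mu]_v (beta_kernel c a v)%:E = (rbeta_fun c a)%:E)%E.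
Proof.
move=> a0 c0; rewrite /rbeta_fun /Rintegral.
have -> : (\int[mu]_(x in `]0%R, 1%R[) (x `^ (c - 1) * (1 - x) `^ (a - 1))%:E =
    \int[mu]_x (beta_kernel c a x)%:E)%E.
  by rewrite integral_mkcond; apply: eq_integral => x _; rewrite epatch_indic -EFinM.
rewrite fineK// ge0_fin_numE; last first.
  by apply: integral_ge0 => x _; rewrite lee_fin beta_kernel_ge0.
rewrite ltey; apply/eqP => h.
have := integral_beta_kernel_gamma a0 c0; rewrite h.
by rewrite gt0_muley ?lte_fin ?gamma_fun_gt0 ?addr_gt0.
Qed.

Lemma rbeta_fun_gamma c a : 0 < a -> 0 < c ->
  gamma_fun (a + c) * rbeta_fun c a = gamma_fun a * gamma_fun c.
Proof.
move=> a0 c0; have := integral_beta_kernel_gamma a0 c0.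
by rewrite integral_beta_kernel// -EFinM => -[].
Qed.

Lemma rbeta_fun_gt0 c a : 0 < a -> 0 < c -> 0 < rbeta_fun c a.
Proof.
move=> a0 c0; rewrite -(pmulr_rgt0 _ (gamma_fun_gt0 (addr_gt0 a0 c0))).
by rewrite rbeta_fun_gamma// mulr_gt0 ?gamma_fun_gt0.
Qed.

Lemma gamma_fun1 : gamma_fun 1 = 1 :> R.
Proof.
apply: EFin_inj; rewrite -integral_gamma_kernel//.
have := @integral_expRN R 1 ltr01; rewrite invr1 => <-.
rewrite [RHS]integral_mkcond; apply: eq_integral => x _.
by rewrite epatch_indic -EFinM /gamma_kernel subrr powRr0 !mul1r.
Qed.

Lemma rbeta_fun1 a : 0 < a -> rbeta_fun a 1 = a^-1.
Proof.
move=> a0; apply: EFin_inj; rewrite -integral_beta_kernel// -integral_powRB1//.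
have mp D : measurable_fun D (fun x : R => (x `^ (a - 1))%:E).
  by apply: measurable_funTS; apply/measurable_EFinP; exact: measurable_powR.
rewrite -integral_itv_bndo_bndc; last exact: mp.
rewrite [RHS]integral_mkcond; apply: eq_integral => x _.
by rewrite epatch_indic -EFinM /beta_kernel subrr powRr0 mulr1.
Qed.

(** Obtained from the beta-gamma relation at parameters a and 1, where the beta
    integral is elementary. *)
Lemma gamma_funS a : 0 < a -> gamma_fun (a + 1) = a * gamma_fun a.
Proof.
move=> a0; have := rbeta_fun_gamma ltr01 a0.
rewrite rbeta_fun1// gamma_fun1 mul1r addrC => <-.
by rewrite mulrCA mulfV ?mulr1// gt_eqF.
Qed.

Lemma integral_gamma_kernel_scale t c : 0 < t -> 0 < c ->
  (\int[mu]_x (x `^ (t - 1) * expR (- (c * x)) *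
     \1_(`]0, +oo[%classic : set R) x)%:E = (c `^ (- t) * gamma_fun t)%:E)%E.
Proof.
move=> t0 c0.
have mk : measurable_fun [set: R] (fun x : R => x `^ (t - 1) * expR (- (c * x)) *
     \1_(`]0, +oo[%classic : set R) x).
  apply: measurable_funM; last exact: measurable_indic.
  apply: measurable_funM; first exact: measurable_powR.
  by apply: measurableT_comp => //; apply: measurable_funN; exact: measurable_funM.
have -> : (c `^ (- t) * gamma_fun t)%:E = ((c `^ (- t))%:E * \int[mu]_x (gamma_kernel t x)%:E)%E.
  by rewrite integral_gamma_kernel.
rewrite (@ge0_integral_affine R c 0 (fun x => (gamma_kernel t x)%:E))//; last 2 first.
- by apply/measurable_EFinP; exact: measurable_gamma_kernel.
- by move=> x; rewrite lee_fin gamma_kernel_ge0.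
rewrite -ge0_integralZl//; last 3 first.
- apply/measurable_EFinP.
  by apply: (measurableT_comp (measurable_gamma_kernel t)); exact: measurable_affine.
- by move=> x _; rewrite lee_fin gamma_kernel_ge0.
- by rewrite lee_fin ltW.
rewrite -ge0_integralZl//; last 3 first.
- apply/measurable_EFinP; apply: measurable_funM => //.
  by apply: (measurableT_comp (measurable_gamma_kernel t)); exact: measurable_affine.
- by move=> x _; rewrite -EFinM lee_fin mulr_ge0 ?gamma_kernel_ge0// ltW.
- by rewrite lee_fin powR_ge0.
apply: eq_integral => x _; rewrite -!EFinM addr0; congr (_%:E).
have [x0|x0] := leP x 0.
  rewrite gamma_kernel_le0; last by rewrite mulr_ge0_le0// ltW.
  rewrite !mulr0.
  rewrite indicE memNset ?mulr0//= in_itv/= andbT.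
  by apply/negP; rewrite -leNgt.
rewrite indicE mem_set; last by rewrite /= in_itv/= x0.
rewrite gamma_kernel_gt0 ?mulr_gt0// powRM ?ltW// mulr1.
have c1 : c `^ (- t) * (c * c `^ (t - 1)) = 1.
  rewrite -{2}(powRr1 (ltW c0)) -!powRD; last 2 first.
  - by rewrite (gt_eqF c0) implybT.
  - by rewrite (gt_eqF c0) implybT.
  by rewrite (_ : - t + _ = 0) ?powRr0//; ring.
rewrite -[LHS]mul1r -[X in X * _]c1; ring.
Qed.

Lemma laplace_gamma_kernel t l : 0 < t -> 0 <= l ->
  (\int[mu]_x ((gamma_kernel t x)%:E * (expR (- (l * x)))%:E) =
   ((1 + l) `^ (- t) * gamma_fun t)%:E)%E.
Proof.
move=> t0 l0; rewrite -integral_gamma_kernel_scale//; last by rewrite ltr_wpDr.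
apply: eq_integral => x _; rewrite -EFinM /gamma_kernel; congr (_%:E).
by rewrite mulrDl mul1r opprD expRD; ring.
Qed.

End gamma_beta_functions.

(** * The arc sine law and its invariance *)

Section arcsine_law.
Context (R : realType).
Notation mu := (@lebesgue_measure R).
Context d (T : measurableType d) (P : probability T R) (G : {RV P >-> R}).
Hypothesis hG : has_density P G (@arcsine_pdf R).
Implicit Types (x y z e p q : R).

Let mG A : measurable A -> measurable (G @^-1` A).
Proof. by move=> mA; rewrite -[_ @^-1` _]setTI; exact: measurable_funPT. Qed.

Let pi_half_norm : 2 / pi * (pi / 2) = 1 :> R.
Proof.
have p0 : pi != 0 :> R by rewrite gt_eqF// pi_gt0.
by move: (pi : R) p0 => y y0; field.
Qed.

Lemma measurable_arcsine_pdf : measurable_fun [set: R] (@arcsine_pdf R).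
Proof.
apply: measurable_funM; last exact: measurable_indic.
apply: measurable_funM => //; apply: (measurableT_comp (@measurable_invr R)).
apply: (measurableT_comp (continuous_measurable_fun (@sqrt_continuous R))).
by apply: measurable_funM => //; exact: measurable_funB.
Qed.

Lemma arcsine_pdf_ge0 x : 0 <= arcsine_pdf x.
Proof.
rewrite /arcsine_pdf indicE !mulr_ge0 ?invr_ge0 ?sqrtr_ge0//.
exact: pi_ge0.
Qed.

Lemma arcsine_pdf_out x : ~~ (0 < x < 1) -> arcsine_pdf x = 0.
Proof.
move=> xN; rewrite /arcsine_pdf.
rewrite (_ : Num.sqrt (x * (1 - x)) = 0) ?invr0 ?mulr0 ?mul0r//.
apply: ler0_sqrtr; move: xN; rewrite negb_and -!leNgt => /orP[x0|x1].
  by rewrite mulr_le0_ge0// subr_ge0 (le_trans x0).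
by rewrite mulr_ge0_le0 ?subr_le0// (le_trans _ x1).
Qed.

Lemma arcsine_pdf_in x : 0 < x < 1 ->
  arcsine_pdf x = pi^-1 * (Num.sqrt (x * (1 - x)))^-1.
Proof.
move=> /andP[x0 x1]; rewrite /arcsine_pdf indicE mem_set ?mulr1//=.
by rewrite in_itv/= !ltW.
Qed.

Lemma arcsine01 : P (G @^-1` (~` `]0, 1[%classic)) = 0%E.
Proof.
rewrite hG; last exact: measurableC.
rewrite integral0_eq// => x /= /negP xN.
by rewrite arcsine_pdf_out//; move: xN; rewrite in_itv.
Qed.

Lemma ae_arcsine01 : {ae P, forall w, 0 < G w < 1}.
Proof.
exists (G @^-1` (~` `]0, 1[%classic)); split.
- by apply: mG; exact: measurableC.
- exact: arcsine01.
- by move=> w /= h; rewrite in_itv/=; apply: contra_not h.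
Qed.

Let asin_sqrt_derive x : 0 < x < 1 ->
  derivable (fun x => 2 / pi * asin (Num.sqrt x)) x 1 /\
  (fun x => 2 / pi * asin (Num.sqrt x))^`()%classic x = arcsine_pdf x.
Proof.
move=> /andP[x0 x1].
have sx : -1 < Num.sqrt x < 1.
  rewrite (lt_le_trans _ (sqrtr_ge0 x)) ?ltrN10//=.
  by rewrite -sqrtr1 ltr_sqrt.
have ds := is_derive1_sqrt x0.
have da := is_derive1_asin sx.
have dc : is_derive x (1 : R) (fun x => asin (Num.sqrt x))
    ((Num.sqrt (1 - Num.sqrt x ^+ 2))^-1 * (2 * Num.sqrt x)^-1).
  exact: (@is_derive1_comp R (@asin R) Num.sqrt x).
have dz := @is_deriveZ R R R _ (2 / pi) x 1 _ dc.
split; first exact: ex_derive.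
rewrite derive1E (@derive_val _ _ _ _ _ _ _ dz).
rewrite arcsine_pdf_in ?x0// sqr_sqrtr ?ltW// sqrtrM ?ltW//.
have p0 : pi != 0 :> R by rewrite gt_eqF// pi_gt0.
rewrite /GRing.scale/=; move: (pi : R) p0 => p0' p0; field.
by rewrite p0 !lt0r_neq0 ?sqrtr_gt0 ?subr_gt0.
Qed.

Lemma arcsine_cdf_itv b : 0 < b < 1 ->
  P (G @^-1` `]0, b]%classic) = (2 / pi * asin (Num.sqrt b))%:E.
Proof.
move=> /andP[b0 b1]; rewrite hG//.
pose f0 x : R := pi^-1 * (Num.sqrt (x * (1 - x)))^-1.
have f0E x : x \in `]0, b] -> arcsine_pdf x = f0 x.
  rewrite in_itv/= => /andP[x0 xb]; rewrite arcsine_pdf_in// x0/=.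
  exact: (le_lt_trans xb).
have -> : (\int[mu]_(x in `]0%R, b]) (arcsine_pdf x)%:E =
    \int[mu]_(x in `]0%R, b]) (f0 x)%:E)%E.
  by apply: eq_integral => x; rewrite inE/= => /f0E ->.
rewrite (@ge0_improper_FTC R f0 (fun x => 2 / pi * asin (Num.sqrt x)))//.
- rewrite sqrtr0 (_ : asin 0 = 0) ?mulr0 ?subr0//.
  rewrite -[in LHS](@sin0 R) sinK// in_itv/=.
  by rewrite oppr_le0 divr_ge0 ?pi_ge0.
- by move=> x /f0E <-; exact: arcsine_pdf_ge0.
- move=> x; rewrite in_itv/= => /andP[x0 xb].
  have x1 : x < 1 by rewrite (le_lt_trans xb).
  apply: cvgMr; apply: cvgV.
    by rewrite gt_eqF// sqrtr_gt0 mulr_gt0// subr_gt0.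
  apply: continuous_comp; last exact: sqrt_continuous.
  by apply: cvgM => //; apply: cvgB => //; exact: cvg_cst.
- apply: cvg_at_right_filter; apply: cvgMr.
  apply: continuous_comp; first exact: sqrt_continuous.
  by apply: continuous_asin; rewrite sqrtr0 ltrN10 ltr01.
- move=> x xb; rewrite -f0E//; apply: asin_sqrt_derive.
  by move: xb; rewrite in_itv/= => /andP[-> xb]; rewrite (le_lt_trans xb).
Qed.

Lemma arcsine_atom x : P (G @^-1` [set x]) = 0%E.
Proof. by rewrite hG// integral_set1. Qed.

Lemma arcsine_itv0y : P (G @^-1` `]0, +oo[%classic) = 1%E.
Proof.
apply/eqP; rewrite eq_le probability_le1/=; last exact: mG.
rewrite -(@probability_setT _ _ _ P) -(sube0 (P setT)) -arcsine01.
rewrite leeBlDr; last by rewrite arcsine01.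
apply: le_trans (measureU2 _ _ _); last 2 first.
- exact: mG.
- by apply: mG; exact: measurableC.
apply: le_measure; rewrite ?inE//.
  by apply: measurableU; apply: mG => //; exact: measurableC.
move=> w _ /=; rewrite !in_itv/= andbT.
by have [/andP[-> _]|/negP] := boolP (0 < G w < 1); [left|right].
Qed.

(** The angle arccos (sqrt G) is uniform on [0, pi/2]. *)
Lemma arcsine_tail e : 0 <= e <= pi / 2 ->
  P (G @^-1` `]cos e ^+ 2, +oo[%classic) = (2 / pi * e)%:E.
Proof.
move=> /andP[e0 epi]; have pi0 : 0 < pi :> R by exact: pi_gt0.
have [->|eN0] := eqVneq e 0.
  rewrite cos0 expr1n mulr0; apply: subset_measure0 arcsine01.
  - exact: mG.
  - by apply: mG; exact: measurableC.
  move=> w /=; rewrite !in_itv/= andbT => w1.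
  by rewrite (ltNge _ 1) (ltW w1) andbF.
have [->|eNpi] := eqVneq e (pi / 2).
  rewrite cos_pihalf expr0n/= arcsine_itv0y.
  by rewrite pi_half_norm.
have e_gt0 : 0 < e by rewrite lt_neqAle eq_sym eN0.
have e_lt : e < pi / 2 by rewrite lt_neqAle eNpi.
have ce : 0 < cos e.
  by rewrite cos_gt0_pihalf// e_lt andbT (lt_le_trans _ e0)// oppr_lt0 divr_gt0.
have ce1 : cos e < 1.
  rewrite -[ltRHS](@cos0 R) ltr_cos// in_itv/= ?lexx ?pi_ge0//.
  by rewrite e0/= (le_trans epi)// ler_pdivrMr// ler_pMr// ler1n.
have b01 : 0 < cos e ^+ 2 < 1.
  by rewrite exprn_gt0//= exprn_ilt1// ltW.
have := arcsine_cdf_itv b01.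
rewrite sqrtr_sqr ger0_norm ?ltW//.
have -> : asin (cos e) = pi / 2 - e.
  have -> : cos e = sin (pi / 2 - e).
    by rewrite sinB sin_pihalf cos_pihalf mul1r mul0r subr0.
  rewrite sinK// in_itv/=; lra.
move=> h.
move: h b01; set b := cos e ^+ 2 => h b01.
have : (P (G @^-1` `]0%R, b]%classic) + P (G @^-1` `]b, +oo[%classic) = 1)%E.
  rewrite -measureU; [|exact: mG|exact: mG|].
  - rewrite -arcsine_itv0y -preimage_setU; congr (P (_ @^-1` _)).
    apply/seteqP; split => x /=; rewrite !in_itv/= !andbT.
      by move=> [/andP[]//|]; exact: lt_trans (proj1 (andP b01)).
    by have [] := leP x b => xb x0; [left; rewrite x0|right].
  - apply/seteqP; split => // w /=; rewrite !in_itv/= andbT => -[/andP[_ h1] h2].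
    by have := lt_le_trans h2 h1; rewrite ltxx.
rewrite h; move: (P _) => [r||]//= []; move=> hr; congr (_%:E).
move: hr; rewrite mulrBr pi_half_norm; lra.
Qed.

(** The criterion by which arc sine laws are recognised: the tails at the points
    cos^2 e must be linear in e. The total mass c is left free because the
    measure may be the image of the Lebesgue measure of an interval. *)
Lemma arcsine_law_unique (nu : {measure set R -> \bar R}) (c : {nonneg R}) :
  (forall a : R, a < 0 -> nu `]a, +oo[%classic = c%:num%:E) ->
  (forall e : R, 0 < e <= pi / 2 ->
    nu `]cos e ^+ 2, +oo[%classic = (c%:num * (2 / pi * e))%:E) ->
  (forall a : R, 1 <= a -> nu `]a, +oo[%classic = 0%E) ->
  forall A, measurable A -> nu A = (c%:num%:E * P (G @^-1` A))%E.
Proof.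
move=> nu_lt0 nu_cos nu_ge1 A mA.
have PGT : P (G @^-1` setT) = 1%E by rewrite preimage_setT probability_setT.
transitivity (mscale c (distribution P G) A) => //.
symmetry; apply: measure_ray_unique => //.
  change (c%:num%:E * P (G @^-1` [set: R]) < +oo)%E; by rewrite PGT mule1 ltry.
move=> a.
change (c%:num%:E * P (G @^-1` `]a, +oo[%classic) = nu `]a, +oo[%classic)%E.
have [a0|a0] := ltP a 0.
  rewrite nu_lt0// (_ : P _ = 1%E) ?mule1//.
  apply/eqP; rewrite eq_le probability_le1/=; last exact: mG.
  rewrite -arcsine_itv0y le_measure ?inE//; [exact: mG|exact: mG|].
  by move=> w /=; rewrite !in_itv/= !andbT; exact: lt_trans.
have [a1|a1] := ltP a 1; last first.
  rewrite nu_ge1// (_ : P _ = 0%E) ?mule0//.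
  apply: subset_measure0 arcsine01; [exact: mG|exact/mG/measurableC|].
  move=> w /=; rewrite !in_itv/= andbT => aw.
  by rewrite [G w < 1]ltNge (le_trans a1 (ltW aw)) andbF.
have sa : -1 <= Num.sqrt a < 1.
  rewrite (le_trans _ (sqrtr_ge0 a)) ?lerN10//=.
  by rewrite -sqrtr1 ltr_sqrt.
have -> : a = cos (acos (Num.sqrt a)) ^+ 2.
  by rewrite acosK ?sqr_sqrtr// in_itv/=; case/andP: sa => -> /ltW.
have e0 : 0 < acos (Num.sqrt a) by exact: acos_gt0.
have epi : acos (Num.sqrt a) <= pi / 2.
  rewrite leNgt; apply/negP => h.
  have := sqrtr_ge0 a; apply/negP; rewrite -ltNge.
  rewrite -[Num.sqrt a]acosK; last by rewrite in_itv/=; case/andP: sa => -> /ltW.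
  rewrite -cos_pihalf ltr_cos// in_itv/=.
  - by rewrite divr_ge0 ?pi_ge0//= ler_pdivrMr// ler_pMr ?pi_gt0// ler1n.
  - by rewrite ltW//= acos_lepi//; case/andP: sa => -> /ltW.
rewrite arcsine_tail; last by rewrite ltW.
by rewrite nu_cos ?e0// EFinM.
Qed.

End arcsine_law.

Section arcsine_quotient.
Context (R : realType).
Context d (T : measurableType d) (P : probability T R) (G : {RV P >-> R}).
Hypothesis hG : has_density P G (@arcsine_pdf R).
Implicit Types (x y z e p q : R).

Definition arcsine_quotient p q x : R :=
  (Num.sqrt (p + q) + Num.sqrt q) ^+ 2 * (x * (1 - x) / (p * x + q)).

Lemma measurable_arcsine_quotient p q :
  measurable_fun [set: R] (arcsine_quotient p q).
Proof.
apply: measurable_funM => //; apply: measurable_funM.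
  by apply: measurable_funM => //; exact: measurable_funB.
by apply: (measurableT_comp (@measurable_invr R)); exact: measurable_affine.
Qed.

Lemma arcsine_quotient_itv p q x : 0 <= p -> 0 <= q -> 0 < p + q ->
  0 < x < 1 -> 0 < arcsine_quotient p q x <= 1.
Proof.
move=> p0 q0 pq0 /andP[x0 x1]; rewrite /arcsine_quotient.
set r := Num.sqrt (p + q); set s := Num.sqrt q.
have s0 : 0 <= s by exact: sqrtr_ge0.
have r0 : 0 < r by rewrite sqrtr_gt0.
have qE : q = s ^+ 2 by rewrite sqr_sqrtr.
have pE : p = r ^+ 2 - s ^+ 2 by rewrite -qE sqr_sqrtr ?addrK// ltW.
have den0 : 0 < p * x + q.
  have -> : p * x + q = r ^+ 2 * x + s ^+ 2 * (1 - x) by rewrite {1}pE {1}qE; ring.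
  apply: ltr_wpDr; last by rewrite mulr_gt0// exprn_gt0.
  by rewrite mulr_ge0 ?sqr_ge0 ?subr_ge0 ?ltW.
apply/andP; split.
  by rewrite mulr_gt0 ?exprn_gt0 ?ltr_wpDr// divr_gt0// mulr_gt0// subr_gt0.
rewrite mulrA ler_pdivrMr// mul1r -subr_ge0 {1}pE {1}qE.
by rewrite (_ : _ - _ = ((r + s) * x - s) ^+ 2) ?sqr_ge0//; ring.
Qed.

Let mG A : measurable A -> measurable (G @^-1` A).
Proof. by move=> mA; rewrite -[_ @^-1` _]setTI; exact: measurable_funPT. Qed.

Let half_angle e : cos (e / 2) ^+ 2 = (1 + cos e) / 2.
Proof.
have e2 : (e / 2) *+ 2 = e by rewrite -mulr_natr divfK.
by rewrite -{2}e2 cos_mulr2n -mulr_natr; field.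
Qed.

(** With u = 1 - 2 x the level set of the quotient is that of a quadratic
    polynomial in u; its roots are cos (sg - dl) and cos (sg + dl), where
    cos dl is the square root of the level and sg is determined by
    cos sg = (r - s) / (r + s) cos dl. *)
Let quotient_level r s z x sg dl : 0 <= s -> s <= r -> 0 < r -> 0 < x < 1 ->
  cos dl = z -> cos sg = (r - s) / (r + s) * z ->
  (z ^+ 2 < (r + s) ^+ 2 * (x * (1 - x) / ((r ^+ 2 - s ^+ 2) * x + s ^+ 2))) =
  ((1 - 2 * x - cos (sg - dl)) * (1 - 2 * x - cos (sg + dl)) < 0).
Proof.
move=> s0 sr r0 /andP[x0 x1] cd cs.
have rs0 : 0 < r + s by rewrite ltr_wpDr.
have den0 : 0 < (r ^+ 2 - s ^+ 2) * x + s ^+ 2.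
  have -> : (r ^+ 2 - s ^+ 2) * x + s ^+ 2 = r ^+ 2 * x + s ^+ 2 * (1 - x) by ring.
  apply: ltr_wpDr; last by rewrite mulr_gt0// exprn_gt0.
  by rewrite mulr_ge0 ?sqr_ge0 ?subr_ge0 ?ltW.
rewrite mulrA ltr_pdivlMr// -subr_gt0.
have -> : (1 - 2 * x - cos (sg - dl)) * (1 - 2 * x - cos (sg + dl)) =
  - (4 / (r + s) ^+ 2) * ((r + s) ^+ 2 * (x * (1 - x)) -
    z ^+ 2 * ((r ^+ 2 - s ^+ 2) * x + s ^+ 2)).
  have -> : (1 - 2 * x - cos (sg - dl)) * (1 - 2 * x - cos (sg + dl)) =
    (1 - 2 * x) ^+ 2 - 2 * (1 - 2 * x) * (cos sg * cos dl) +
    (cos sg ^+ 2 * cos dl ^+ 2 - sin sg ^+ 2 * sin dl ^+ 2).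
    by rewrite cosB cosD; ring.
  rewrite !sin2cos2 cs cd; field.
  by rewrite gt_eqF.
by rewrite mulNr oppr_lt0 pmulr_rgt0// divr_gt0// exprn_gt0.
Qed.

Let cos_pi_sub e : cos ((pi - e) / 2) ^+ 2 = (1 - cos e) / 2.
Proof. by rewrite half_angle cosB cospi sinpi mulN1r mul0r addr0. Qed.

Let arcsine_interval e1 e2 : 0 <= e2 -> e2 <= e1 -> e1 <= pi / 2 ->
  P (G @^-1` `](cos e1 ^+ 2), (cos e2 ^+ 2)[%classic) = (2 / pi * (e1 - e2))%:E.
Proof.
move=> e20 e21 e1pi.
have e1b : 0 <= e1 <= pi / 2 by rewrite e1pi (le_trans e20).
have e2b : 0 <= e2 <= pi / 2 by rewrite e20 (le_trans e21).
set a := cos e1 ^+ 2; set b := cos e2 ^+ 2.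
have ab : a <= b.
  have cge e : 0 <= e <= pi / 2 -> 0 <= cos e.
    move=> /andP[e0 epi]; apply: cos_ge0_pihalf; rewrite epi andbT.
    by rewrite (le_trans _ e0)// oppr_le0 divr_ge0 ?pi_ge0.
  have mem e : 0 <= e <= pi / 2 -> e \in `[0, pi].
    move=> /andP[e0 epi]; rewrite in_itv/= e0/= (le_trans epi)//.
    by rewrite ler_pdivrMr// ler_pMr ?pi_gt0// ler1n.
  by rewrite /a /b lerXn2r ?nnegrE ?cge// leNgt ltr_cos ?mem// -leNgt.
have ta := arcsine_tail hG e1b; have tb := arcsine_tail hG e2b.
rewrite -/a in ta; rewrite -/b in tb.
have : (P (G @^-1` `]a, b[%classic) + P (G @^-1` [set b]) +
    P (G @^-1` `]b, +oo[%classic) = P (G @^-1` (`]a, +oo[%classic `|` [set b])))%E.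
  rewrite -!measureU; try exact: mG; try by apply: measurableU; exact: mG.
  - congr (P _); apply/seteqP; split => w /=; rewrite !in_itv/= !andbT.
      move=> [[/andP[-> _]|->]|h]; [by left|by right|left].
      exact: le_lt_trans h.
    move=> [h|->]; last by left; right.
    have [h2|h2|->] := ltgtP (G w) b; [|by right|by left; right].
    by left; left; rewrite h.
  - apply/seteqP; split => // w /=; rewrite !in_itv/= !andbT.
    by move=> [[/andP[_ h1]|->]]; [move=> /(lt_trans h1)|]; rewrite ltxx.
  - apply/seteqP; split => // w /=; rewrite !in_itv/= => -[/andP[_ h1] h2].
    by move: h1; rewrite h2 ltxx.
rewrite (arcsine_atom hG) tb adde0.
rewrite (_ : P (G @^-1` (_ `|` _)) = P (G @^-1` `]a, +oo[%classic)); last first.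
  apply/eqP; rewrite eq_le; apply/andP; split.
    rewrite preimage_setU (le_trans (measureU2 _ _ _))//; first exact: mG.
    by rewrite [X in (_ + X)%E](arcsine_atom hG) adde0.
  rewrite le_measure ?inE//; [exact: mG|apply: mG; exact: measurableU|].
  by move=> w h; left.
rewrite ta; move: (P _) => [v||]//= [] h; congr (_%:E).
by rewrite mulrBr -h addrK.
Qed.

(** The superlevel set of level cos^2 e is, in terms of u = 1 - 2 G, the interval
    between cos (sg + e) and cos (sg - e). In the angle of G it has length e,
    whatever the centre sg: all dependence on p and q disappears. *)
Lemma arcsine_quotient_law p q : 0 <= p -> 0 <= q -> 0 < p + q ->
  forall A, measurable A ->
  P ((fun w => arcsine_quotient p q (G w)) @^-1` A) = P (G @^-1` A).
Proof.
move=> p0 q0 pq0.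
have mW : measurable_fun [set: T] (fun w => arcsine_quotient p q (G w)).
  by apply: (measurableT_comp (measurable_arcsine_quotient p q)).
pose W : {RV P >-> R} := HB.pack (fun w => arcsine_quotient p q (G w))
  (isMeasurableFun.Build _ _ _ _ _ mW).
set r := Num.sqrt (p + q); set s := Num.sqrt q.
have s0 : 0 <= s by exact: sqrtr_ge0.
have r0 : 0 < r by rewrite sqrtr_gt0.
have sr : s <= r by rewrite ler_sqrt ?lerDr// ltW.
have rs0 : 0 < r + s by rewrite ltr_wpDr.
have qE : s ^+ 2 = q by rewrite sqr_sqrtr.
have pE : r ^+ 2 - s ^+ 2 = p by rewrite qE sqr_sqrtr ?addrK// ltW.
have WE x : arcsine_quotient p q x =
    (r + s) ^+ 2 * (x * (1 - x) / ((r ^+ 2 - s ^+ 2) * x + s ^+ 2)).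
  by rewrite pE qE.
have WP (B : set R) (C : set R) : measurable B -> measurable C ->
    (forall x, 0 < x < 1 -> B (arcsine_quotient p q x) <-> C x) ->
    P (W @^-1` B) = P (G @^-1` C).
  move=> mB mC BC.
  have mWB : measurable (W @^-1` B).
    by rewrite -[_ @^-1` _]setTI; exact: measurable_funPT.
  have mGC := mG mC.
  rewrite -[X in P X]setIT -[X in _ = P X]setIT.
  rewrite -!integral_indic//; apply: ae_eq_integral => //.
  - by apply/measurable_EFinP; exact: measurable_indic.
  - by apply/measurable_EFinP; exact: measurable_indic.
  - apply: filterS (ae_arcsine01 hG) => w /BC BCw _; rewrite !indicE.
    congr (_%:R%:E); congr nat_of_bool.
    by apply/idP/idP; rewrite !inE => /BCw.
move=> A mA.
transitivity (1%:E * P (G @^-1` A))%E; last by rewrite mul1e.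
change (distribution P W A = 1%:E * P (G @^-1` A))%E.
apply: (arcsine_law_unique hG (c := 1%:nng)) => //= [a a0|e /andP[e0 epi]|a a1].
- change (P (W @^-1` `]a, +oo[%classic) = 1%:E).
  rewrite (WP _ `]0, +oo[%classic)//; first exact: arcsine_itv0y hG.
  move=> x /andP[x0 x1]; rewrite /= !in_itv/= !andbT x0; split => // _.
  rewrite (lt_le_trans a0)// mulr_ge0 ?sqr_ge0// divr_ge0//.
    by rewrite mulr_ge0 ?subr_ge0// ltW.
  by rewrite addr_ge0// mulr_ge0// ltW.
- change (P (W @^-1` `](cos e ^+ 2), +oo[%classic) = (1 * (2 / pi * e))%:E).
  have pi0 : 0 < pi :> R by exact: pi_gt0.
  set z := cos e; set rho := (r - s) / (r + s).
  have z0 : 0 <= z.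
    by rewrite cos_ge0_pihalf// epi andbT (le_trans _ (ltW e0))// oppr_le0 divr_ge0 ?pi_ge0.
  have rho0 : 0 <= rho by rewrite divr_ge0 ?subr_ge0// ltW.
  have rho1 : rho <= 1.
    by rewrite ler_pdivrMr// mul1r lerD2l (le_trans _ s0)// oppr_le0.
  have rz : rho * z <= z by rewrite ler_piMl.
  have rzb : -1 <= rho * z <= 1.
    by rewrite (le_trans _ (mulr_ge0 rho0 z0)) ?lerN10// (le_trans rz)// cos_le1.
  have [/andP[sg0 sgpi] csg] := acos_def rzb.
  set sg := acos (rho * z) in sg0 sgpi csg.
  have pi2 : pi / 2 <= pi :> R by rewrite ler_pdivrMr// ler_pMr// ler1n.
  have esg : e <= sg.
    rewrite leNgt; apply/negP => h; have : z < cos sg.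
      by rewrite ltr_cos// in_itv/= ?sg0// ltW//= (le_trans epi).
    by rewrite csg ltNge rz.
  have sgpi2 : sg <= pi / 2.
    rewrite leNgt; apply/negP => h; have : cos sg < cos (pi / 2).
      by rewrite ltr_cos// in_itv/= ?sg0// divr_ge0 ?pi_ge0.
    by rewrite cos_pihalf csg ltNge mulr_ge0.
  (* u = 1 - 2 G lies between cos (sg + e) and cos (sg - e) *)
  rewrite (WP _ `](cos ((pi - (sg - e)) / 2) ^+ 2),
                  (cos ((pi - (sg + e)) / 2) ^+ 2)[%classic)//.
    rewrite arcsine_interval; first by congr (_%:E); rewrite mul1r; congr (_ * _); lra.
    - by lra.
    - by lra.
    - by lra.
  move=> x x01; rewrite /= !in_itv/= andbT WE.
  rewrite (quotient_level s0 sr r0 x01 erefl csg) !cos_pi_sub.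
  have AB : cos (sg + e) <= cos (sg - e).
    rewrite cosB cosD lerD2l -subr_ge0 opprK addr_ge0// mulr_ge0// sin_ge0_pi//.
    - by rewrite sg0.
    - by rewrite ltW//= (le_trans epi).
    - by rewrite sg0.
    - by rewrite ltW//= (le_trans epi).
  move: AB; set a := cos (sg - e); set b := cos (sg + e) => AB.
  split => [h|/andP[h1 h2]]; last by nra.
  apply/andP; split; nra.
- change (P (W @^-1` `]a, +oo[%classic) = 0%:E).
  rewrite (WP _ set0)//; first by rewrite preimage_set0 measure0.
  move=> x /andP[x0 x1]; rewrite /= !in_itv/= !andbT; split => //.
  apply/negP; rewrite -leNgt (le_trans _ a1)//.
  by have /andP[] : 0 < arcsine_quotient p q x <= 1
    by apply: arcsine_quotient_itv => //; rewrite x0.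
Qed.

End arcsine_quotient.

Section arcsine_expectations.
Context (R : realType).
Notation mu := (@lebesgue_measure R).
Context d (T : measurableType d) (P : probability T R) (G : {RV P >-> R}).
Hypothesis hG : has_density P G (@arcsine_pdf R).
Implicit Types (x y z p q l t a c : R) (h : R -> \bar R).

Lemma ae_eq_ge0_integral (f g : T -> \bar R) :
  measurable_fun [set: T] f -> measurable_fun [set: T] g ->
  (forall w, 0 < G w < 1 -> f w = g w) ->
  (\int[P]_w f w = \int[P]_w g w)%E.
Proof.
move=> mf mg fg; apply: ae_eq_integral => //.
by apply: filterS (ae_arcsine01 hG) => w /fg + _.
Qed.

Lemma integral_arcsine_quotient p q h : 0 <= p -> 0 <= q -> 0 < p + q ->
  measurable_fun [set: R] h -> (forall x, (0 <= h x)%E) ->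
  (\int[P]_w h (arcsine_quotient p q (G w)) = \int[P]_w h (G w))%E.
Proof.
move=> p0 q0 pq0 mh h0.
have mW : measurable_fun [set: T] (fun w => arcsine_quotient p q (G w)).
  by apply: (measurableT_comp (measurable_arcsine_quotient p q)).
pose W : {RV P >-> R} := HB.pack (fun w => arcsine_quotient p q (G w))
  (isMeasurableFun.Build _ _ _ _ _ mW).
by apply: (@integral_eq_law _ _ _ P _ _ P W G) => // A mA; exact: arcsine_quotient_law.
Qed.

Let mGf (f : R -> R) : measurable_fun [set: R] f ->
  measurable_fun [set: T] (fun w => f (G w)).
Proof. by move=> mf; apply: (measurableT_comp mf). Qed.

Let mGE h : measurable_fun [set: R] h ->
  measurable_fun [set: T] (fun w => h (G w)).
Proof. by move=> mf; apply: (measurableT_comp mf). Qed.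

(** The quotient at (p, q) = (1, 0) is 1 - G. *)
Lemma arcsine_reflect h : measurable_fun [set: R] h -> (forall x, (0 <= h x)%E) ->
  (\int[P]_w h (1 - G w)%R = \int[P]_w h (G w))%E.
Proof.
move=> mh h0; rewrite -(@integral_arcsine_quotient 1 0)// ?addr0//.
apply: ae_eq_ge0_integral.
- apply: (measurableT_comp mh); apply: (mGf (f := fun x => 1 - x)).
  exact: measurable_funB.
- by apply: (measurableT_comp mh); apply: mGf; exact: measurable_arcsine_quotient.
move=> w /andP[w0 w1]; congr h.
rewrite /arcsine_quotient !addr0 sqrtr0 sqrtr1 addr0 expr1n !mul1r.
by rewrite mulrAC divff ?mul1r// gt_eqF.
Qed.

(** The quotient at (p, q) = (0, 1) is 4 G (1 - G). *)
Lemma arcsine_double h : measurable_fun [set: R] h -> (forall x, (0 <= h x)%E) ->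
  (\int[P]_w h (4 * (G w * (1 - G w)))%R = \int[P]_w h (G w))%E.
Proof.
move=> mh h0; rewrite -(@integral_arcsine_quotient 0 1)// ?add0r//.
apply: eq_integral => w _; congr h.
by rewrite /arcsine_quotient !add0r sqrtr1 mul0r add0r divr1; congr (_ * _); ring.
Qed.

(** Beta laws as biased arc sine laws: this transports the invariance of G to all
    beta variables. *)
Lemma beta_kernel_arcsine c a x :
  beta_kernel (c + 1 / 2) (a + 1 / 2) x =
  pi * (arcsine_pdf x * (x `^ c * (1 - x) `^ a)).
Proof.
have [x01|xN] := boolP (0 < x < 1); last first.
  by rewrite beta_kernel_out// arcsine_pdf_out// mul0r mulr0.
rewrite beta_kernel_in// arcsine_pdf_in//.
have p0 : pi != 0 :> R by rewrite gt_eqF// pi_gt0.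
move/andP: x01 => [x0 x1]; have x10 : 0 < 1 - x by rewrite subr_gt0.
have powE y e : 0 < y -> y `^ (e + 1 / 2 - 1) = (Num.sqrt y)^-1 * y `^ e.
  move=> y0; rewrite -powR12_sqrt ?ltW// -powRN -powRD; last first.
    by rewrite (gt_eqF y0) implybT.
  by congr powR; field.
rewrite !powE// sqrtrM ?ltW// invfM; move: (pi : R) p0 => y y0.
by field; rewrite y0 !gt_eqF ?sqrtr_gt0.
Qed.

Lemma integral_beta_kernel_arcsine c a h :
  measurable_fun [set: R] h -> (forall x, (0 <= h x)%E) ->
  (\int[mu]_x (h x * (beta_kernel (c + 1 / 2) (a + 1 / 2) x)%:E) =
   pi%:E * \int[P]_w (h (G w) * (G w `^ c * (1 - G w) `^ a)%:E))%E.
Proof.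
move=> mh h0.
have mp : measurable_fun [set: R] (fun x => x `^ c * (1 - x) `^ a).
  apply: measurable_funM; first exact: measurable_powR.
  by apply: (measurableT_comp (@measurable_powR R a)); exact: measurable_funB.
have mhp : measurable_fun [set: R] (fun x => h x * (x `^ c * (1 - x) `^ a)%:E)%E.
  by apply: emeasurable_funM => //; exact/measurable_EFinP.
have hp0 x : (0 <= h x * (x `^ c * (1 - x) `^ a)%:E)%E.
  by rewrite mule_ge0// lee_fin mulr_ge0 ?powR_ge0.
rewrite (integral_density hG (@measurable_arcsine_pdf R) (@arcsine_pdf_ge0 R) mhp hp0).
rewrite -ge0_integralZl//.
- apply: eq_integral => x _; rewrite beta_kernel_arcsine !EFinM.
  rewrite muleCA; congr (_ * _)%E; rewrite [RHS]muleCA.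
  by rewrite -!EFinM.
- apply: emeasurable_funM => //; apply/measurable_EFinP.
  exact: measurable_arcsine_pdf.
- by move=> x _; rewrite mule_ge0// lee_fin arcsine_pdf_ge0.
- by rewrite lee_fin pi_ge0.
Qed.

Lemma arcsine_beta c a : 0 < c + 1 / 2 -> 0 < a + 1 / 2 ->
  (\int[P]_w (G w `^ c * (1 - G w) `^ a)%:E =
   (rbeta_fun (c + 1 / 2) (a + 1 / 2) / pi)%:E)%E.
Proof.
move=> c0 a0.
have := @integral_beta_kernel_arcsine c a (cst 1%E) (@measurable_cst _ _ _ _ _ _)
  (fun=> @lee01 R).
under eq_integral do rewrite mul1e.
under [in RHS]eq_integral do rewrite mul1e.
rewrite integral_beta_kernel// => h.
by rewrite EFinM h muleC muleA -EFinM mulVf ?mul1e// gt_eqF// pi_gt0.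
Qed.

Lemma arcsine_moment c : 0 < c + 1 / 2 ->
  (\int[P]_w (G w `^ c)%:E = (rbeta_fun (c + 1 / 2) (1 / 2) / pi)%:E)%E.
Proof.
move=> c0; have := @arcsine_beta c 0 c0; rewrite add0r => <- //.
by apply: eq_integral => w _; rewrite powRr0 mulr1.
Qed.

Lemma sqrt_add_sub l : 0 <= l ->
  (Num.sqrt (1 + l) + Num.sqrt l) * (Num.sqrt (1 + l) - Num.sqrt l) = 1.
Proof.
by move=> l0; rewrite mulrC -subr_sqr !sqr_sqrtr ?addrK// addr_ge0.
Qed.

Lemma sqrt_add_gt0 l : 0 <= l -> 0 < Num.sqrt (1 + l) + Num.sqrt l.
Proof. by move=> l0; rewrite ltr_wpDr ?sqrtr_ge0// sqrtr_gt0 ltr_wpDr. Qed.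

Lemma sqrt_subE l : 0 <= l ->
  Num.sqrt (1 + l) - Num.sqrt l = (Num.sqrt (1 + l) + Num.sqrt l)^-1.
Proof.
move=> l0; apply: (mulfI (lt0r_neq0 (sqrt_add_gt0 l0))).
by rewrite sqrt_add_sub// mulfV// lt0r_neq0// sqrt_add_gt0.
Qed.

Lemma sqrt_sub_powR l t : 0 <= l ->
  (Num.sqrt (1 + l) - Num.sqrt l) `^ (2 * t) =
  ((Num.sqrt (1 + l) + Num.sqrt l) ^+ 2) `^ (- t).
Proof.
move=> l0; have k0 := sqrt_add_gt0 l0.
rewrite sqrt_subE// -powR_inv1 ?(ltW k0)// -powRrM -powR_mulrn ?(ltW k0)//.
by rewrite -powRrM mulN1r mulrN.
Qed.

(** G (1 - G) / (G + l) is a constant multiple of the quotient at (1, l), hence of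
    a variable with the law of G. *)
Lemma integral_arcsine_quotient_powR t l : 0 < t + 1 / 2 -> 0 <= l ->
  (\int[P]_w ((G w * (1 - G w) / (G w + l)) `^ t)%:E =
   ((Num.sqrt (1 + l) - Num.sqrt l) `^ (2 * t) *
    (rbeta_fun (t + 1 / 2) (1 / 2) / pi))%:E)%E.
Proof.
move=> t0 l0; rewrite EFinM -arcsine_moment//.
have mpt : measurable_fun [set: R] (fun x : R => (x `^ t)%:E).
  by apply/measurable_EFinP; exact: measurable_powR.
have l1 : 0 < 1 + l by rewrite ltr_wpDr.
rewrite -(@integral_arcsine_quotient 1 l (fun x => (x `^ t)%:E))//; last first.
  by move=> x; rewrite lee_fin powR_ge0.
have mq : measurable_fun [set: T] (fun w => (arcsine_quotient 1 l (G w) `^ t)%:E).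
  by apply: (measurableT_comp mpt); apply: mGf; exact: measurable_arcsine_quotient.
rewrite -ge0_integralZl//; last 2 first.
- by move=> w _; rewrite lee_fin powR_ge0.
- by rewrite lee_fin powR_ge0.
apply: ae_eq_ge0_integral.
- apply: (measurableT_comp mpt); apply: (mGf (f := fun x => x * (1 - x) / (x + l))).
  apply: measurable_funM; first by apply: measurable_funM => //; exact: measurable_funB.
  by apply: (measurableT_comp (@measurable_invr R)); exact: measurable_funD.
- by apply: emeasurable_funM.
move=> w /andP[w0 w1]; rewrite -EFinM; congr (_%:E).
rewrite /arcsine_quotient mul1r sqrt_sub_powR//.
have k0 : 0 < (Num.sqrt (1 + l) + Num.sqrt l) ^+ 2.
  by rewrite exprn_gt0// sqrt_add_gt0.
move: k0; move: (_ ^+ 2) => k k0.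
rewrite [in RHS]powRM ?(ltW k0)//; last first.
  by apply: divr_ge0; [rewrite mulr_ge0 ?subr_ge0 ?ltW|rewrite addr_ge0// ltW].
by rewrite mulrA -powRD ?addNr ?powRr0 ?mul1r// (gt_eqF k0) implybT.
Qed.

(** Any exponent strictly between - 1/2 and 0 would do: what matters is that
    x^(-1/4) is integrable against 1 / sqrt x. *)
Let ln_bound x : 0 < x -> x < 1 -> `|ln x| <= 4 * x `^ (- (1 / 4)).
Proof.
move=> x0 x1.
have p0 : 0 < x `^ (- (1 / 4)) by exact: powR_gt0.
have lnx0 : ln x < 0 by rewrite ln_lt0 ?x0.
have := @le_ln1Dx R (x `^ (- (1 / 4)) - 1).
rewrite ltrBrDl subrr => /(_ p0); rewrite addrCA subrr addr0 ln_powR => h.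
rewrite ltr0_norm//; lra.
Qed.

Lemma integral_ln_arcsine_lty : (\int[P]_w (`|ln (G w)|)%:E < +oo)%E.
Proof.
have m4 : 0 < - (1 / 4) + 1 / 2 :> R by lra.
have mn : measurable_fun [set: R] (fun x : R => `|ln x|).
  by apply: measurableT_comp => //; exact: measurable_ln.
apply: (@le_lt_trans _ _ (\int[P]_w (4 * G w `^ (- (1 / 4)))%:E)%E).
  apply: ae_ge0_le_integral => //.
  - by apply/measurable_EFinP; exact: (mGf mn).
  - by move=> w _; rewrite lee_fin mulr_ge0 ?powR_ge0.
  - apply/measurable_EFinP; apply: measurable_funM => //.
    by apply: (mGf (f := fun x => x `^ _)); exact: measurable_powR.
  - apply: filterS (ae_arcsine01 hG) => w /andP[w0 w1] _.
    by rewrite lee_fin ln_bound.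
under eq_integral do rewrite EFinM.
rewrite ge0_integralZl//.
- by rewrite arcsine_moment// -EFinM ltry.
- by apply/measurable_EFinP; apply: (mGf (f := fun x => x `^ _)); exact: measurable_powR.
- by move=> w _; rewrite lee_fin powR_ge0.
Qed.

(** Let W be the quotient at (1, l), so that
    ln W = ln kappa + ln (1 - G) - ln (1 + l / G). Taking expectations, E ln W
    and E ln (1 - G) cancel because both equal E ln G, which is finite. Absolute
    values keep all integrands nonnegative. *)
Lemma integral_ln_arcsine l : 0 <= l ->
  (\int[P]_w (ln (1 + l / G w))%:E =
   (ln ((Num.sqrt (1 + l) + Num.sqrt l) ^+ 2))%:E)%E.
Proof.
move=> l0; have l1 : 0 < 1 + l by rewrite ltr_wpDr.
set k := (Num.sqrt (1 + l) + Num.sqrt l) ^+ 2.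
have k1 : 1 <= k.
  have : 1 <= Num.sqrt (1 + l) by rewrite -{1}(@sqrtr1 R) ler_sqrt ?lerDl ?(ltW l1).
  by move=> h; rewrite /k exprn_ege1// (le_trans h)// lerDl sqrtr_ge0.
have mn : measurable_fun [set: R] (fun x : R => `|ln x|).
  by apply: measurableT_comp => //; exact: measurable_ln.
have mnE : measurable_fun [set: R] (fun x : R => (`|ln x|)%:E).
  exact/measurable_EFinP.
have mq : measurable_fun [set: T] (fun w => (`|ln (arcsine_quotient 1 l (G w))|)%:E).
  by apply: (measurableT_comp mnE); apply: mGf; exact: measurable_arcsine_quotient.
have mr : measurable_fun [set: T] (fun w => (`|ln (1 - G w)|)%:E).
  apply: (measurableT_comp mnE); apply: (mGf (f := fun x => 1 - x)).
  exact: measurable_funB.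
have ml : measurable_fun [set: T] (fun w => (`|ln (1 + l / G w)|)%:E).
  apply: (measurableT_comp mnE); apply: (mGf (f := fun x => 1 + l / x)).
  apply: measurable_funD => //; apply: measurable_funM => //.
  exact: measurable_invr.
have lnE w : 0 < G w < 1 -> `|ln (1 + l / G w)| = ln (1 + l / G w).
  by move=> /andP[w0 _]; rewrite ger0_norm// ln_ge0// lerDl divr_ge0// (ltW w0).
transitivity (\int[P]_w (`|ln (1 + l / G w)|)%:E)%E.
  apply: ae_eq_ge0_integral => //.
    apply/measurable_EFinP; apply: (measurableT_comp (@measurable_ln R)).
    apply: (mGf (f := fun x => 1 + l / x)).
    apply: measurable_funD => //; apply: measurable_funM => //.
    exact: measurable_invr.
  by move=> w /lnE ->.
have Mfin := integral_ln_arcsine_lty.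
have M0 : (0 <= \int[P]_w (`|ln (G w)|)%:E)%E by apply: integral_ge0.
(* the cancellation is done additively, before any term is known to be finite *)
have key : (\int[P]_w ((`|ln (arcsine_quotient 1 l (G w))|)%:E + (ln k)%:E) =
    \int[P]_w ((`|ln (1 - G w)|)%:E + (`|ln (1 + l / G w)|)%:E))%E.
  apply: ae_eq_ge0_integral; [exact: emeasurable_funD|exact: emeasurable_funD|].
  move=> w w01; rewrite lnE//.
  have /andP[q0 q1] := @arcsine_quotient_itv R 1 l (G w) ler01 l0 l1 w01.
  case/andP: w01 => w0 w1.
  have w10 : 0 < 1 - G w by rewrite subr_gt0.
  rewrite ler0_norm ?ln_le0// ler0_norm; last by rewrite ln_le0// gerBl ltW.
  rewrite -!EFinD; congr (_%:E).
  have k0 : 0 < k by rewrite (lt_le_trans _ k1).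
  have wl : 0 < G w + l by rewrite ltr_wpDr.
  have -> : 1 + l / G w = (G w + l) / G w by field; rewrite gt_eqF.
  have pp y : 0 < y -> y \in Num.pos by rewrite posrE.
  have gg : 0 < G w * (1 - G w) by exact: mulr_gt0.
  have -> : arcsine_quotient 1 l (G w) = k * (G w * (1 - G w) / (G w + l)).
    by rewrite /arcsine_quotient mul1r.
  rewrite (lnM (pp _ k0) (pp _ (divr_gt0 gg wl))) (ln_div (pp _ gg) (pp _ wl)).
  rewrite (ln_div (pp _ wl) (pp _ w0)) (lnM (pp _ w0) (pp _ w10)); ring.
move: key; rewrite !ge0_integralD//; last first.
  by move=> w _; rewrite lee_fin ln_ge0.
have mn0 x : (0 <= (`|ln x|)%:E)%E by rewrite lee_fin.
rewrite (@integral_arcsine_quotient 1 l (fun x => (`|ln x|)%:E))//.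
rewrite (@arcsine_reflect (fun x => (`|ln x|)%:E))//.
rewrite integral_cst// [X in (_ * X)%E](@probability_setT _ _ _ P) mule1.
move: Mfin M0; case: (\int[P]_w (`|ln (G w)|)%:E)%E => [m||]// _ _ h.
move: h; case: (\int[P]_w (`|ln (1 + l / G w)|)%:E)%E => [r [h]||]//.
by congr (_%:E); lra.
Qed.

End arcsine_expectations.

(** * Laplace exponents *)

Section laplace_exponents.
Context (R : realType).
Notation mu := (@lebesgue_measure R).
Implicit Types (x l c m t : R).

Lemma laplace_transformE d (T : measurableType d) (P : probability T R)
    (X : T -> R) l :
  laplace_transform P X l = (\int[P]_w (expR (- (l * X w)))%:E)%E.
Proof. by rewrite /laplace_transform unlock. Qed.

Let measurable_expR_lin (a : R) D : measurable_fun D (fun x : R => expR (- (a * x))).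
Proof.
apply: measurable_funTS; apply: measurableT_comp => //.
by apply: measurable_funN; exact: measurable_funM.
Qed.

Lemma integral_expR_param l x : 0 <= l -> 0 < x ->
  (\int[mu]_(m in `]0%R, l]) (expR (- (m * x)))%:E =
   ((1 - expR (- (l * x))) / x)%:E)%E.
Proof.
rewrite le_eqVlt => /predU1P[<-|l0] x0.
  by rewrite set_itv_ge ?integral_set0 ?mul0r ?oppr0 ?expR0 ?subrr ?mul0r ?bnd_simp ?ltxx.
pose F m : R := - x^-1 * expR (- (m * x)).
have dF m : is_derive m (1 : R) F (expR (- (m * x))).
  have -> : expR (- (m * x)) = - x^-1 *: (expR (- (m * x)) * - x).
    by rewrite /GRing.scale/=; field; rewrite gt_eqF.
  apply: is_deriveZ; apply: is_derive1_comp.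
  have -> : (fun m => - (m * x)) = - x \*: (@id R).
    by apply/funext => y; rewrite -[RHS]/(- x * y); ring.
  suff : is_derive m (1 : R) (- x \*: (@id R)) (- x *: (1 : R)).
    by rewrite [_ *: _]mulr1.
  exact: is_deriveZ.
rewrite (@ge0_improper_FTC R (fun m => expR (- (m * x))) F 0 l)//.
- by rewrite /F mul0r oppr0 expR0; congr (_%:E); field; rewrite gt_eqF.
- move=> m _; apply: continuous_comp; last exact: continuous_expR.
  by apply: cvgN; apply: cvgMl.
- apply: cvg_at_right_filter; apply/differentiable_continuous/derivable1_diffP.
  exact: (@ex_derive _ _ _ _ _ _ _ (dF 0)).
- move=> m _; split; first exact: (@ex_derive _ _ _ _ _ _ _ (dF m)).
  by rewrite derive1E (@derive_val _ _ _ _ _ _ _ (dF m)).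
Qed.

Lemma integral_inv_shift l c : 0 <= l -> 0 < c ->
  (\int[mu]_(m in `]0%R, l]) ((m + c)^-1)%:E = (ln (1 + l / c))%:E)%E.
Proof.
rewrite le_eqVlt => /predU1P[<-|l0] c0.
  by rewrite set_itv_ge ?integral_set0 ?mul0r ?addr0 ?ln1 ?bnd_simp ?ltxx.
pose F m : R := ln (m + c).
have dF m : 0 <= m -> is_derive m (1 : R) F ((m + c)^-1).
  move=> m0; have mc : 0 < m + c by rewrite ltr_wpDl.
  rewrite -[(m + c)^-1]mulr1.
  apply: (@is_derive1_comp R (@ln R) (fun m => m + c)).
  - exact: is_derive1_ln.
  - by apply: is_derive_eq; rewrite addr0.
rewrite (@ge0_improper_FTC R (fun m => (m + c)^-1) F 0 l)//.
- rewrite /F add0r -ln_div ?posrE ?ltr_wpDr// ?(ltW l0)//.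
  by congr ((ln _)%:E); field; rewrite gt_eqF.
- exact: ltW.
- by move=> m; rewrite in_itv/= => /andP[m0 _]; rewrite invr_ge0 addr_ge0 ?ltW.
- move=> m; rewrite in_itv/= => /andP[m0 _]; apply: cvgV.
    by rewrite gt_eqF// addr_gt0.
  by apply: cvgD => //; exact: cvg_cst.
- apply: cvg_at_right_filter; apply/differentiable_continuous/derivable1_diffP.
  exact: (@ex_derive _ _ _ _ _ _ _ (dF 0 (lexx 0))).
- move=> m; rewrite in_itv/= => /andP[/ltW m0 _].
  split; first exact: (@ex_derive _ _ _ _ _ _ _ (dF m m0)).
  by rewrite derive1E (@derive_val _ _ _ _ _ _ _ (dF m m0)).
Qed.

(** (1 - e^(-l x)) / x is the integral of e^(-m x) over m in [0, l]; exchanging the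
    integrals leaves the integral of 1 / (m + c). *)
Lemma frullani l c : 0 <= l -> 0 < c ->
  laplace_exponent (fun x => (x^-1 * expR (- (c * x)))%:E) l = (ln (1 + l / c))%:E.
Proof.
move=> l0 c0; rewrite /laplace_exponent.
pose I0 x : R := \1_(`]0, +oo[%classic : set R) x.
pose I1 x : R := \1_(`]0, l]%classic : set R) x.
have I0_gt0 x : 0 < x -> I0 x = 1.
  by move=> x0; rewrite /I0 indicE mem_set//= in_itv/= x0.
have I1_in x : 0 < x -> x <= l -> I1 x = 1.
  by move=> x0 xl; rewrite /I1 indicE mem_set//= in_itv/= x0.
pose f (z : R * R) : R := expR (- (z.2 * z.1)) * expR (- (c * z.1)) * (I0 z.1 * I1 z.2).
have f0 z : (0 <= (f z)%:E)%E.
  by rewrite lee_fin mulr_ge0// mulr_ge0 ?expR_ge0.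
have mf : measurable_fun [set: R * R] f.
  apply: measurable_funM; apply: measurable_funM.
  - by apply: measurableT_comp => //; apply: measurable_funN; exact: measurable_funM.
  - by apply: measurableT_comp => //; apply: measurable_funN; exact: measurable_funM.
  - exact: (measurableT_comp (@measurable_indic _ R R setT _ (measurable_itv _))).
  - exact: (measurableT_comp (@measurable_indic _ R R setT _ (measurable_itv _))).
transitivity (\int[mu]_x \int[mu]_m (f (x, m))%:E)%E.
  rewrite integral_mkcond; apply: eq_integral => x _.
  rewrite patchE; case: ifPn => [|x0]; last first.
    by rewrite integral0_eq// => m _; rewrite /f/= /I0 indicE (negbTE x0) mul0r mulr0.
  rewrite inE/= in_itv/= andbT => x0.
  have := integral_expR_param l0 x0 => h.
  transitivity ((expR (- (c * x)))%:E *
      \int[mu]_(m in `]0%R, l]) (expR (- (m * x)))%:E)%E.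
    by rewrite h -!EFinM; congr (_%:E); ring.
  rewrite [X in (_ * X)%E]integral_mkcond -ge0_integralZl//.
  - apply: eq_integral => m _; rewrite epatch_indic -!EFinM; congr (_%:E).
    by rewrite /f/= I0_gt0// mul1r -/(I1 m); ring.
  - apply/(measurable_restrictT _ _).1 => //; apply: measurable_funTS.
    apply/measurable_EFinP; under eq_fun do rewrite mulrC.
    exact: measurable_expR_lin.
  - by move=> m _; apply: erestrict_ge0 => y _; rewrite lee_fin expR_ge0.
rewrite (@fubini_tonelli _ _ _ _ R mu mu (fun z : R * R => (f z)%:E))//; last exact/measurable_EFinP.
rewrite -integral_inv_shift// [RHS]integral_mkcond; apply: eq_integral => m _.
rewrite patchE; case: ifPn => [|m0]; last first.
  have I1m : I1 m = 0 by rewrite /I1 indicE (negbTE m0).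
  by rewrite integral0_eq// => x _; rewrite /f/= I1m !mulr0.
rewrite inE/= in_itv/= => /andP[m0 ml].
rewrite -integral_expRN ?addr_gt0// [RHS]integral_mkcond.
apply: eq_integral => x _; rewrite epatch_indic -EFinM; congr (_%:E).
by rewrite /f/= I1_in// mulr1 -expRD mulrDl opprD.
Qed.

Lemma gamma_process_exponent l : 0 <= l ->
  laplace_exponent (fun x => (x^-1 * expR (- x))%:E) l = (ln (1 + l))%:E.
Proof.
move=> l0; have := frullani l0 ltr01; rewrite divr1; apply: etrans.
by apply: eq_integral => x _; rewrite mul1r.
Qed.

Context d (T : measurableType d) (P : probability T R) (G : {RV P >-> R}).
Hypothesis hG : has_density P G (@arcsine_pdf R).

(** Frullani's formula at c = G, averaged over G. *)
Lemma arcsine_exponent l : 0 <= l ->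
  laplace_exponent (fun x => ((x^-1)%:E * laplace_transform P G x)%E) l =
  (ln ((Num.sqrt (1 + l) + Num.sqrt l) ^+ 2))%:E.
Proof.
move=> l0; rewrite -(integral_ln_arcsine hG l0) /laplace_exponent.
pose I0 x : R := \1_(`]0, +oo[%classic : set R) x.
pose f (z : R * T) : R :=
  (1 - expR (- (l * z.1))) * (z.1^-1 * expR (- (z.1 * G z.2))) * I0 z.1.
have I0_gt0 x : 0 < x -> I0 x = 1.
  by move=> x0; rewrite /I0 indicE mem_set//= in_itv/= x0.
have I0_le0 x : x <= 0 -> I0 x = 0.
  by move=> x0; rewrite /I0 indicE memNset//= in_itv/= andbT => /(le_lt_trans x0); rewrite ltxx.
have k0 x : 0 < x -> 0 <= 1 - expR (- (l * x)).
  by move=> x0; rewrite subr_ge0 expR_le1 oppr_le0 mulr_ge0// ltW.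
have f0 z : (0 <= (f z)%:E)%E.
  rewrite lee_fin /f; have [z0|z0] := leP z.1 0; first by rewrite I0_le0// mulr0.
  by rewrite I0_gt0// mulr1 !mulr_ge0 ?k0 ?expR_ge0 ?invr_ge0 ?(ltW z0).
have mf : measurable_fun [set: R * T] f.
  apply: measurable_funM; last first.
    exact: (measurableT_comp (@measurable_indic _ R R setT _ (measurable_itv _))).
  apply: measurable_funM.
    apply: measurable_funB => //; apply: measurableT_comp => //.
    by apply: measurable_funN; exact: measurable_funM.
  apply: measurable_funM; first exact: (measurableT_comp (@measurable_invr R)).
  apply: measurableT_comp => //; apply: measurable_funN; apply: measurable_funM => //.
  exact: (measurableT_comp (measurable_funPT G)).
transitivity (\int[mu]_x \int[P]_w (f (x, w))%:E)%E.
  rewrite integral_mkcond; apply: eq_integral => x _.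
  rewrite patchE; case: ifPn => [|x0]; last first.
    by rewrite integral0_eq// => w _; rewrite /f/= /I0 indicE (negbTE x0) mulr0.
  rewrite inE/= in_itv/= andbT => x0.
  rewrite laplace_transformE.
  have me : measurable_fun [set: T] (fun w => (expR (- (x * G w)))%:E).
    apply/measurable_EFinP; apply: measurableT_comp => //.
    by apply: measurable_funN; exact: measurable_funM.
  rewrite -!ge0_integralZl//.
  - apply: eq_integral => w _; rewrite -!EFinM; congr (_%:E).
    by rewrite /f/= I0_gt0// mulr1.
  - exact: emeasurable_funM.
  - by move=> w _; rewrite mule_ge0// lee_fin ?expR_ge0 ?invr_ge0 ?(ltW x0).
  - by rewrite lee_fin k0.
  - by rewrite lee_fin invr_ge0 ltW.
rewrite (@fubini_tonelli _ _ _ _ R mu P (fun z => (f z)%:E))//; last exact/measurable_EFinP.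
apply: (ae_eq_ge0_integral hG).
- apply: (measurable_fun_fubini_tonelli_G (m1 := mu) (fun z => (f z)%:E)) => //.
  exact/measurable_EFinP.
- apply/measurable_EFinP; apply: (measurableT_comp (@measurable_ln R)).
  apply: measurable_funD => //; apply: measurable_funM => //.
  by apply: (measurableT_comp (@measurable_invr R)).
move=> w /andP[w0 w1]; rewrite -frullani// /laplace_exponent [RHS]integral_mkcond.
apply: eq_integral => x _; rewrite epatch_indic -!EFinM; congr (_%:E).
by rewrite /f/= (mulrC x).
Qed.

End laplace_exponents.

(** * The Laplace transform of the arc sine law *)

Section bessel.
Context (R : realType).
Notation mu := (@lebesgue_measure R).
Implicit Types (x y z u : R) (k n : nat).

Lemma eseries_EFin (a : R^nat) (r : R) : series a @ \oo --> r ->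
  (\sum_(k <oo) (a k)%:E = r%:E)%E.
Proof.
move=> ar; apply/cvg_lim => //.
rewrite (_ : (fun n => _) = EFin \o series a); last first.
  by apply/funext => n; rewrite /= sumEFin.
by apply: cvg_EFin => //; exact: nearW.
Qed.

(** Compares the Bessel series with that of the hyperbolic cosine. *)
Lemma fact_double_le k : ((2 * k)`! <= 4 ^ k * k`! ^ 2)%N.
Proof.
elim: k => // k ih.
have -> : (2 * k.+1 = (2 * k).+2)%N by rewrite mulnS.
rewrite !factS expnS expnMn.
apply: (@leq_trans ((2 * k).+2 * ((2 * k).+1 * (4 ^ k * k`! ^ 2)))%N).
  by rewrite !leq_mul.
rewrite mulnA (mulnACA 4%N _ _ (k`! ^ 2)%N).
rewrite leq_mul2r; apply/orP; right.
have -> : (2 * k).+2 = (2 * k.+1)%N by rewrite mulnS.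
by rewrite -[4%N]/(2 * 2)%N -mulnn (mulnACA 2 2) leq_mul// mulnS.
Qed.

Lemma cvg_cosh_series u :
  series (fun k => u ^+ (2 * k) / (2 * k)`!%:R) @ \oo --> (expR u + expR (- u)) / 2.
Proof.
have E n : series (fun k => u ^+ (2 * k) / (2 * k)`!%:R) n =
    (series (exp_coeff u) (2 * n)%N + series (exp_coeff (- u)) (2 * n)%N) / 2.
  rewrite /series/= /exp_coeff/=.
  elim: n => [|n ih]; first by rewrite muln0 !big_geq// addr0 mul0r.
  have -> : (2 * n.+1 = (2 * n).+2)%N by rewrite mulnS.
  rewrite !big_nat_recr//= ih.
  have -> : (- u) ^+ (2 * n).+1 = - u ^+ (2 * n).+1.
    by rewrite !exprS !exprM sqrrN mulNr.
  have -> : (- u) ^+ (2 * n) = u ^+ (2 * n) by rewrite !exprM sqrrN.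
  rewrite mulNr; lra.
have sub2 v : series (exp_coeff v) (2 * n)%N @[n --> \oo] --> expR v.
  have : series (exp_coeff v) @ \oo --> expR v by exact: is_cvg_series_exp_coeff.
  apply: cvg_comp; apply/cvgnyPge => A; near=> n.
  by rewrite (@leq_trans n)// ?leq_pmull//; near: n; exact: nbhs_infty_ge.
rewrite (_ : series _ = (fun n => (series (exp_coeff u) (2 * n)%N +
    series (exp_coeff (- u)) (2 * n)%N) / 2)); last by apply/funext => n; exact: E.
by apply: cvgMl; apply: cvgD; exact: sub2.
Unshelve. all: by end_near. Qed.

Context d (T : measurableType d) (P : probability T R) (G : {RV P >-> R}).
Hypothesis hG : has_density P G (@arcsine_pdf R).

Lemma rbeta_fun_half : rbeta_fun (1 / 2) (1 / 2) = pi :> R.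
Proof.
have h2 : 0 < 0 + 1 / 2 :> R by rewrite add0r.
have := arcsine_beta hG h2 h2.
under eq_integral do rewrite !powRr0 mul1r.
rewrite integral_cst// [X in (_ * X)%E](@probability_setT _ _ _ P) mule1 add0r.
move=> [h]; have p0 : pi != 0 :> R by rewrite gt_eqF// pi_gt0.
by rewrite -[LHS](divfK p0) -h mul1r.
Qed.

(** The moments E G^k, by the recursion of the gamma function. *)
Lemma rbeta_fun_natE k : rbeta_fun (k%:R + 1 / 2) (1 / 2) / pi =
  (2 * k)`!%:R / (4 ^+ k * k`!%:R ^+ 2) :> R.
Proof.
have p0 : pi != 0 :> R by rewrite gt_eqF// pi_gt0.
elim: k => [|k ih].
  by rewrite add0r rbeta_fun_half muln0 fact0 expr0 expr1n mul1r divff// divr1.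
have k0 : 0 < k%:R + 1 / 2 :> R by rewrite ltr_wpDl.
have h0 : 0 < 1 / 2 :> R by [].
have k1 : 0 < k%:R + 1 :> R by rewrite ltr_wpDl.
have Bk := rbeta_fun_gamma h0 k0.
have Bk1 := rbeta_fun_gamma h0 (addr_gt0 k0 ltr01).
have e1 : 1 / 2 + (k%:R + 1 / 2) = k%:R + 1 :> R by field.
have e2 : 1 / 2 + (k%:R + 1 / 2 + 1) = (k%:R + 1) + 1 :> R by field.
rewrite e1 in Bk; rewrite e2 (gamma_funS k1) (gamma_funS k0) in Bk1.
have g0 := gamma_fun_gt0 k1.
have rec : rbeta_fun (k.+1%:R + 1 / 2) (1 / 2) =
    (k%:R + 1 / 2) / (k%:R + 1) * rbeta_fun (k%:R + 1 / 2) (1 / 2) :> R.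
  have -> : k.+1%:R + 1 / 2 = k%:R + 1 / 2 + 1 :> R by rewrite -natr1; ring.
  apply: (mulfI (lt0r_neq0 (mulr_gt0 k1 g0))); rewrite Bk1.
  rewrite mulrCA -Bk; field.
  by rewrite gt_eqF.
rewrite rec -[LHS]mulrA ih.
have -> : (2 * k.+1 = (2 * k).+2)%N by rewrite mulnS.
have f2 : (2 * k).+2`!%:R = (2 * k%:R + 2) * (2 * k%:R + 1) * (2 * k)`!%:R :> R.
  have n1 n : n.+1%:R = n%:R + 1 :> R by rewrite natr1.
  by rewrite !factS !natrM (n1 (2 * k).+1) (n1 (2 * k)%N) natrM; ring.
have f1 : k.+1`!%:R = (k%:R + 1) * k`!%:R :> R by rewrite factS natrM -natr1.
have kf : k`!%:R != 0 :> R by rewrite pnatr_eq0 -lt0n fact_gt0.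
have k4 : 4 ^+ k != 0 :> R by rewrite expf_neq0.
rewrite f2 f1 (exprS 4 k); move: k4 kf; move: (4 ^+ k) (k`!%:R : R) => A B k4 kf.
by field; rewrite k4 kf gt_eqF.
Qed.

(** By symmetry E e^(-x G) = e^(-z) E cosh (z (1 - 2 G)) with z = x/2. In the series
    of cosh only powers of (1 - 2 G)^2 = 1 - 4 G (1 - G) appear, and this
    variable has the law of 1 - G, hence of G. *)
Lemma arcsine_bessel x : 0 < x ->
  laplace_transform P G x = (bessel_I0 (x / 2) * expR (- (x / 2)))%:E.
Proof.
move=> x0; rewrite laplace_transformE; set z := x / 2.
have z0 : 0 < z by rewrite divr_gt0.
have xE : x = 2 * z by rewrite /z mulrC divfK.
pose c k : R := z ^+ (2 * k) / (2 * k)`!%:R.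
have c0 k : 0 <= c k by rewrite divr_ge0// exprn_ge0// ltW.
have mG : measurable_fun [set: T] (fun w => expR (- (x * G w))).
  by apply: measurableT_comp => //; apply: measurable_funN; exact: measurable_funM.
have mG1 : measurable_fun [set: T] (fun w => expR (- (x * (1 - G w)))).
  apply: measurableT_comp => //; apply: measurable_funN; apply: measurable_funM => //.
  exact: measurable_funB.
have sym : (\int[P]_w (expR (- (x * G w)))%:E =
    \int[P]_w ((expR (- (x * G w)) + expR (- (x * (1 - G w)))) / 2)%:E)%E.
  have mh : measurable_fun [set: R] (fun v : R => (expR (- (x * v)) / 2)%:E).
    apply/measurable_EFinP; apply: measurable_funM => //.
    apply: measurableT_comp => //; apply: measurable_funN; exact: measurable_funM.
  have h0 v : (0 <= (expR (- (x * v)) / 2)%:E)%E by rewrite lee_fin divr_ge0 ?expR_ge0.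
  have mhG : measurable_fun [set: T] (fun w => (expR (- (x * G w)) / 2)%:E).
    by apply/measurable_EFinP; exact: measurable_funM.
  have mhG1 : measurable_fun [set: T] (fun w => (expR (- (x * (1 - G w))) / 2)%:E).
    by apply/measurable_EFinP; exact: measurable_funM.
  under [RHS]eq_integral do rewrite mulrDl EFinD.
  rewrite ge0_integralD//.
  rewrite (arcsine_reflect hG mh h0) -ge0_integralD//.
  by apply: eq_integral => w _; rewrite -EFinD; congr (_%:E); field.
have pw w : ((expR (- (x * G w)) + expR (- (x * (1 - G w)))) / 2)%:E =
  ((expR (- z))%:E * \sum_(k <oo) (c k * (1 - 4 * (G w * (1 - G w))) ^+ k)%:E)%E.
  have -> : (\sum_(k <oo) (c k * (1 - 4 * (G w * (1 - G w))) ^+ k)%:E =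
      ((expR (z * (1 - 2 * G w)) + expR (- (z * (1 - 2 * G w)))) / 2)%:E)%E.
    apply: eseries_EFin; rewrite (_ : (fun k => _) = (fun k =>
        (z * (1 - 2 * G w)) ^+ (2 * k) / (2 * k)`!%:R)); last first.
      apply/funext => k; rewrite /c.
      have -> : (1 - 4 * (G w * (1 - G w))) ^+ k = (1 - 2 * G w) ^+ (2 * k).
        by rewrite exprM; congr (_ ^+ _); ring.
      by rewrite [in RHS]exprMn mulrAC.
    exact: cvg_cosh_series.
  rewrite -EFinM; congr (_%:E).
  have -> : expR (- (x * G w)) = expR (- z) * expR (z * (1 - 2 * G w)).
    by rewrite -expRD xE; congr expR; ring.
  have -> : expR (- (x * (1 - G w))) = expR (- z) * expR (- (z * (1 - 2 * G w))).
    by rewrite -expRD xE; congr expR; ring.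
  by ring.
rewrite sym; under eq_integral do rewrite pw.
have y0 w k : 0 <= (1 - 4 * (G w * (1 - G w))) ^+ k.
  rewrite exprn_ge0// (_ : _ - _ = (1 - 2 * G w) ^+ 2) ?sqr_ge0//; ring.
have my k : measurable_fun [set: T] (fun w => (c k * (1 - 4 * (G w * (1 - G w))) ^+ k)%:E).
  apply/measurable_EFinP; apply: measurable_funM => //; apply: measurable_funX.
  apply: measurable_funB => //; apply: measurable_funM => //.
  by apply: measurable_funM => //; exact: measurable_funB.
have mS : measurable_fun [set: T]
    (fun w => (\sum_(k <oo) (c k * (1 - 4 * (G w * (1 - G w))) ^+ k)%:E)%E).
  by apply: ge0_emeasurable_sum => // k w _ _; rewrite lee_fin mulr_ge0.
have S0 w : (0 <= \sum_(k <oo) (c k * (1 - 4 * (G w * (1 - G w))) ^+ k)%:E)%E.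
  by apply: nneseries_ge0 => k _ _; rewrite lee_fin mulr_ge0.
rewrite ge0_integralZl ?lee_fin ?expR_ge0//.
rewrite integral_nneseries//; last by move=> k w _; rewrite lee_fin mulr_ge0.
have mom k : (\int[P]_w (c k * (1 - 4 * (G w * (1 - G w))) ^+ k)%:E =
   (c k * ((2 * k)`!%:R / (4 ^+ k * k`!%:R ^+ 2)))%:E)%E.
  have mh : measurable_fun [set: R] (fun v : R => (c k * `|v| ^+ k)%:E).
    apply/measurable_EFinP; apply: measurable_funM => //; apply: measurable_funX.
    exact: normr_measurable.
  have h0 (v : R) : (0 <= (c k * `|v| ^+ k)%:E)%E by rewrite lee_fin mulr_ge0 ?exprn_ge0.
  have mh1 : measurable_fun [set: R] (fun v : R => (c k * `|1 - v| ^+ k)%:E).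
    apply: (measurableT_comp mh); exact: measurable_funB.
  transitivity (\int[P]_w (c k * `|1 - 4 * (G w * (1 - G w))| ^+ k)%:E)%E.
    apply: eq_integral => w _; rewrite ger0_norm//; exact: (y0 w 1%N).
  rewrite (arcsine_double hG mh1)//.
  rewrite (arcsine_reflect hG mh h0).
  have k2 : 0 < k%:R + 1 / 2 :> R by rewrite ltr_wpDl.
  rewrite -rbeta_fun_natE EFinM -(arcsine_moment hG k2).
  have mk : measurable_fun [set: T] (fun w => (G w `^ k%:R)%:E).
    apply/measurable_EFinP; exact: (measurableT_comp (@measurable_powR R k%:R)).
  rewrite -ge0_integralZl//; [|by move=> w _; rewrite lee_fin powR_ge0|by rewrite lee_fin].
  apply: (ae_eq_ge0_integral hG); [exact: (measurableT_comp mh)|exact: emeasurable_funM|].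
  move=> w /andP[w0 _]; rewrite -EFinM; congr (_%:E).
  by rewrite powR_mulrn ?ltW// ger0_norm// ltW.
rewrite (eq_eseriesr (fun k _ => mom k)) mulrC EFinM; congr (_ * _)%E.
(* the moment of order k turns the coefficient of cosh into that of I_0 *)
have dE k : c k * ((2 * k)`!%:R / (4 ^+ k * k`!%:R ^+ 2)) =
    (z / 2) ^+ (2 * k) / k`!%:R ^+ 2.
  have kf : k`!%:R != 0 :> R by rewrite pnatr_eq0 -lt0n fact_gt0.
  have kf2 : (2 * k)`!%:R != 0 :> R by rewrite pnatr_eq0 -lt0n fact_gt0.
  have k4 : 4 ^+ k != 0 :> R by rewrite expf_neq0.
  have -> : (z / 2) ^+ (2 * k) = z ^+ (2 * k) / 4 ^+ k.
    rewrite exprMn; congr (_ * _); rewrite exprM -exprVn; congr (_ ^+ _).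
    by field.
  rewrite /c; move: k4 kf kf2; move: (4 ^+ k) (k`!%:R : R) ((2 * k)`!%:R : R).
  by move=> A B C A0 B0 C0; field; rewrite A0 B0 C0.
apply: eseries_EFin; rewrite (funext dE) /bessel_I0.
apply: (@series_le_cvg _ _ c) => // [k|k|].
- by rewrite -dE mulr_ge0// divr_ge0// mulr_ge0// exprn_ge0.
- rewrite -dE ler_piMr// ler_pdivrMr; last first.
    by rewrite mulr_gt0 ?exprn_gt0// ltr0n fact_gt0.
  by rewrite mul1r -natrX -natrX -natrM ler_nat fact_double_le.
- by apply: cvgP; exact: cvg_cosh_series.
Qed.

End bessel.

(** * Mixtures with a gamma variable *)

Section densities.
Context (R : realType).
Notation mu := (@lebesgue_measure R).
Implicit Types (x y l t a b c : R).

Lemma gamma_pdfE a : gamma_pdf a = (fun x => (gamma_fun a)^-1 * gamma_kernel a x).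
Proof. by apply/funext => x; rewrite /gamma_pdf /gamma_kernel; ring. Qed.

Lemma rbeta_pdfE a b :
  rbeta_pdf a b = (fun x => (rbeta_fun a b)^-1 * beta_kernel a b x).
Proof. by apply/funext => x; rewrite /rbeta_pdf /beta_kernel; ring. Qed.

Lemma measurable_gamma_pdf a : measurable_fun [set: R] (gamma_pdf a).
Proof.
rewrite gamma_pdfE; apply: measurable_funM => //.
exact: measurable_gamma_kernel.
Qed.

Lemma gamma_pdf_ge0 a : 0 < a -> forall x, 0 <= gamma_pdf a x.
Proof.
move=> a0 x; rewrite gamma_pdfE mulr_ge0 ?gamma_kernel_ge0// invr_ge0.
by rewrite ltW// gamma_fun_gt0.
Qed.

Lemma measurable_rbeta_pdf a b : measurable_fun [set: R] (rbeta_pdf a b).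
Proof.
rewrite rbeta_pdfE; apply: measurable_funM => //.
exact: measurable_beta_kernel.
Qed.

Lemma rbeta_pdf_ge0 a b : 0 < a -> 0 < b -> forall x, 0 <= rbeta_pdf a b x.
Proof.
move=> a0 b0 x; rewrite rbeta_pdfE mulr_ge0 ?beta_kernel_ge0// invr_ge0.
by rewrite ltW// rbeta_fun_gt0.
Qed.

Lemma rbeta_funC a c : 0 < a -> 0 < c -> rbeta_fun a c = rbeta_fun c a.
Proof.
move=> a0 c0; apply: (mulfI (lt0r_neq0 (gamma_fun_gt0 (addr_gt0 c0 a0)))).
have h1 := rbeta_fun_gamma a0 c0; have h2 := rbeta_fun_gamma c0 a0.
rewrite (addrC c a) in h2 *; move: h1 h2.
move: (gamma_fun (a + c)) (rbeta_fun a c) (rbeta_fun c a) => s u v h1 h2.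
by rewrite h2 h1 mulrC.
Qed.

Context d (T : measurableType d) (P : probability T R).

Lemma ae_density (X : {RV P >-> R}) (f : R -> R) (A : set R) :
  has_density P X f -> measurable A -> (forall x, ~ A x -> f x = 0) ->
  {ae P, forall w, A (X w)}.
Proof.
move=> Xf mA fA; exists (X @^-1` (~` A)); split => //.
- by rewrite -[_ @^-1` _]setTI; apply: (measurable_funPT X) => //; exact: measurableC.
- rewrite Xf; last exact: measurableC.
  by rewrite integral0_eq// => x /= /fA ->.
Qed.

Lemma ae_gamma_gt0 (g : {RV P >-> R}) a :
  has_density P g (gamma_pdf a) -> {ae P, forall w, 0 < g w}.
Proof.
move=> hg; have h : {ae P, forall w, `]0, +oo[%classic (g w)}.
  apply: (ae_density hg) => // x /negP; rewrite in_itv/= andbT -leNgt => x0.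
  by rewrite gamma_pdfE gamma_kernel_le0// mulr0.
by apply: filterS h => w /=; rewrite in_itv/= andbT.
Qed.

Lemma ae_beta01 (b : {RV P >-> R}) a c :
  has_density P b (rbeta_pdf a c) -> {ae P, forall w, 0 < b w < 1}.
Proof.
move=> hb; have h : {ae P, forall w, `]0, 1[%classic (b w)}.
  apply: (ae_density hb) => // x /negP; rewrite in_itv/= => x01.
  by rewrite rbeta_pdfE beta_kernel_out// mulr0.
by apply: filterS h => w /=; rewrite in_itv/=.
Qed.

Lemma gamma_mixture_laplace t (g Y : {RV P >-> R}) l : 0 < t ->
  has_density P g (gamma_pdf t) -> independent2 P g Y ->
  (\int[P]_w (expR (- (l * (g w * Y w))))%:E =
   \int[mu]_x ((gamma_pdf t x)%:E * \int[P]_w (expR (- (l * x * Y w)))%:E))%E.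
Proof.
move=> t0 hg gY.
pose h (z : R * R) : \bar R := (expR (- (l * (z.1 * z.2))))%:E.
have mh : measurable_fun [set: R * R] h.
  apply/measurable_EFinP; apply: measurableT_comp => //; apply: measurable_funN.
  by apply: measurable_funM => //; exact: measurable_funM.
have h0 z : (0 <= h z)%E by rewrite lee_fin expR_ge0.
have := integral_independent2 gY mh h0; rewrite /h/= => ->.
have mi : measurable_fun [set: R] (fun x => \int[P]_w (expR (- (l * (x * Y w))))%:E)%E.
  apply: (@measurable_fun_fubini_tonelli_F _ _ R T R P (fun z => (expR (- (l * (z.1 * Y z.2))))%:E)).
  - apply/measurable_EFinP; apply: measurableT_comp => //; apply: measurable_funN.
    apply: measurable_funM => //; apply: measurable_funM => //.
    exact: (measurableT_comp (measurable_funPT Y)).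
  - by move=> z; rewrite lee_fin expR_ge0.
rewrite (@integral_density R _ T P g _ (fun x => \int[P]_w (expR (- (l * (x * Y w))))%:E)%E
  hg (@measurable_gamma_pdf t) (gamma_pdf_ge0 t0) mi); last first.
  by move=> x; apply: integral_ge0 => w _; rewrite lee_fin expR_ge0.
by apply: eq_integral => x _; under [in RHS]eq_integral do rewrite -mulrA.
Qed.

(** Integrating over the gamma variable first turns the Laplace transform of a
    product g Y into the generalised Stieltjes transform of Y. *)
Lemma gamma_mixture_stieltjes t (Y : {RV P >-> R}) l : 0 < t -> 0 <= l ->
  {ae P, forall w, 0 <= Y w} ->
  (\int[mu]_x ((gamma_pdf t x)%:E * \int[P]_w (expR (- (l * x * Y w)))%:E) =
   \int[P]_w ((1 + l * Y w) `^ (- t))%:E)%E.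
Proof.
move=> t0 l0 Y0.
pose f (z : R * T) : \bar R := (gamma_pdf t z.1 * expR (- (l * z.1 * Y z.2)))%:E.
have mf : measurable_fun [set: R * T] f.
  apply/measurable_EFinP; apply: measurable_funM.
    by apply: (measurableT_comp (@measurable_gamma_pdf t)).
  apply: measurableT_comp => //; apply: measurable_funN.
  apply: measurable_funM; first exact: measurable_funM.
  exact: (measurableT_comp (measurable_funPT Y)).
have f0 z : (0 <= f z)%E by rewrite lee_fin mulr_ge0 ?expR_ge0 ?gamma_pdf_ge0.
transitivity (\int[mu]_x \int[P]_w f (x, w))%E.
  apply: eq_integral => x _; rewrite -ge0_integralZl//.
  - apply/measurable_EFinP; apply: measurableT_comp => //; apply: measurable_funN.
    by apply: measurable_funM.
  - by rewrite lee_fin gamma_pdf_ge0.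
rewrite (@fubini_tonelli _ _ _ _ R mu P f)//.
apply: ae_eq_integral => //.
- exact: (measurable_fun_fubini_tonelli_G (m1 := mu) f).
- apply/measurable_EFinP; apply: (measurableT_comp (@measurable_powR R (- t))).
  by apply: measurable_funD => //; exact: measurable_funM.
apply: filterS Y0 => w Yw _; rewrite /f/=.
have lY : 0 <= l * Y w by rewrite mulr_ge0.
have g0 := gamma_fun_gt0 t0.
have := laplace_gamma_kernel t0 lY => h.
transitivity (((gamma_fun t)^-1)%:E * ((1 + l * Y w) `^ (- t) * gamma_fun t)%:E)%E; last first.
  by rewrite -EFinM; congr (_%:E); field; rewrite gt_eqF.
rewrite -h -ge0_integralZl//.
- apply: eq_integral => x _; rewrite -!EFinM gamma_pdfE; congr (_%:E).
  by rewrite (mulrAC l); ring.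
- apply: emeasurable_funM; apply/measurable_EFinP.
    exact: measurable_gamma_kernel.
  apply: measurableT_comp => //; apply: measurable_funN; exact: measurable_funM.
- by move=> x _; rewrite -EFinM lee_fin mulr_ge0 ?expR_ge0 ?gamma_kernel_ge0.
- by rewrite lee_fin invr_ge0 ltW.
Qed.

End densities.

Section gamma_mixing.
Context (R : realType).
Notation mu := (@lebesgue_measure R).
Implicit Types (x y l t : R).

Section one_variable.
Context d (T : measurableType d) (P : probability T R) (Y : {RV P >-> R}).
Hypothesis Y0 : {ae P, forall w, 0 <= Y w}.

Let L y : \bar R := (\int[P]_w (expR (- (y * Y w)))%:E)%E.

Let L_ge0 y : (0 <= L y)%E.
Proof. by apply: integral_ge0 => w _; rewrite lee_fin expR_ge0. Qed.

Lemma measurable_expR_RV y : measurable_fun [set: T] (fun w => (expR (- (y * Y w)))%:E).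
Proof.
apply/measurable_EFinP; apply: measurableT_comp => //; apply: measurable_funN.
exact: measurable_funM.
Qed.

Lemma laplace_le1 y : 0 <= y -> (\int[P]_w (expR (- (y * Y w)))%:E <= 1)%E.
Proof.
move=> y0; rewrite -(@probability_setT _ _ _ P) -[leRHS]mul1e -integral_cst//.
apply: ae_ge0_le_integral => //.
- exact: measurable_expR_RV.
- by apply: filterS Y0 => w Yw _; rewrite lee_fin expR_le1 oppr_le0 mulr_ge0.
Qed.

Lemma measurable_laplace :
  measurable_fun [set: R] (fun y => \int[P]_w (expR (- (y * Y w)))%:E)%E.
Proof.
apply: (@measurable_fun_fubini_tonelli_F _ _ R T R P (fun z => (expR (- (z.1 * Y z.2)))%:E)).
- apply/measurable_EFinP; apply: measurableT_comp => //; apply: measurable_funN.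
  by apply: measurable_funM => //; exact: (measurableT_comp (measurable_funPT Y)).
- by move=> z; rewrite lee_fin expR_ge0.
Qed.

Lemma cvg_laplace (s : R^nat) y : (forall n, 0 <= s n) -> s @ \oo --> y ->
  (\int[P]_w (expR (- (s n * Y w)))%:E)%E @[n --> \oo] -->
  (\int[P]_w (expR (- (y * Y w)))%:E)%E.
Proof.
move=> s0 sy.
have cvgf : {ae P, forall w, [set: T] w ->
    (fun n => (expR (- (s n * Y w)))%:E) @ \oo --> (expR (- (y * Y w)))%:E}.
  apply: aeW => w _; apply: cvg_EFin; first exact: nearW.
  apply: continuous_cvg; first exact: continuous_expR.
  by apply: cvgN; apply: cvgMl.
have int1 : P.-integrable [set: T] (cst 1%E : T -> \bar R).
  exact: finite_measure_integrable_cst.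
have bnd : {ae P, forall w n, [set: T] w ->
    (`|(expR (- (s n * Y w)))%:E| <= (cst 1%E : T -> \bar R) w)%E}.
  apply: filterS Y0 => w Yw n _; rewrite gee0_abs ?lee_fin ?expR_ge0//.
  by rewrite expR_le1 oppr_le0 mulr_ge0.
by have [] := dominated_convergence measurableT
  (fun n => measurable_expR_RV (s n)) (measurable_expR_RV y) cvgf int1 bnd.
Qed.

Lemma laplace_fin_num y : 0 <= y ->
  (\int[P]_w (expR (- (y * Y w)))%:E)%E \is a fin_num.
Proof.
move=> y0; rewrite ge0_fin_numE; last exact: L_ge0.
by rewrite (le_lt_trans (laplace_le1 y0))// ltry.
Qed.

(** The function x^(t-1) e^(-x) E e^(-x Y) on the half-line: it determines the law
    of Y, and its own Laplace transform at l is, up to an explicit factor, the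
    Stieltjes transform of Y at 1 / (1 + l). *)
Definition mixing_density t y : R :=
  gamma_kernel t y * fine (\int[P]_w (expR (- (y * Y w)))%:E)%E.

Lemma measurable_mixing_density t : measurable_fun [set: R] (mixing_density t).
Proof.
apply: measurable_funM; first exact: measurable_gamma_kernel.
by apply: (measurableT_comp (@fine_measurable R _ measurableT)); exact: measurable_laplace.
Qed.

Lemma mixing_density_ge0 t y : 0 <= mixing_density t y.
Proof. by apply: mulr_ge0; [exact: gamma_kernel_ge0|apply: fine_ge0; exact: L_ge0]. Qed.

(** The substitution y = x / (1 + l). *)
Lemma laplace_mixing_density t l : 0 < t -> 0 <= l ->
  (\int[mu]_y ((mixing_density t y)%:E * (expR (- (l * y)))%:E) =
   ((1 + l) `^ (- t) * gamma_fun t)%:E *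
   \int[mu]_x ((gamma_pdf t x)%:E *
     \int[P]_w (expR (- ((1 + l)^-1 * x * Y w)))%:E))%E.
Proof.
move=> t0 l0; have l1 : 0 < 1 + l by rewrite ltr_wpDr.
have l1N : 1 + l != 0 by rewrite gt_eqF.
have mm := measurable_mixing_density t.
have mf : measurable_fun [set: R]
    (fun y => (mixing_density t y)%:E * (expR (- (l * y)))%:E)%E.
  apply: emeasurable_funM; first exact/measurable_EFinP.
  apply/measurable_EFinP; apply: measurableT_comp => //; apply: measurable_funN.
  exact: measurable_funM.
have f0 y : (0 <= (mixing_density t y)%:E * (expR (- (l * y)))%:E)%E.
  by apply: mule_ge0; rewrite lee_fin ?mixing_density_ge0 ?expR_ge0.
have mg : measurable_fun [set: R] (fun x => (gamma_pdf t x)%:E *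
    \int[P]_w (expR (- ((1 + l)^-1 * x * Y w)))%:E)%E.
  apply: emeasurable_funM; first by apply/measurable_EFinP; exact: measurable_gamma_pdf.
  apply: (measurableT_comp measurable_laplace); exact: measurable_funM.
have g0 x : (0 <= (gamma_pdf t x)%:E *
    \int[P]_w (expR (- ((1 + l)^-1 * x * Y w)))%:E)%E.
  by apply: mule_ge0; [rewrite lee_fin gamma_pdf_ge0|exact: L_ge0].
have il0 : 0 < (1 + l)^-1 by rewrite invr_gt0.
have k0 : (0 <= ((1 + l) `^ (- t) * gamma_fun t)%:E)%E.
  by rewrite lee_fin mulr_ge0 ?powR_ge0// ltW// gamma_fun_gt0.
have ma : measurable_fun [set: R] (fun x => (1 + l)^-1 * x + 0) by exact: measurable_affine.
rewrite (ge0_integral_affine 0 il0 mf f0).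
rewrite -ge0_integralZl//; last 2 first.
- exact: (measurableT_comp mf ma).
- by rewrite lee_fin ltW.
rewrite -ge0_integralZl//.
apply: eq_integral => x _; rewrite addr0.
have [x0|x0] := leP x 0.
  have x0' : (1 + l)^-1 * x <= 0 by rewrite mulr_ge0_le0// ltW.
  by rewrite /mixing_density gamma_pdfE !gamma_kernel_le0// mulr0 !mul0r !mul0e !mule0.
have x0' : 0 < (1 + l)^-1 * x by rewrite mulr_gt0.
rewrite -[X in (_ = _ * (_ * X))%E]fineK; last exact: laplace_fin_num (ltW x0').
rewrite -!EFinM; congr (_%:E); rewrite /mixing_density gamma_pdfE !gamma_kernel_gt0//.
move: (fine _) => J.
rewrite (powRM _ (ltW il0) (ltW x0)).
have -> : (1 + l) `^ (- t) = (1 + l)^-1 * (1 + l)^-1 `^ (t - 1).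
  rewrite -[(1 + l)^-1]powR_inv1 ?(ltW l1)// -powRrM -powRD; last first.
    by rewrite l1N implybT.
  by congr powR; ring.
have -> : expR (- x) = expR (- ((1 + l)^-1 * x)) * expR (- (l * ((1 + l)^-1 * x))).
  by rewrite -expRD; congr expR; field.
have gN : gamma_fun t != 0 :> R by rewrite gt_eqF// gamma_fun_gt0.
move: gN; move: (gamma_fun t) => g gN; field.
by rewrite gN l1N.
Qed.

End one_variable.

(** Equal mixtures give equal Laplace transforms of the mixing densities, hence
    mixing densities equal almost everywhere; so the Laplace transforms of Y1
    and Y2 agree almost everywhere, then everywhere by continuity. *)
Lemma gamma_mixture_unique t d1 (T1 : measurableType d1) (P1 : probability T1 R)
    d2 (T2 : measurableType d2) (P2 : probability T2 R)
    (Y1 : {RV P1 >-> R}) (Y2 : {RV P2 >-> R}) : 0 < t ->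
  {ae P1, forall w, 0 <= Y1 w} -> {ae P2, forall w, 0 <= Y2 w} ->
  (forall l, (0 <= l)%R ->
    \int[mu]_x ((gamma_pdf t x)%:E * \int[P1]_w (expR (- (l * x * Y1 w)))%:E) =
    \int[mu]_x ((gamma_pdf t x)%:E * \int[P2]_w (expR (- (l * x * Y2 w)))%:E))%E ->
  eq_law P1 Y1 P2 Y2.
Proof.
move=> t0 Y10 Y20 H.
have m1 := measurable_mixing_density Y1 t; have g1 := mixing_density_ge0 Y1 t.
have m2 := measurable_mixing_density Y2 t; have g2 := mixing_density_ge0 Y2 t.
have mixE l : 0 <= l ->
    (\int[mu]_y ((mixing_density Y1 t y)%:E * (expR (- (l * y)))%:E) =
     \int[mu]_y ((mixing_density Y2 t y)%:E * (expR (- (l * y)))%:E))%E.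
  move=> l0; rewrite (laplace_mixing_density Y10)// (laplace_mixing_density Y20)//.
  by rewrite H// invr_ge0 addr_ge0.
have mix0 d (T : measurableType d) (P : probability T R) (Y : {RV P >-> R}) y :
    y <= 0 -> mixing_density Y t y = 0.
  by move=> y0; rewrite /mixing_density gamma_kernel_le0// mul0r.
have mixy : (\int[mu]_y (mixing_density Y1 t y)%:E < +oo)%E.
  apply: (@le_lt_trans _ _ (\int[mu]_y (gamma_kernel t y)%:E)%E).
    apply: ge0_le_integral => //.
    - by move=> y _; rewrite lee_fin.
    - exact/measurable_EFinP.
    - by apply/measurable_EFinP; exact: measurable_gamma_kernel.
    - move=> y _; rewrite lee_fin; have [y0|y0] := leP y 0.
        by rewrite mix0// gamma_kernel_ge0.
      rewrite /mixing_density ler_piMr ?gamma_kernel_ge0// -lee_fin fineK.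
        by apply: laplace_le1 => //; exact: ltW.
      by apply: laplace_fin_num => //; exact: ltW.
  exact: gamma_kernel_lty.
pose nu1 : {measure set (measurableTypeR R) -> \bar R} := density_measure mu m1 g1.
pose nu2 : {measure set (measurableTypeR R) -> \bar R} := density_measure mu m2 g2.
have mid : measurable_fun [set: measurableTypeR R] (idfun : measurableTypeR R -> R).
  exact: measurable_id.
pose X : {mfun (measurableTypeR R) >-> R} :=
  HB.pack (idfun : measurableTypeR R -> R) (isMeasurableFun.Build _ _ _ _ _ mid).
have me l : measurable_fun [set: R] (fun x => (expR (- (l * x)))%:E).
  apply/measurable_EFinP; apply: measurableT_comp => //; apply: measurable_funN.
  exact: measurable_funM.
have e0 l x : (0 <= (expR (- (l * x)))%:E)%E by rewrite lee_fin expR_ge0.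
have nu12 (A : set R) : measurable A -> nu1 A = nu2 A.
  have neg d (T : measurableType d) (P : probability T R) (Y : {RV P >-> R})
      (mY : measurable_fun [set: R] (mixing_density Y t))
      (Y_ge0 : forall y, 0 <= mixing_density Y t y) :
      {ae (density_measure mu mY Y_ge0), forall w, 0 <= X w}.
    exists `]-oo, 0[%classic; split => //.
    - rewrite [LHS](_ : _ = \int[mu]_(y in `]-oo, 0%R[) (mixing_density Y t y)%:E)%E//.
      rewrite integral0_eq// => y /=; rewrite in_itv/= => y0.
      by rewrite mix0// ltW.
    - by move=> y /= /negP; rewrite -ltNge in_itv.
  apply: (@laplace_unique R _ _ nu1 _ _ nu2 X X).
  - exact: mixy.
  - exact: neg.
  - exact: neg.
  - move=> l l0; transitivity (\int[mu]_y ((mixing_density Y1 t y)%:E * (expR (- (l * y)))%:E))%E.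
      exact: (ge0_integral_density_measure mu m1 g1 (me l) (e0 l)).
    rewrite mixE//; symmetry.
    exact: (ge0_integral_density_measure mu m2 g2 (me l) (e0 l)).
have aeL : ae_eq mu setT (EFin \o mixing_density Y1 t) (EFin \o mixing_density Y2 t).
  apply: integral_ae_eq => //.
  - apply/integrableP; split; first exact/measurable_EFinP.
    by under eq_integral do rewrite gee0_abs ?lee_fin//.
  - exact/measurable_EFinP.
  - by move=> A _ mA; exact: nu12.
have LL y : 0 <= y -> (\int[P1]_w (expR (- (y * Y1 w)))%:E =
                       \int[P2]_w (expR (- (y * Y2 w)))%:E)%E.
  move=> y0; have [N [mN N0 sN]] := aeL.
  (* points outside the null set, decreasing to y *)
  have ex n : exists z, y < z < y + n.+1%:R^-1 /\ ~ N z.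
    apply: contrapT => /forallNP h.
    have yb : 0 < (n.+1%:R^-1 : R) by rewrite invr_gt0 ltr0n.
    move: yb h; move: (n.+1%:R^-1 : R) => b b0 h.
    have : (mu `]y, (y + b)%R[%classic <= mu N)%E.
      apply: le_measure; rewrite ?inE// => z; rewrite /= in_itv/= => yz.
      by apply: contrapT => Nz; exact: (h z).
    rewrite N0 lebesgue_measure_itv/= lte_fin ltrDl b0/=.
    by rewrite -EFinB lee_fin addrC addKr leNgt b0.
  have [s sP] := choice ex.
  have s0 n : 0 <= s n by have [/andP[/ltW h _] _] := sP n; exact: le_trans h.
  have sy : s @ \oo --> y.
    apply: (@squeeze_cvgr _ _ _ _ (cst y) (fun n => y + n.+1%:R^-1)).
    - by apply: nearW => n; have [/andP[/ltW -> /ltW ->] _] := sP n.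
    - exact: cvg_cst.
    - rewrite -[X in _ --> X]addr0; apply: cvgD; first exact: cvg_cst.
      exact: cvg_harmonic.
  have c1 := cvg_laplace Y10 s0 sy.
  have := cvg_laplace Y20 s0 sy.
  rewrite (_ : (fun n => _) = (fun n => \int[P1]_w (expR (- (s n * Y1 w)))%:E)%E).
    by move/cvg_unique => /(_ _ _ c1) ->.
  apply/funext => n; have [/andP[ys _] NN] := sP n.
  have sn0 : 0 < s n by rewrite (le_lt_trans y0).
  have : (EFin \o mixing_density Y1 t) (s n) = (EFin \o mixing_density Y2 t) (s n).
    by apply: contrapT => ne; apply: NN; apply: sN => /= /(_ I).
  move=> []; have gN : gamma_kernel t (s n) != 0.
    by rewrite gamma_kernel_gt0// gt_eqF// mulr_gt0 ?powR_gt0 ?expR_gt0.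
  move=> /(mulfI gN) h; rewrite -[LHS]fineK; last exact: laplace_fin_num (ltW sn0).
  by rewrite -[RHS]fineK ?h//; exact: laplace_fin_num (ltW sn0).
move=> A mA; apply: (@laplace_unique R _ _ P1 _ _ P2 Y1 Y2) => //.
by rewrite (@le_lt_trans _ _ 1%E) ?ltry// probability_le1.
Qed.

End gamma_mixing.

(** * The laws of the subordinator *)

Lemma subordinator_ge0 (R : realType) d (T : measurableType d) (P : probability T R)
    (X : R -> {RV P >-> R}) (t : R) :
  subordinator X -> 0 <= t -> {ae P, forall w, 0 <= X t w}.
Proof.
move=> [X0 Xc _ _] t0; apply: filterS2 X0 Xc => w X0w [nd _].
have := nd 0 t t0; rewrite /extend_below0.
by rewrite (max_idPl (lexx _)) (max_r t0) X0w.
Qed.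

Section beta_identities.
Context (R : realType).
Notation mu := (@lebesgue_measure R).
Implicit Types (x y l t : R).
Context d0 (T0 : measurableType d0) (P0 : probability T0 R) (G : {RV P0 >-> R}).
Hypothesis hG : has_density P0 G (@arcsine_pdf R).

Lemma expeR_arcsine_exponent l t : 0 <= l ->
  expeR (- (t%:E * (ln ((Num.sqrt (1 + l) + Num.sqrt l) ^+ 2))%:E))%E =
  ((Num.sqrt (1 + l) - Num.sqrt l) `^ (2 * t))%:E.
Proof.
move=> l0; rewrite sqrt_sub_powR//=; congr (_%:E).
by rewrite /powR gt_eqF ?mulNr// exprn_gt0// sqrt_add_gt0.
Qed.

Section subordinator_laplace.
Context d (T : measurableType d) (P : probability T R) (Gam : R -> {RV P >-> R}).
Hypothesis hGam : driftless_subordinator Gam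
  (fun x => ((x^-1)%:E * laplace_transform P0 G x)%E).

Lemma arcsine_subordinator_laplace l t : 0 <= l -> 0 <= t ->
  (\int[P]_w (expR (- (l * Gam t w)))%:E =
   ((Num.sqrt (1 + l) - Num.sqrt l) `^ (2 * t))%:E)%E.
Proof.
move=> l0 t0; rewrite -laplace_transformE hGam.2// (arcsine_exponent hG)//.
exact: expeR_arcsine_exponent.
Qed.

End subordinator_laplace.

Lemma arcsine_mass t : 0 < t ->
  rbeta_fun (1 / 2) (1 / 2 + t) = rbeta_fun (t + 1 / 2) (1 / 2) :> R.
Proof.
move=> t0; have h2 : 0 < 1 / 2 :> R by [].
rewrite (addrC (1 / 2) t); exact: (rbeta_funC h2 (addr_gt0 t0 h2)).
Qed.

Lemma integral_beta_arcsine d1 (T1 : measurableType d1) (P1 : probability T1 R)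
    (b : {RV P1 >-> R}) t (h : R -> \bar R) : 0 < t ->
  has_density P1 b (rbeta_pdf (1 / 2) (1 / 2 + t)) ->
  measurable_fun [set: R] h -> (forall x, (0 <= h x)%E) ->
  (\int[P1]_w h (b w) = (pi / rbeta_fun (t + 1 / 2) (1 / 2))%:E *
    \int[P0]_w (h (G w) * ((1 - G w) `^ t)%:E))%E.
Proof.
move=> t0 hb mh h0.
have t2 : 0 < 1 / 2 + t by rewrite addr_gt0.
have h2 : 0 < 1 / 2 :> R by [].
rewrite (integral_density hb (@measurable_rbeta_pdf R _ _) (rbeta_pdf_ge0 h2 t2) mh h0).
have := integral_beta_kernel_arcsine hG 0 t mh h0.
move=> e; rewrite add0r (addrC t) in e.
have B0 := rbeta_fun_gt0 t2 h2.
transitivity (((rbeta_fun (1 / 2) (1 / 2 + t))^-1)%:E *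
    \int[mu]_x (h x * (beta_kernel (1 / 2) (1 / 2 + t) x)%:E))%E.
  rewrite -ge0_integralZl//.
  - apply: eq_integral => x _; rewrite rbeta_pdfE EFinM -muleA; congr (_ * _)%E.
    exact: muleC.
  - apply: emeasurable_funM => //; apply/measurable_EFinP.
    exact: measurable_beta_kernel.
  - by move=> x _; rewrite mule_ge0// lee_fin beta_kernel_ge0.
  - by rewrite lee_fin invr_ge0 ltW.
rewrite e muleA -EFinM arcsine_mass//.
move: (rbeta_fun (t + 1 / 2) (1 / 2)) (pi : R) => B p; rewrite [B^-1 * p]mulrC.
congr (_ * _)%E; apply: eq_integral => w _; by rewrite powRr0 mul1r.
Qed.

(** Biasing by (1 - G)^t, with G^t / (G + l)^t from the Stieltjes kernel, produces
    exactly the quotient (G (1 - G) / (G + l))^t. *)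
Lemma beta_stieltjes d1 (T1 : measurableType d1) (P1 : probability T1 R)
    (b : {RV P1 >-> R}) t l : 0 < t -> 0 <= l ->
  has_density P1 b (rbeta_pdf (1 / 2) (1 / 2 + t)) ->
  (\int[P1]_w ((1 + l * (b w)^-1) `^ (- t))%:E =
   ((Num.sqrt (1 + l) - Num.sqrt l) `^ (2 * t))%:E)%E.
Proof.
move=> t0 l0 hb.
have mh : measurable_fun [set: R] (fun x : R => ((1 + l * x^-1) `^ (- t))%:E).
  apply/measurable_EFinP; apply: (measurableT_comp (@measurable_powR R (- t))).
  apply: measurable_funD => //; apply: measurable_funM => //; exact: measurable_invr.
have t2 : 0 < t + 1 / 2 by rewrite addr_gt0.
have B0 : 0 < rbeta_fun (t + 1 / 2) (1 / 2) :> R by exact: rbeta_fun_gt0.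
rewrite (integral_beta_arcsine t0 hb mh); last by move=> x; rewrite lee_fin powR_ge0.
transitivity ((pi / rbeta_fun (t + 1 / 2) (1 / 2))%:E *
    \int[P0]_w ((G w * (1 - G w) / (G w + l)) `^ t)%:E)%E; last first.
  rewrite (integral_arcsine_quotient_powR hG)// -EFinM; congr (_%:E).
  have p0 : pi != 0 :> R by rewrite gt_eqF// pi_gt0.
  rewrite mulrCA -[RHS]mulr1; congr (_ * _).
  by rewrite mulrA divfK ?mulfV// gt_eqF.
congr (_ * _)%E; apply: (ae_eq_ge0_integral hG).
- apply: emeasurable_funM.
    by apply: (measurableT_comp mh).
  apply/measurable_EFinP; apply: (measurableT_comp (@measurable_powR R t)).
  exact: measurable_funB.
- apply/measurable_EFinP; apply: (measurableT_comp (@measurable_powR R t)).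
  apply: measurable_funM; first by apply: measurable_funM => //; exact: measurable_funB.
  by apply: (measurableT_comp (@measurable_invr R)); exact: measurable_funD.
move=> w /andP[w0 w1]; rewrite -EFinM; congr (_%:E).
have w10 : 0 < 1 - G w by rewrite subr_gt0.
have wl : 0 < G w + l by rewrite ltr_wpDr.
have -> : 1 + l * (G w)^-1 = (G w / (G w + l))^-1.
  by field; rewrite !gt_eqF.
have q0 : 0 < G w / (G w + l) by rewrite divr_gt0.
rewrite -powR_inv1 ?ltW// -powRrM mulN1r opprK -powRM ?ltW//.
by congr powR; ring.
Qed.

Lemma independent2C d1 (T1 : measurableType d1) (P1 : probability T1 R)
    (X Y : T1 -> R) : independent2 P1 X Y -> independent2 P1 Y X.
Proof. by move=> XY A B mA mB; rewrite setIC XY// muleC. Qed.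

Lemma ae_beta_inv_ge0 d1 (T1 : measurableType d1) (P1 : probability T1 R)
    (b : {RV P1 >-> R}) (a c : R) : has_density P1 b (rbeta_pdf a c) ->
  {ae P1, forall w, 0 <= (b w)^-1}.
Proof.
move=> hb; apply: filterS (ae_beta01 hb) => w /andP[b0 _].
by rewrite invr_ge0 ltW.
Qed.

(** Since 1 + g / g' = 1 / (g' / (g + g')), it suffices that g' / (g + g') is a
    beta variable. *)
Lemma beta_gamma_ratio d1 (T1 : measurableType d1) (P1 : probability T1 R)
    (b : {RV P1 >-> R}) d2 (T2 : measurableType d2) (P2 : probability T2 R)
    (g g' : {RV P2 >-> R}) a c : 0 < a -> 0 < c ->
  has_density P1 b (rbeta_pdf c a) -> has_density P2 g (gamma_pdf a) ->
  has_density P2 g' (gamma_pdf c) -> independent2 P2 g g' ->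
  eq_law P1 (fun w => 1 / b w) P2 (fun w => 1 + g w / g' w).
Proof.
move=> a0 c0 hb hg hg' gg' A mA.
have mi : measurable_fun [set: R] (fun x : R => \1_A (x^-1) : R).
  apply: (measurableT_comp (@measurable_indic _ R R setT _ mA)).
  exact: measurable_invr.
pose h (x : R) : \bar R := (\1_A (x^-1))%:E.
have mh : measurable_fun [set: R] h by exact/measurable_EFinP.
have h0 x : (0 <= h x)%E by rewrite lee_fin.
have B0 := rbeta_fun_gt0 a0 c0.
have ga := gamma_fun_gt0 a0; have gc := gamma_fun_gt0 c0.
have mq : measurable_fun [set: T2] (fun w => g' w / (g w + g' w)).
  apply: measurable_funM => //; apply: (measurableT_comp (@measurable_invr R)).
  exact: measurable_funD.
have indE d3 (T3 : measurableType d3) (Q : probability T3 R) (Z : {RV Q >-> R})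
    (Z' : T3 -> R) : measurable_fun [set: T3] Z' -> {ae Q, forall w, Z' w = (Z w)^-1} ->
    Q (Z' @^-1` A) = (\int[Q]_w h (Z w))%E.
  move=> mZ' ZZ'.
  have mZA : measurable (Z' @^-1` A) by rewrite -[_ @^-1` _]setTI; exact: mZ'.
  rewrite -[X in Q X]setIT -integral_indic//; apply: ae_eq_integral => //.
  - by apply/measurable_EFinP; exact: measurable_indic.
  - exact: (measurableT_comp mh).
  - by apply: filterS ZZ' => w Zw _; rewrite /h !indicE -Zw.
pose Q : {RV P2 >-> R} := HB.pack (fun w => g' w / (g w + g' w))
  (isMeasurableFun.Build _ _ _ _ _ mq).
rewrite (indE _ _ P1 b); last 2 first.
- by apply: measurable_funM => //; exact: (measurableT_comp (@measurable_invr R)).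
- by apply: aeW => w; rewrite div1r.
rewrite (indE _ _ P2 Q); last 2 first.
- apply: measurable_funD => //; apply: measurable_funM => //.
  exact: (measurableT_comp (@measurable_invr R)).
- apply: filterS2 (ae_gamma_gt0 hg) (ae_gamma_gt0 hg') => w gw gw'.
  by rewrite /Q/= invf_div; field; rewrite gt_eqF.
pose H (z : R * R) : \bar R := h (z.1 / (z.2 + z.1)).
have mH : measurable_fun [set: R * R] H.
  apply: (measurableT_comp mh); apply: measurable_funM => //.
  apply: (measurableT_comp (@measurable_invr R)); exact: measurable_funD.
have := integral_independent2 (independent2C gg') mH (fun z => h0 _).
rewrite /H/= => ->.
have mgx e := @measurable_gamma_pdf R e.
transitivity (\int[P2]_w \int[mu]_x ((gamma_pdf a x)%:E * h (g' w / (x + g' w))%R))%E; last first.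
  apply: eq_integral => w _; apply/esym.
  apply: (integral_density hg (mgx a) (gamma_pdf_ge0 a0)) => //.
  apply: (measurableT_comp mh); apply: measurable_funM => //.
  apply: (measurableT_comp (@measurable_invr R)); exact: measurable_funD.
have mi2 : measurable_fun [set: R]
    (fun y => \int[mu]_x ((gamma_pdf a x)%:E * h (y / (x + y))%R))%E.
  apply: (@measurable_fun_fubini_tonelli_F _ _ R (measurableTypeR R) R mu
    (fun z : R * R => (gamma_pdf a z.2)%:E * h (z.1 / (z.2 + z.1))%R)%E).
  - apply: emeasurable_funM => //; apply/measurable_EFinP.
    by apply: (measurableT_comp (mgx a)).
  - by move=> z; rewrite mule_ge0// lee_fin gamma_pdf_ge0.
rewrite (integral_density hg' (mgx c) (gamma_pdf_ge0 c0) mi2); last first.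
  by move=> y; apply: integral_ge0 => x _; rewrite mule_ge0// lee_fin gamma_pdf_ge0.
rewrite (integral_density hb (@measurable_rbeta_pdf R _ _) (rbeta_pdf_ge0 c0 a0) mh h0).
have mHk : measurable_fun [set: measurableTypeR R * measurableTypeR R]
    (fun z => h (z.1 / (z.2 + z.1))%R * (gamma_kernel a z.2 * gamma_kernel c z.1)%:E)%E.
  apply: emeasurable_funM => //; apply/measurable_EFinP; apply: measurable_funM.
  - by apply: (measurableT_comp (@measurable_gamma_kernel R a)).
  - by apply: (measurableT_comp (@measurable_gamma_kernel R c)).
have Hk0 z : (0 <= h (z.1 / (z.2 + z.1))%R *
    (gamma_kernel a z.2 * gamma_kernel c z.1)%:E)%E.
  by rewrite mule_ge0// lee_fin mulr_ge0// gamma_kernel_ge0.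
transitivity (((gamma_fun c)^-1 * (gamma_fun a)^-1)%:E * \int[mu]_y \int[mu]_x
    (h (y / (x + y))%R * (gamma_kernel a x * gamma_kernel c y)%:E))%E.
  rewrite (integral_gamma_beta a0 c0 mh h0) muleA -EFinM.
  have := rbeta_fun_gamma a0 c0.
  move: (rbeta_fun c a) B0 (rbeta_pdfE c a) (gamma_fun_gt0 (addr_gt0 a0 c0)).
  move: (gamma_fun (a + c)) (gamma_fun a) (gamma_fun c) ga gc.
  move=> gs ga gc ga0 gc0 B B0 pE gs0 e.
  have -> : gc^-1 * ga^-1 * gs = B^-1.
    rewrite -invfM -[gs](mulfK (lt0r_neq0 B0)) e [gc * ga]mulrC mulrA.
    by rewrite mulVf ?mul1r// mulf_neq0// gt_eqF.
  rewrite -ge0_integralZl//.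
  - apply: eq_integral => x _; rewrite pE EFinM -muleA; congr (_ * _)%E.
    exact: muleC.
  - apply: emeasurable_funM => //; apply/measurable_EFinP.
    exact: measurable_beta_kernel.
  - by move=> x _; rewrite mule_ge0// lee_fin beta_kernel_ge0.
  - by rewrite lee_fin invr_ge0 ltW.
have gai : 0 <= (gamma_fun a)^-1 by rewrite invr_ge0 ltW.
have gci : 0 <= (gamma_fun c)^-1 by rewrite invr_ge0 ltW.
have pa := gamma_pdfE a; have pc := gamma_pdfE c.
move: (gamma_fun a)^-1 (gamma_fun c)^-1 gai gci pa pc => ia ic ia0 ic0 pa pc.
rewrite -ge0_integralZl//; first last.
- by rewrite lee_fin mulr_ge0.
- by move=> y _; apply: integral_ge0 => x _; exact: (Hk0 (y, x)).
- exact: (@measurable_fun_fubini_tonelli_F _ _ (measurableTypeR R) (measurableTypeR R) R mu _ mHk (fun z => Hk0 z)).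
apply: eq_integral => y _; rewrite -ge0_integralZl//; first last.
- by rewrite lee_fin mulr_ge0.
- by move=> x _; exact: (Hk0 (y, x)).
- apply: (measurableT_comp mHk (pair1_measurable y)).
rewrite -ge0_integralZl//; first last.
- by rewrite lee_fin gamma_pdf_ge0.
- by move=> x _; rewrite mule_ge0// lee_fin gamma_pdf_ge0.
- apply: emeasurable_funM; first by apply/measurable_EFinP; exact: mgx.
  apply: (measurableT_comp mh); apply: measurable_funM => //.
  apply: (measurableT_comp (@measurable_invr R)); exact: measurable_funD.
apply: eq_integral => x _; rewrite pa pc; move: (h _) => z.
rewrite muleCA -EFinM [RHS]muleA -EFinM [RHS]muleC; congr (_ * _%:E)%E.
by ring.
Qed.

End beta_identities.

Section laws.
Context (R : realType).
Notation mu := (@lebesgue_measure R).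
Implicit Types (x y l t : R).
Context d0 (T0 : measurableType d0) (P0 : probability T0 R) (G : {RV P0 >-> R}).
Hypothesis hG : has_density P0 G (@arcsine_pdf R).

(** Legendre's duplication formula in beta form, from the law of 4 G (1 - G): the
    integrand of B(t, t) is a power of G (1 - G). *)
Lemma rbeta_fun_double t : 0 < t ->
  2 `^ (2 * t) * rbeta_fun t t = 2 * rbeta_fun t (1 / 2).
Proof.
move=> t0; have tE : t = (t - 1 / 2) + 1 / 2 by rewrite subrK.
have p0 : 0 < pi :> R by exact: pi_gt0.
have t2 : 0 < (t - 1 / 2) + 1 / 2 by rewrite -tE.
have e1 := arcsine_beta hG t2 t2; have e2 := arcsine_moment hG t2.
have mp : measurable_fun [set: R] (fun x : R => (x `^ (t - 1 / 2))%:E).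
  by apply/measurable_EFinP; exact: measurable_powR.
rewrite -tE in e1 e2.
have e3 := arcsine_double hG mp (fun x => powR_ge0 x (t - 1 / 2)).
rewrite e2 in e3.
have e4 : (\int[P0]_w ((4 * (G w * (1 - G w))) `^ (t - 1 / 2))%:E =
    (4 `^ (t - 1 / 2) * (rbeta_fun t t / pi))%:E)%E.
  rewrite EFinM -e1 -ge0_integralZl//.
  - apply: (ae_eq_ge0_integral hG).
    + apply: (measurableT_comp mp); apply: measurable_funM => //.
      by apply: measurable_funM => //; exact: measurable_funB.
    + apply/measurable_EFinP; apply: measurable_funM => //; apply: measurable_funM.
      * by apply: (measurableT_comp (@measurable_powR R _)).
      * by apply: (measurableT_comp (@measurable_powR R _)); exact: measurable_funB.
    + move=> w /andP[w0 w1]; rewrite -EFinM; congr (_%:E).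
      by rewrite -!powRM// ?mulr_ge0// ?subr_ge0 ?ltW.
  - apply/measurable_EFinP; apply: measurable_funM.
    + by apply: (measurableT_comp (@measurable_powR R _)).
    + by apply: (measurableT_comp (@measurable_powR R _)); exact: measurable_funB.
  - by move=> w _; rewrite lee_fin mulr_ge0 ?powR_ge0.
have {e3 e4} e5 : 4 `^ (t - 1 / 2) * (rbeta_fun t t / pi) =
    rbeta_fun t (1 / 2) / pi by apply: EFin_inj; rewrite -e4 -e3.
have f4 : 4 `^ (t - 1 / 2) * 2 = 2 `^ (2 * t) :> R.
  have -> : 4 = 2 ^+ 2 :> R by rewrite expr2; ring.
  rewrite -powR_mulrn// -powRrM -[X in _ * X = _](@powRr1 R 2)// -powRD; last by rewrite pnatr_eq0 implybT.
  by congr powR; lra.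
rewrite -f4; move: (rbeta_fun t t) (rbeta_fun t _) e5 => u v.
move: (pi : R) p0 => p p0; rewrite !mulrA => /(divIf (lt0r_neq0 p0)) <-.
by move: (4 `^ _) => z; ring.
Qed.

(** B(1/2, 1/2) is the total mass of the unnormalised arc sine law. *)
Lemma gamma_fun_half : gamma_fun (1 / 2) ^+ 2 = pi :> R.
Proof.
have h2 : 0 < 1 / 2 :> R by [].
have := rbeta_fun_gamma h2 h2; rewrite (rbeta_fun_half hG).
have -> : 1 / 2 + 1 / 2 = 1 :> R by lra.
by rewrite gamma_fun1 mul1r expr2.
Qed.

Lemma subordinator_density_constant t : 0 < t ->
  (2 `^ (2 * t) * gamma_fun (1 + t)) / (2 * pi * gamma_fun (2 * t)) *
  (gamma_fun t * rbeta_fun (t + 1 / 2) (1 / 2)) = 1 :> R.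
Proof.
move=> t0; have h2 : 0 < 1 / 2 :> R by [].
have t2 : 0 < t + 1 / 2 by rewrite addr_gt0.
have t22 : 0 < 2 * t by rewrite mulr_gt0.
have st : 1 / 2 + (t + 1 / 2) = 1 + t :> R by lra.
have e1 := rbeta_fun_double t0.
have e2 := rbeta_fun_gamma t0 t0.
have e3 := rbeta_fun_gamma h2 t0.
have e4 := rbeta_fun_gamma h2 t2.
have g0 := gamma_fun_gt0 t0; have g2 := gamma_fun_gt0 t2.
have gh := gamma_fun_gt0 h2; have g22 := gamma_fun_gt0 t22.
have e5 := gamma_fun_half.
have b0 := rbeta_fun_gt0 h2 t0; have b1 := rbeta_fun_gt0 t0 t0.
rewrite -mulr2n -mulr_natl in e2.
rewrite st in e4.
rewrite (addrC (1 / 2) t) in e3.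
have p0 := pi_gt0 R; have q0 : 0 < 2 `^ (2 * t) :> R by exact: powR_gt0.
move: (2 `^ (2 * t)) (gamma_fun (1 + t)) (gamma_fun (2 * t)) (gamma_fun t)
  (rbeta_fun (t + 1 / 2) (1 / 2)) (rbeta_fun t t) (rbeta_fun t (1 / 2))
  (gamma_fun (t + 1 / 2)) (gamma_fun (1 / 2)) (pi : R) p0 q0 e1 e2 e3 e4 e5
  g0 g2 gh g22 b0 b1.
move=> q g1t g2t gt b b' bh gth gh0 p p0 q0 e1 e2 e3 e4 e5 g0 g2 gh1 g22 b0 b1.
apply: (@mulfI _ (2 * p * g2t * bh)); first by rewrite !mulf_neq0 ?gt_eqF.
rewrite mulr1; transitivity (q * g1t * (gt * b) * bh).
  by field; rewrite !gt_eqF.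
have -> : q * g1t * (gt * b) * bh = q * gt * bh * (g1t * b) by ring.
rewrite e4; transitivity (q * gt * gh0 * (gth * bh)); first by ring.
rewrite e3; transitivity (q * (gh0 ^+ 2) * (gt * gt)); first by ring.
rewrite e5 -e2; transitivity (p * g2t * (q * b')); first by ring.
by rewrite e1; ring.
Qed.

Context d (T : measurableType d) (P : probability T R) (Gam : R -> {RV P >-> R}).
Hypothesis hGam : driftless_subordinator Gam
  (fun x => ((x^-1)%:E * laplace_transform P0 G x)%E).

Lemma measurable_fun_RV d1 (T1 : measurableType d1) (P1 : probability T1 R) (X : T1 -> R) :
  measurable_fun [set: T1] X -> exists X' : {RV P1 >-> R}, X' = X :> (T1 -> R).
Proof.
move=> mX; pose X' : {RV P1 >-> R} := HB.pack X (isMeasurableFun.Build _ _ _ _ _ mX).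
by exists X'.
Qed.

Section beta_law.
Context d1 (T1 : measurableType d1) (P1 : probability T1 R) (b : {RV P1 >-> R}) (t : R).
Hypotheses (t0 : 0 < t) (hb : has_density P1 b (rbeta_pdf (1 / 2) (1 / 2 + t))).

Lemma beta_inv_stieltjes l : 0 <= l ->
  (\int[P1]_w ((1 + l * (b w)^-1) `^ (- t))%:E = \int[P]_w (expR (- (l * Gam t w)))%:E)%E.
Proof.
move=> l0; rewrite (beta_stieltjes hG t0 l0 hb).
by rewrite (arcsine_subordinator_laplace hG hGam l0 (ltW t0)).
Qed.

End beta_law.

(** Both sides have the Laplace transform (sqrt (1 + l) - sqrt l)^(2 t). *)
Lemma subordinator_gamma_over_beta t d1 (T1 : measurableType d1)
    (P1 : probability T1 R) (g b : {RV P1 >-> R}) : 0 < t ->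
  has_density P1 g (gamma_pdf t) ->
  has_density P1 b (rbeta_pdf (1 / 2) (1 / 2 + t)) ->
  independent2 P1 g b ->
  eq_law P (Gam t) P1 (fun w => g w / b w).
Proof.
move=> t0 hg hb gb.
have mbi : measurable_fun [set: T1] (fun w => (b w)^-1).
  exact: (measurableT_comp (@measurable_invr R)).
have [Y YE] := measurable_fun_RV P1 mbi.
have mq : measurable_fun [set: T1] (fun w => g w * Y w) by exact: measurable_funM.
have [Z ZE] := measurable_fun_RV P1 mq.
have gY : independent2 P1 g Y.
  move=> A B mA mB; rewrite YE.
  pose B' := (fun x : R => x^-1) @^-1` B.
  have mB' : measurable B' by rewrite -[B']setTI; exact: (@measurable_invr R).
  exact: (gb A B' mA mB').
have Y0 : {ae P1, forall w, 0 <= Y w} by rewrite YE; exact: ae_beta_inv_ge0 hb.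
suff H A : measurable A -> P (Gam t @^-1` A) = P1 (Z @^-1` A).
  by move=> A mA; rewrite H// ZE YE.
move=> mA; apply: laplace_unique => //.
- by apply: (le_lt_trans (probability_le1 P measurableT)); rewrite ltry.
- exact: subordinator_ge0 hGam.1 (ltW t0).
- rewrite ZE; apply: filterS2 (ae_gamma_gt0 hg) Y0 => w gw Yw.
  by rewrite mulr_ge0// ltW.
move=> l l0; rewrite ZE (gamma_mixture_laplace l t0 hg gY).
rewrite (gamma_mixture_stieltjes t0 l0 Y0) -(beta_inv_stieltjes t0 hb l0).
by apply: eq_integral => w _; rewrite YE.
Qed.

(** D and 1 / b produce the same gamma mixture, which determines them. The
    nonnegativity of D, on which that uniqueness depends, comes from that of
    the subordinator and of the gamma variable. *)
Lemma mixing_variable_law t d1 (T1 : measurableType d1)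
    (P1 : probability T1 R) (g D : {RV P1 >-> R})
    d2 (T2 : measurableType d2) (P2 : probability T2 R) (b : {RV P2 >-> R}) : 0 < t ->
  has_density P1 g (gamma_pdf t) -> independent2 P1 g D ->
  eq_law P (Gam t) P1 (fun w => g w * D w) ->
  has_density P2 b (rbeta_pdf (1 / 2) (1 / 2 + t)) ->
  eq_law P1 D P2 (fun w => 1 / b w).
Proof.
move=> t0 hg gD GgD hb.
have mbi : measurable_fun [set: T2] (fun w => 1 / b w).
  by apply: measurable_funM => //; exact: (measurableT_comp (@measurable_invr R)).
have [Y YE] := measurable_fun_RV P2 mbi.
have Y0 : {ae P2, forall w, 0 <= Y w}.
  rewrite YE; apply: filterS (ae_beta_inv_ge0 hb) => w; by rewrite div1r.
have mgD : measurable_fun [set: T1] (fun w => g w * D w) by exact: measurable_funM.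
have mneg : measurable (`]-oo, 0[%classic : set R) by [].
(* g D has the law of a nonnegative variable, and g > 0 *)
have D0 : {ae P1, forall w, 0 <= D w}.
  have gD0 : {ae P1, forall w, 0 <= g w * D w}.
    have [N [mN N0 HN]] := subordinator_ge0 hGam.1 (ltW t0).
    exists ((fun w => g w * D w) @^-1` `]-oo, 0[); split.
    - by rewrite -[_ @^-1` _]setTI; exact: mgD.
    - rewrite -GgD//; apply: (subset_measure0 _ mN _ N0).
        by rewrite -[_ @^-1` _]setTI; exact: (measurable_funPT (Gam t)).
      move=> w /=; rewrite in_itv/= => w0; apply: HN => /=.
      by apply/negP; rewrite -ltNge.
    - by move=> w /= /negP; rewrite -ltNge in_itv.
  apply: filterS2 (ae_gamma_gt0 hg) gD0 => w gw.
  by rewrite pmulr_rge0.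
suff H A : measurable A -> P1 (D @^-1` A) = P2 (Y @^-1` A).
  by move=> A mA; rewrite H// YE.
move=> mA; apply: (gamma_mixture_unique t0 D0 Y0) => // l l0.
rewrite (gamma_mixture_stieltjes t0 l0 Y0) -(gamma_mixture_laplace l t0 hg gD).
transitivity (\int[P]_w (expR (- (l * Gam t w)))%:E)%E.
  have [Z ZE] := measurable_fun_RV P1 mgD.
  have mh : measurable_fun [set: R] (fun x : R => (expR (- (l * x)))%:E).
    apply/measurable_EFinP; apply: measurableT_comp => //; apply: measurable_funN.
    exact: measurable_funM.
  have GZ : eq_law P (Gam t) P1 Z by move=> B mB; rewrite GgD// ZE.
  have := integral_eq_law GZ mh (fun x => expR_ge0 _) => ->.
  by rewrite ZE.
rewrite -(beta_inv_stieltjes t0 hb l0).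
by apply: eq_integral => w _; rewrite YE div1r.
Qed.

End laws.

(** * The density of the subordinator *)

Section density.
Context (R : realType).
Notation mu := (@lebesgue_measure R).
Implicit Types (x y l t : R).
Context d0 (T0 : measurableType d0) (P0 : probability T0 R) (G : {RV P0 >-> R}).
Hypothesis hG : has_density P0 G (@arcsine_pdf R).

Local Notation bk t := (beta_kernel (t + 1 / 2) (t + 1 / 2)).

Lemma integral_arcsine_beta t x : 0 < t -> 0 <= x ->
  (\int[mu]_y (expR (- (x * y)) * bk t y)%:E =
   (\int[mu]_(y in `[0%R, 1%R]) (expR (- (x * y)) * (y * (1 - y)) `^ (t - 1 / 2)))%:E)%E.
Proof.
move=> t0 x0; have t2 : 0 < t + 1 / 2 by rewrite addr_gt0.
have tE : t + 1 / 2 - 1 = t - 1 / 2 by lra.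
have me D : measurable_fun D (fun y : R => expR (- (x * y))).
  apply: measurable_funTS; apply: measurableT_comp => //; apply: measurable_funN.
  exact: measurable_funM.
have mb := @measurable_beta_kernel R (t + 1 / 2) (t + 1 / 2).
have E : (\int[mu]_(y in `[0%R, 1%R]) (expR (- (x * y)) * (y * (1 - y)) `^ (t - 1 / 2))%:E =
    \int[mu]_y (expR (- (x * y)) * bk t y)%:E)%E.
  rewrite integral_itv_bndoo; last first.
    apply/measurable_EFinP; apply: measurable_funM; first exact: me.
    apply: measurable_funTS; apply: (measurableT_comp (@measurable_powR R _)).
    by apply: measurable_funM => //; exact: measurable_funB.
  rewrite integral_mkcond; apply: eq_integral => y _.
  rewrite patchE; case: ifPn => [|y01].
    rewrite inE/= in_itv/= => /andP[y0 y1].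
    by rewrite beta_kernel_in ?y0// tE -powRM ?subr_ge0 ?ltW.
  rewrite beta_kernel_out ?mulr0//; apply: contra y01 => y01.
  by rewrite inE/= in_itv.
rewrite /Rintegral E fineK// ge0_fin_numE; last first.
  by apply: integral_ge0 => y _; rewrite lee_fin mulr_ge0 ?expR_ge0 ?beta_kernel_ge0.
apply: (@le_lt_trans _ _ (\int[mu]_y (bk t y)%:E)%E); last first.
  by rewrite integral_beta_kernel// ltry.
apply: ge0_le_integral => //.
- by move=> y _; rewrite lee_fin mulr_ge0 ?expR_ge0 ?beta_kernel_ge0.
- by apply/measurable_EFinP; apply: measurable_funM; [exact: me|exact: mb].
- exact/measurable_EFinP.
move=> y _; rewrite lee_fin; have [y01|y01] := boolP (0 < y < 1); last first.
  by rewrite beta_kernel_out// mulr0.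
rewrite ler_piMl ?beta_kernel_ge0// -expR0 ler_expR oppr_le0 mulr_ge0//.
by case/andP : y01 => /ltW.
Qed.

Definition subordinator_density t x : R :=
  (2 `^ (2 * t) * gamma_fun (1 + t)) / (2 * pi * gamma_fun (2 * t))
  * x `^ (t - 1)
  * (\int[mu]_(y in `[0, 1]) (expR (- (x * y)) * (y * (1 - y)) `^ (t - 1 / 2)))
  * \1_(`[0, +oo[%classic : set R) x.

Local Notation K t := ((2 `^ (2 * t) * gamma_fun (1 + t)) / (2 * pi * gamma_fun (2 * t))).

(** The integrand of the density as a function of the pair (x, y), without
    constant; the value at x = 0 is kept so that the density is proportional to
    its y-integral at every point. *)
Definition density_kernel t (z : R * R) : R :=
  z.1 `^ (t - 1) * \1_(`[0, +oo[%classic : set R) z.1 * (expR (- (z.1 * z.2)) * bk t z.2).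

Lemma measurable_density_kernel t :
  measurable_fun [set: measurableTypeR R * measurableTypeR R] (density_kernel t).
Proof.
apply: measurable_funM; [apply: measurable_funM|apply: measurable_funM].
- by apply: (measurableT_comp (@measurable_powR R _)).
- by apply: (measurableT_comp (@measurable_indic _ R R setT `[0, +oo[%classic _)).
- apply: measurableT_comp => //; apply: measurable_funN.
  exact: measurable_funM.
- by apply: (measurableT_comp (@measurable_beta_kernel R _ _)).
Qed.

Lemma density_kernel_ge0 t z : 0 <= density_kernel t z.
Proof. by rewrite !mulr_ge0 ?powR_ge0 ?expR_ge0 ?beta_kernel_ge0. Qed.

Lemma density_constant_gt0 t : 0 < t -> 0 < K t :> R.
Proof.
move=> t0; have t1 : 0 < 1 + t by rewrite addr_gt0.
have t2 : 0 < 2 * t by rewrite mulr_gt0.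
by rewrite divr_gt0// !mulr_gt0 ?powR_gt0 ?gamma_fun_gt0 ?pi_gt0.
Qed.

Lemma subordinator_densityE t x : 0 < t ->
  ((subordinator_density t x)%:E = (K t)%:E * \int[mu]_y (density_kernel t (x, y))%:E)%E.
Proof.
move=> t0; have me : measurable_fun [set: R] (fun y => (expR (- (x * y)) * bk t y)%:E).
  apply/measurable_EFinP; apply: measurable_funM; last exact: measurable_beta_kernel.
  apply: measurableT_comp => //; apply: measurable_funN; exact: measurable_funM.
rewrite /subordinator_density; move: (K t) => k.
under [in RHS]eq_integral do rewrite /density_kernel/= EFinM.
rewrite ge0_integralZl//; last 2 first.
- by move=> y _; rewrite lee_fin mulr_ge0 ?expR_ge0 ?beta_kernel_ge0.
- by rewrite lee_fin mulr_ge0 ?powR_ge0.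
have [x0|x0] := leP 0 x; last first.
  rewrite indicE memNset ?mulr0 ?mul0e ?mule0//=.
  by rewrite in_itv/= andbT; apply/negP; rewrite -ltNge.
rewrite integral_arcsine_beta// -!EFinM; congr (_%:E).
by rewrite !mulrA mulrAC -!mulrA.
Qed.

Lemma subordinator_density_ge0 t x : 0 < t -> 0 <= subordinator_density t x.
Proof.
move=> t0; rewrite -lee_fin subordinator_densityE// mule_ge0//.
  by rewrite lee_fin ltW// density_constant_gt0.
by apply: integral_ge0 => y _; rewrite lee_fin density_kernel_ge0.
Qed.

Lemma measurable_subordinator_density t : 0 < t ->
  measurable_fun [set: R] (subordinator_density t).
Proof.
move=> t0; apply/measurable_EFinP.
rewrite [X in measurable_fun _ X](_ : _ =
  (fun x => (K t)%:E * \int[mu]_y (density_kernel t (x, y))%:E)%E); last first.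
  by apply/funext => x; rewrite /comp subordinator_densityE.
apply: emeasurable_funM => //.
apply: (@measurable_fun_fubini_tonelli_F _ _ (measurableTypeR R) (measurableTypeR R) R mu
  (fun z => (density_kernel t z)%:E)).
- by apply/measurable_EFinP; exact: measurable_density_kernel.
- by move=> z; rewrite lee_fin density_kernel_ge0.
Qed.

Lemma integral_density_kernel t y l : 0 < t -> 0 <= l ->
  (\int[mu]_x (density_kernel t (x, y) * expR (- (l * x)))%:E =
   (gamma_fun t)%:E * (((y + l) `^ (- t))%:E * (bk t y)%:E))%E.
Proof.
move=> t0 l0; have [/andP[y0 y1]|y01] := boolP (0 < y < 1); last first.
  rewrite beta_kernel_out// !mule0; apply: integral0_eq => x _.
  by rewrite /density_kernel/= beta_kernel_out// !mulr0 mul0r.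
have yl : 0 < y + l by rewrite ltr_wpDr.
have mp : measurable_fun [set: R] (fun x => x `^ (t - 1) * expR (- ((y + l) * x))).
  apply: measurable_funM; first exact: measurable_powR.
  apply: measurableT_comp => //; apply: measurable_funN; exact: measurable_funM.
transitivity ((bk t y)%:E * \int[mu]_x (x `^ (t - 1) * expR (- ((y + l) * x)) *
     \1_(`]0, +oo[%classic : set R) x)%:E)%E; last first.
  rewrite integral_gamma_kernel_scale// -!EFinM; congr (_%:E).
  by move: (beta_kernel _ _ _) (_ `^ _) (gamma_fun _) => b p g; ring.
rewrite -ge0_integralZl//; first last.
- by rewrite lee_fin beta_kernel_ge0.
- by move=> x _; rewrite lee_fin !mulr_ge0 ?powR_ge0 ?expR_ge0.
- apply/measurable_EFinP; apply: measurable_funM => //; exact: measurable_indic.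
apply: ae_eq_integral => //.
- apply/measurable_EFinP; apply: measurable_funM.
    exact: (measurableT_comp (measurable_density_kernel t) (pair2_measurable y)).
  apply: measurableT_comp => //; apply: measurable_funN; exact: measurable_funM.
- apply/measurable_EFinP; apply: measurable_funM => //.
  apply: measurable_funM => //; exact: measurable_indic.
(* the two integrands differ at most at x = 0 *)
exists [set 0]; split; [exact: measurable_set1|exact: lebesgue_measure_set1|].
move=> x /= xN; apply: contrapT => x0; apply: xN => _.
rewrite -EFinM /density_kernel/=; congr (_%:E).
have -> : \1_(`[0, +oo[%classic : set R) x = \1_(`]0, +oo[%classic : set R) x :> R.
  rewrite !indicE; congr (_%:R); congr (nat_of_bool _); apply/idP/idP.
    rewrite !inE/= !in_itv/= !andbT le_eqVlt => /orP[/eqP e|//].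
    by exfalso; apply: x0; rewrite -e.
  by rewrite !inE/= !in_itv/= !andbT => /ltW.
have -> : expR (- ((y + l) * x)) = expR (- (x * y)) * expR (- (l * x)).
  by rewrite -expRD; congr expR; ring.
by move: (\1_ _ _) (beta_kernel _ _ _) (_ `^ _) => i b p; ring.
Qed.

(** Integrating over x first gives Gamma(t) (y + l)^(-t) against a beta kernel of
    parameters t + 1/2, t + 1/2 in y, that is,
    E [(G (1 - G) / (G + l))^t] up to a constant. *)
Lemma laplace_subordinator_density t l : 0 < t -> 0 <= l ->
  (\int[mu]_x ((subordinator_density t x)%:E * (expR (- (l * x)))%:E) =
   ((Num.sqrt (1 + l) - Num.sqrt l) `^ (2 * t))%:E)%E.
Proof.
move=> t0 l0; have t2 : 0 < t + 1 / 2 by rewrite addr_gt0.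
have K0 := density_constant_gt0 t0.
have mE : measurable_fun [set: R] (fun x : R => expR (- (l * x))).
  apply: measurableT_comp => //; apply: measurable_funN; exact: measurable_funM.
pose f (z : R * R) : \bar R := (density_kernel t z * expR (- (l * z.1)))%:E.
have mf : measurable_fun [set: measurableTypeR R * measurableTypeR R] f.
  apply/measurable_EFinP; apply: measurable_funM; first exact: measurable_density_kernel.
  exact: (measurableT_comp mE).
have f0 z : (0 <= f z)%E by rewrite lee_fin mulr_ge0 ?density_kernel_ge0 ?expR_ge0.
transitivity ((K t)%:E * \int[mu]_x \int[mu]_y f (x, y))%E.
  rewrite -ge0_integralZl//; first last.
  - by rewrite lee_fin ltW.
  - by move=> x _; exact: integral_ge0.
  - exact: (@measurable_fun_fubini_tonelli_F _ _ (measurableTypeR R) (measurableTypeR R) R mu f).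
  apply: eq_integral => x _; rewrite subordinator_densityE// -muleA; congr (_ * _)%E.
  rewrite muleC -ge0_integralZl//.
  - by apply: eq_integral => y _; rewrite -EFinM mulrC.
  - apply/measurable_EFinP.
    exact: (measurableT_comp (measurable_density_kernel t) (pair1_measurable x)).
  - by move=> y _; rewrite lee_fin density_kernel_ge0.
rewrite (@fubini_tonelli _ _ _ _ R mu mu f mf f0).
under eq_integral do rewrite /f/= integral_density_kernel//.
have mp : measurable_fun [set: R] (fun y : R => ((y + l) `^ (- t))%:E).
  apply/measurable_EFinP; apply: (measurableT_comp (@measurable_powR R (- t))).
  exact: measurable_funD.
have p0 y : (0 <= ((y + l) `^ (- t))%:E)%E by rewrite lee_fin powR_ge0.
rewrite ge0_integralZl//; first last.
- by rewrite lee_fin ltW// gamma_fun_gt0.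
- by move=> y _; rewrite mule_ge0// lee_fin beta_kernel_ge0.
- apply: emeasurable_funM => //; apply/measurable_EFinP; exact: measurable_beta_kernel.
rewrite (integral_beta_kernel_arcsine hG t t mp p0).
rewrite (@ae_eq_ge0_integral _ _ _ _ _ hG _
    (fun w => ((G w * (1 - G w) / (G w + l)) `^ t)%:E)%E).
- rewrite (integral_arcsine_quotient_powR hG)// -!EFinM; congr (_%:E).
  have p1 : pi != 0 :> R by rewrite gt_eqF// pi_gt0.
  have := subordinator_density_constant hG t0.
  move: ((_ - _) `^ _) (K t) => w k e.
  transitivity (w * (k * (gamma_fun t * rbeta_fun (t + 1 / 2) (1 / 2)))); last first.
    by rewrite e mulr1.
  by move: (gamma_fun t) (rbeta_fun _ _) (pi : R) p1 => g b p p1; field.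
- apply: emeasurable_funM; first exact: (measurableT_comp mp).
  apply/measurable_EFinP; apply: measurable_funM.
  + by apply: (measurableT_comp (@measurable_powR R _)).
  + by apply: (measurableT_comp (@measurable_powR R _)); exact: measurable_funB.
- apply/measurable_EFinP; apply: (measurableT_comp (@measurable_powR R t)).
  apply: measurable_funM; first by apply: measurable_funM => //; exact: measurable_funB.
  by apply: (measurableT_comp (@measurable_invr R)); exact: measurable_funD.
move=> w /andP[w0 w1]; rewrite -EFinM; congr (_%:E).
have w10 : 0 < 1 - G w by rewrite subr_gt0.
have wl : 0 < G w + l by rewrite ltr_wpDr.
rewrite powRN -powR_inv1 ?powR_ge0// -powRrM mulrN1 -mulN1r powRrM powR_inv1 ?ltW//.
by rewrite -!powRM ?mulr_ge0 ?invr_ge0 ?ltW// mulrC.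
Qed.

Context d (T : measurableType d) (P : probability T R) (Gam : R -> {RV P >-> R}).
Hypothesis hGam : driftless_subordinator Gam
  (fun x => ((x^-1)%:E * laplace_transform P0 G x)%E).

Lemma subordinator_has_density t : 0 < t ->
  has_density P (Gam t) (subordinator_density t).
Proof.
move=> t0 A mA.
have mf := measurable_subordinator_density t0.
have f0 x := @subordinator_density_ge0 t x t0.
pose m := @density_measure _ _ R mu _ mf f0.
have mid : measurable_fun [set: measurableTypeR R] (id : R -> R) by [].
pose I : {mfun measurableTypeR R >-> R} := HB.pack (id : R -> R)
  (isMeasurableFun.Build _ _ _ _ _ mid).
transitivity (m (I @^-1` A)); last by [].
apply: (laplace_unique (m2 := m)) => //.
- by apply: (le_lt_trans (probability_le1 P measurableT)); rewrite ltry.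
- exact: subordinator_ge0 hGam.1 (ltW t0).
- exists `]-oo, 0[%classic; split => //.
    rewrite /m/density_measure; apply: integral0_eq => x /=.
    rewrite in_itv/= => x0; rewrite /subordinator_density indicE memNset ?mulr0//=.
    by rewrite in_itv/= andbT leNgt x0.
  by move=> x /= /negP; rewrite -ltNge in_itv.
move=> l l0; rewrite (arcsine_subordinator_laplace hG hGam l0 (ltW t0)).
rewrite -(laplace_subordinator_density t0 l0).
have mE : measurable_fun [set: R] (fun x : R => (expR (- (l * x)))%:E).
  apply/measurable_EFinP; apply: measurableT_comp => //.
  apply: measurable_funN; exact: measurable_funM.
have := @ge0_integral_density_measure _ _ _ mu _ mf f0 _ mE (fun x => expR_ge0 _) => <-.
by [].
Qed.

End density.

(** * The closed forms of the Laplace transform *)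

Section laplace_transforms.
Context (R : realType).
Context d0 (T0 : measurableType d0) (P0 : probability T0 R) (G : {RV P0 >-> R}).
Hypothesis hG : has_density P0 G (@arcsine_pdf R).

Lemma arcsine_bessel_exponent (l : R) :
  laplace_exponent (fun x => (x^-1 * (bessel_I0 (x / 2) * expR (- (x / 2))))%:E) l =
  laplace_exponent (fun x => ((x^-1)%:E * laplace_transform P0 G x)%E) l.
Proof.
apply: eq_integral => x; rewrite inE/= in_itv/= andbT => x0.
by rewrite (arcsine_bessel hG x0) -EFinM.
Qed.

Lemma sqrt_sub_powRE (l t : R) : 0 <= l ->
  (Num.sqrt (1 + l) - Num.sqrt l) `^ (2 * t) =
  (1 / (Num.sqrt (1 + l) + Num.sqrt l)) `^ (2 * t).
Proof. by move=> l0; rewrite div1r sqrt_subE. Qed.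

Lemma sqrt_add_powRE (l t : R) : 0 <= l ->
  (1 / (Num.sqrt (1 + l) + Num.sqrt l)) `^ (2 * t) =
  (1 + 2 * l + 2 * Num.sqrt (l * (1 + l))) `^ (- t).
Proof.
move=> l0; have l1 : 0 <= 1 + l by rewrite addr_ge0.
have -> : 1 + 2 * l + 2 * Num.sqrt (l * (1 + l)) =
    (Num.sqrt (1 + l) + Num.sqrt l) ^+ 2.
  by rewrite sqrrD !sqr_sqrtr// sqrtrM// mulr2n; ring.
have s0 : 0 <= Num.sqrt (1 + l) + Num.sqrt l by rewrite addr_ge0.
rewrite div1r -powR_inv1// -!powRrM -powR_mulrn// -powRrM; congr powR; ring.
Qed.

End laplace_transforms.

(** * Expectations of products of independent variables *)

Section independence.
Context (R : realType) d (T : measurableType d) (P : probability T R).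
Variables (n : nat) (X : nat -> {RV P >-> R}).
Hypothesis indX : mutually_independent P n (fun i w => X i w).

Lemma measurable_prod_RV (Q : pred 'I_n) (h : nat -> R -> R) :
  (forall i, measurable_fun [set: R] (h i)) ->
  measurable_fun [set: T] (fun w => \prod_(i < n | Q i) h i (X i w)).
Proof.
move=> mh; have -> : (fun w => \prod_(i < n | Q i) h i (X i w)) =
    (fun w => \prod_(i <- [seq i <- index_enum 'I_n | Q i]) h i (X i w)).
  by apply/funext => w; rewrite big_filter.
elim: [seq i <- _ | _] => [|i s IH].
  by rewrite (_ : (fun=> _) = cst 1)//; apply/funext => w; rewrite big_nil.
rewrite (_ : (fun w => _) = (fun w => h i (X i w) * \prod_(i <- s) h i (X i w))).
  by apply: measurable_funM => //; exact: (measurableT_comp (mh i)).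
by apply/funext => w; rewrite big_cons.
Qed.

(** The definition of independence is the case of indicator functions. They are
    replaced by the h i one at a time, j counting the replaced ones: for fixed
    other factors, both sides are measures in the set whose indicator is being
    replaced. *)
Lemma mutually_independent_prod (j : nat) (h : nat -> R -> R) (e : nat -> R) :
  (forall i, measurable_fun [set: R] (h i)) -> (forall i x, 0 <= h i x) ->
  (forall i, \int[P]_w (h i (X i w))%:E = (e i)%:E)%E ->
  (forall i, (j <= i)%N -> exists2 B : set R, measurable B & h i = \1_B) ->
  (\int[P]_w (\prod_(i < n) h i (X i w))%:E = (\prod_(i < n) e i)%:E)%E.
Proof.
elim: j h e => [|j IH] h e mh h0 he hB.
  have [B HB] : {B : nat -> set R & forall i, measurable (B i) /\ h i = \1_(B i)}.
    apply: (@choice _ _ (fun i B => measurable B /\ h i = \1_B)) => i.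
    by have [B mB hE] := hB i (leq0n i); exists B.
  have mB i := (HB i).1; have hE i := (HB i).2.
  have mE : measurable [set w | forall i, (i < n)%N -> B i (X i w)].
    rewrite (_ : [set w | _] = \bigcap_(i < n) (X i @^-1` B i)); last first.
      by apply/seteqP; split => w /= H i; exact: H.
    by apply: bigcap_measurableType => // i _; exact: (measurable_funPTI (X i)).
  have := indX mB; rewrite -[X in P X]setIT -integral_indic// big_mkord => E.
  transitivity (\prod_(i < n) (e i)%:E)%E; last by rewrite prodEFin.
  transitivity (\int[P]_w (\1_[set w | forall i, (i < n)%N -> B i (X i w)] w)%:E)%E.
    apply: eq_integral => w _; congr (_%:E); rewrite indicE.
    have [H|H] := pselect (forall i, (i < n)%N -> B i (X i w)).
      rewrite mem_set// big1// => i _; rewrite hE indicE mem_set//.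
      exact: H (ltn_ord i).
    rewrite memNset//; apply/eqP/prodf_eq0.
    have [i [ni NB]] : exists i, (i < n)%N /\ ~ B i (X i w).
      apply: contrapT => K; apply: H => i ni; apply: contrapT => NB.
      by apply: K; exists i.
    by exists (Ordinal ni) => //=; rewrite hE indicE memNset.
  rewrite E; apply: eq_bigr => i _; rewrite -he hE.
  rewrite -[X in P X]setIT -integral_indic//.
  exact: (measurable_funPTI (X i)).
have PXE A : measurable A -> (\int[P]_w (\1_A (X j w) : R)%:E = (fine (P (X j @^-1` A)))%:E)%E.
  move=> mA; rewrite fineK; last by apply: fin_num_measure; exact: (measurable_funPTI (X j)).
  by rewrite -[X in P X]setIT -integral_indic//; exact: (measurable_funPTI (X j)).
have swap A : measurable A ->
    (\int[P]_w (\prod_(i < n) (if i == j :> nat then \1_A else h i) (X i w))%:E =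
     (\prod_(i < n) (if i == j :> nat then fine (P (X j @^-1` A)) else e i))%:E)%E.
  move=> mA; pose h' (i : nat) : R -> R := if i == j then \1_A else h i.
  apply: (IH h' (fun i => if i == j then fine (P (X j @^-1` A)) else e i)).
  - by move=> i; rewrite /h'; case: ifP.
  - by move=> i x; rewrite /h'; case: ifP.
  - by move=> i; rewrite /h'; case: eqP => [->|_]; [exact: PXE|exact: he].
  - move=> i ji; rewrite /h'; case: eqP => [_|/eqP ij]; first by exists A.
    by apply: hB; rewrite ltn_neqAle eq_sym ij.
have [jn|nj] := ltnP j n; last first.
  have ne (i : 'I_n) : (i == j :> nat) = false by rewrite ltn_eqF// (leq_trans _ nj).
  have := swap setT measurableT; under eq_bigr do rewrite ne.
  by under eq_integral do under eq_bigr do rewrite ne.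
pose J := Ordinal jn.
pose W w := \prod_(i < n | i != J) h i (X i w).
pose c := \prod_(i < n | i != J) e i.
have mW : measurable_fun [set: T] W by exact: measurable_prod_RV.
have W0 w : 0 <= W w by apply: prodr_ge0.
have e0 i : 0 <= e i.
  by rewrite -lee_fin -he; apply: integral_ge0 => w _; rewrite lee_fin.
have c0 : 0 <= c by apply: prodr_ge0.
have neJ (i : 'I_n) : i != J -> (i == j :> nat) = false by move=> /negPf <-.
have mXj := measurable_funPT (X j).
(* m1 A is the left-hand side with h j replaced by the indicator of A *)
pose m1 := measure_function_pushforward__canonical__measure_function_Measure (density_measure P mW W0) mXj.
pose m2 := mscale (NngNum c0) (distribution P (X j)).
have m12 A : measurable A -> m1 A = m2 A.
  move=> mA; have := swap A mA; rewrite (bigD1 J)//= eqxx.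
  under eq_bigr => i iJ do rewrite neJ//.
  rewrite EFinM fineK; last by apply: fin_num_measure; exact: (measurable_funPTI (X j)).
  move=> E; transitivity (P (X j @^-1` A) * c%:E)%E; last exact: muleC.
  rewrite -E /m1 /pushforward /density_measure integral_mkcond.
  apply: eq_integral => w _; rewrite patchE (bigD1 J)//= eqxx.
  rewrite (eq_bigr (fun i : 'I_n => h i (X i w))); last first.
    by move=> i iJ; rewrite neJ.
  rewrite indicE -/(W w); case: ifPn => wA.
    by rewrite mem_set ?mul1r//; rewrite inE in wA.
  by rewrite memNset ?mul0r//; rewrite notin_setE in wA.
have mhj : measurable_fun [set: R] (fun x => (h j x)%:E) by exact/measurable_EFinP.
have hj0 x : (0 <= (h j x)%:E)%E by rewrite lee_fin.
transitivity (\int[m1]_x (h j x)%:E)%E.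
  rewrite ge0_integral_pushforward// preimage_setT ge0_integral_density_measure//.
  - by apply: eq_integral => w _; rewrite (bigD1 J)//= EFinM muleC.
  - exact: (measurableT_comp mhj).
  - by move=> w /=.
transitivity (\int[m2]_x (h j x)%:E)%E.
  by apply: eq_measure_integral => A mA _; exact: m12.
rewrite ge0_integral_mscale// ge0_integral_distribution//= he -EFinM.
by rewrite (bigD1 J)//= mulrC.
Qed.

End independence.

(** A nondecreasing sequence of nonnegative variables whose Laplace transforms
    converge to L, with L(l) arbitrarily close to 1, has an almost surely finite
    limit with Laplace transform L: the limiting transform is the expectation of
    e^(-l X) on the event X < +oo, hence at most the probability of that event. *)
Section nondecreasing_limit.
Context (R : realType) d (T : measurableType d) (P : probability T R).
Variables (S : nat -> {RV P >-> R}) (L : R -> R).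
Hypothesis S_nd : {ae P, forall w, (forall n, 0 <= S n w) /\
  nondecreasing_seq (fun n => S n w)}.
Hypothesis S_laplace : forall l, 0 < l ->
  (\int[P]_w (expR (- (l * S n w)))%:E)%E @[n --> \oo] --> (L l)%:E.
Hypothesis L0 : forall e, 0 < e -> exists2 l, 0 < l & 1 - e <= L l.

Let X w := limn_esup (fun n => (S n w)%:E).

Let mX : measurable_fun [set: T] X.
Proof.
have := @measurable_fun_limn_esup _ T R setT (fun n w => (S n w)%:E).
by apply => n; exact/measurable_EFinP.
Qed.

Let X_cvg : {ae P, forall w, (S n w)%:E @[n --> \oo] --> X w}.
Proof.
apply: filterS S_nd => w [_ nd].
have cv : cvgn (fun n => (S n w)%:E).
  by apply: ereal_nondecreasing_is_cvgn => m n mn; rewrite lee_fin nd.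
by rewrite /X is_cvg_limn_esupE.
Qed.

Let X_ge0 : {ae P, forall w, (0 <= X w)%E}.
Proof.
apply: filterS2 S_nd X_cvg => w [S0 _] cX.
rewrite -(cvg_lim _ cX)//; apply: lime_ge; first by apply/cvg_ex; exists (X w).
by apply: nearW => n; rewrite lee_fin.
Qed.

Let F := X @^-1` [set x | x < +oo]%E.

Let mF : measurable F.
Proof. by rewrite -[F]setTI; exact: emeasurable_fun_infty_o. Qed.

Let phi l w : R := expR (- (l * fine (X w))) * \1_F w.

Let mphi l : measurable_fun [set: T] (phi l).
Proof.
apply: measurable_funM; last exact: measurable_indic.
apply: measurableT_comp => //; apply: measurable_funN; apply: measurable_funM => //.
exact: (measurableT_comp (fine_measurable measurableT) mX).
Qed.

Let phi_cvg l : 0 < l ->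
  {ae P, forall w, (expR (- (l * S n w)))%:E @[n --> \oo] --> (phi l w)%:E}.
Proof.
move=> l0; apply: filterS2 X_cvg X_ge0 => w; rewrite /phi /F indicE.
case XE : (X w) => [x| |]// cS _.
  rewrite mem_set; last by rewrite /= XE ltry.
  rewrite mulr1/=; apply: cvg_EFin; first by apply: nearW.
  have {}cS : S n w @[n --> \oo] --> x by move/fine_cvgP : cS => [_ +].
  apply: continuous_cvg; first exact: continuous_expR.
  by apply: cvgN; apply: cvgMr.
rewrite memNset; last by rewrite /= XE ltxx.
rewrite mulr0; apply: cvg_EFin; first by apply: nearW.
move/cvgeryP : cS => cS.
have lS : l * S n w @[n --> \oo] --> +oo.
  apply/cvgryPge => A; move/cvgryPge : cS => /(_ (A / l)); apply: filterS => n.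
  by rewrite ler_pdivrMr// mulrC.
exact: (cvg_comp _ _ lS (@cvgr_expR R)).
Qed.

Let integral_phi l : 0 < l -> (\int[P]_w (phi l w)%:E = (L l)%:E)%E.
Proof.
move=> l0.
have int1 : P.-integrable [set: T] (cst 1%E).
  exact: finite_measure_integrable_cst.
have mS n : measurable_fun [set: T] (fun w => (expR (- (l * S n w)))%:E).
  exact: measurable_expR_RV.
have bnd : {ae P, forall w n, setT w ->
    (`|(expR (- (l * S n w)))%:E| <= (cst 1%E : T -> \bar R) w)%E}.
  apply: filterS S_nd => w [S0 _] n _; rewrite gee0_abs ?lee_fin ?expR_ge0//.
  by rewrite expR_le1 oppr_le0 mulr_ge0// ltW.
have cvgf : {ae P, forall w, setT w -> (expR (- (l * S n w)))%:E @[n --> \oo] --> (phi l w)%:E}.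
  by apply: filterS (phi_cvg l0) => w + _.
have mp : measurable_fun [set: T] (fun w => (phi l w)%:E) by exact/measurable_EFinP.
have [_ _ c] := dominated_convergence measurableT mS mp cvgf int1 bnd.
exact: (cvg_unique _ c (S_laplace l0)).
Qed.

Let ae_finite : {ae P, forall w, F w}.
Proof.
have PF : P F = 1%E.
  apply/eqP; rewrite eq_le probability_le1//=; apply/lee_addgt0Pr => e e0.
  have [l l0 Ll] := L0 e0.
  rewrite -leeBlDr// -EFinB; apply: (@le_trans _ _ (L l)%:E); first by rewrite lee_fin.
  rewrite -integral_phi// -[F]setIT -integral_indic//.
  apply: ae_ge0_le_integral => //.
  - by move=> w _; rewrite lee_fin mulr_ge0 ?expR_ge0.
  - exact/measurable_EFinP.
  - by apply/measurable_EFinP; exact: measurable_indic.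
  apply: filterS X_ge0 => w X0 _; rewrite lee_fin ler_piMl// expR_le1 oppr_le0.
  by rewrite mulr_ge0 ?(ltW l0)// fine_ge0.
exists (~` F); split => //; first exact: measurableC.
by rewrite probability_setC// PF subee.
Qed.

Lemma nondecreasing_limit_laplace : exists X' : {RV P >-> R},
  [/\ {ae P, forall w, (S n w)%:E @[n --> \oo] --> (X' w)%:E},
      {ae P, forall w, 0 <= X' w} &
      forall l, 0 < l -> (\int[P]_w (expR (- (l * X' w)))%:E = (L l)%:E)%E].
Proof.
have mX' : measurable_fun [set: T] (fine \o X).
  exact: (measurableT_comp (fine_measurable measurableT) mX).
have [X' X'E] := measurable_fun_RV P mX'; exists X'; rewrite X'E; split.
- apply: filterS3 X_cvg X_ge0 ae_finite => w cX X0 FX /=.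
  by rewrite fineK// ge0_fin_numE.
- by apply: filterS X_ge0 => w X0; rewrite fine_ge0.
move=> l l0; rewrite -integral_phi//; apply: ae_eq_integral => //.
- apply/measurable_EFinP; apply: measurableT_comp => //; apply: measurable_funN.
  exact: measurable_funM.
- exact/measurable_EFinP.
by apply: filterS ae_finite => w FX _; rewrite /phi indicE mem_set// mulr1.
Qed.

End nondecreasing_limit.

(** * Dyadic sums and pathwise integrals *)

Section dyadic.
Context (R : realType).
Implicit Types (t u : R) (n k : nat) (v : nat -> R).

Definition dyadic t n k : R := t * k%:R / 2 ^+ n.

Definition dyadic_cell t n k : set R := `]dyadic t n k, dyadic t n k.+1]%classic.

(** The step function with value v k on the k-th cell. Cells are open on the left,
    as the intervals whose Stieltjes measure is an increment. *)
Definition dyadic_step t n v u : R :=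
  \sum_(k < 2 ^ n) v k * \1_(dyadic_cell t n k) u.

Lemma dyadic0 t n : dyadic t n 0 = 0.
Proof. by rewrite /dyadic mulr0 mul0r. Qed.

Lemma dyadic_last t n : dyadic t n (2 ^ n) = t.
Proof. by rewrite /dyadic natrX mulfK// expf_neq0. Qed.

Lemma dyadic_double t n k : dyadic t n.+1 k.*2 = dyadic t n k.
Proof.
rewrite /dyadic -mul2n natrM exprS mulrCA.
by rewrite -mulf_div divff ?mul1r// pnatr_eq0.
Qed.

Lemma le_dyadic t n k j : 0 <= t -> (k <= j)%N -> dyadic t n k <= dyadic t n j.
Proof.
move=> t0 kj; rewrite /dyadic ler_pM2r ?invr_gt0 ?exprn_gt0//.
by rewrite ler_wpM2l// ler_nat.
Qed.

Lemma dyadic_cell_half t n k u : 0 <= t ->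
  dyadic_cell t n.+1 k u -> dyadic_cell t n k./2 u.
Proof.
move=> t0; rewrite /dyadic_cell/= !in_itv/= => /andP[u1 u2].
rewrite -(dyadic_double t n) -(dyadic_double t n k./2.+1).
have e := odd_double_half k.
apply/andP; split.
  by apply: le_lt_trans u1; apply: le_dyadic => //; rewrite -{2}e leq_addl.
apply: (le_trans u2); apply: le_dyadic => //; rewrite doubleS.
by rewrite -{1}e ltnS; case: (odd k).
Qed.

Lemma dyadic_cell_exists t n u : 0 <= t -> 0 < u <= t ->
  exists2 k, (k < 2 ^ n)%N & dyadic_cell t n k u.
Proof.
move=> t0 ut; elim: n => [|n [k kn]].
  by exists 0%N => //; rewrite /dyadic_cell/= in_itv/= dyadic0 -[1%N]/(2 ^ 0)%N dyadic_last.
rewrite /dyadic_cell/= in_itv/= -(dyadic_double t n) -(dyadic_double t n k.+1).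
move=> /andP[u1 u2]; have [um|um] := leP u (dyadic t n.+1 k.*2.+1).
  exists k.*2; first by rewrite expnS mul2n ltn_double.
  by rewrite /dyadic_cell/= in_itv/= u1 um.
exists k.*2.+1; first by rewrite expnS mul2n -doubleS leq_double in kn *.
by rewrite /dyadic_cell/= in_itv/= um -doubleS u2.
Qed.

Lemma dyadic_cell_inj t n k j u : 0 <= t ->
  dyadic_cell t n k u -> dyadic_cell t n j u -> k = j.
Proof.
move=> t0; rewrite /dyadic_cell/= !in_itv/=.
wlog kj : k j / (k <= j)%N.
  move=> H uk uj; have [kj|/ltnW jk] := leqP k j; first exact: H.
  by apply/esym; exact: H.
move=> /andP[_ uk] /andP[uj _]; apply/eqP; rewrite eqn_leq kj leqNgt/=.
apply/negP => kj'; have := le_dyadic n t0 kj'.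
by rewrite leNgt (lt_le_trans uj uk).
Qed.

Lemma dyadic_stepE t n v k u : 0 <= t -> (k < 2 ^ n)%N -> dyadic_cell t n k u ->
  dyadic_step t n v u = v k.
Proof.
move=> t0 kn uk; rewrite /dyadic_step (bigD1 (Ordinal kn))//= indicE mem_set//.
rewrite mulr1 big1 ?addr0// => j jk; rewrite indicE memNset ?mulr0// => uj.
by move/eqP: jk; apply; apply: val_inj => /=; exact: dyadic_cell_inj uj uk.
Qed.

Lemma dyadic_cell_sub t n k : 0 <= t -> (k < 2 ^ n)%N ->
  dyadic_cell t n k `<=` `]0, t].
Proof.
move=> t0 kn u; rewrite /dyadic_cell/= !in_itv/= => /andP[u1 u2].
have k0 : 0 <= dyadic t n k by rewrite -(dyadic0 t n) le_dyadic.
have kt : dyadic t n k.+1 <= t by rewrite -[leRHS](dyadic_last t n) le_dyadic.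
by rewrite (le_lt_trans k0 u1) (le_trans u2 kt).
Qed.

Lemma dyadic_near t n k u : 0 <= t -> dyadic_cell t n k u ->
  (`|dyadic t n k - u| <= t / 2 ^+ n) /\ (`|dyadic t n k.+1 - u| <= t / 2 ^+ n).
Proof.
move=> t0; rewrite /dyadic_cell/= in_itv/=.
have -> : dyadic t n k.+1 = dyadic t n k + t / 2 ^+ n.
  by rewrite /dyadic -natr1 mulrDr mulr1 mulrDl.
move: (dyadic t n k) (t / _) => a b /andP[u1 u2].
by split; rewrite ler_norml; apply/andP; split; lra.
Qed.

Lemma cvg_dyadic_mesh t : t / 2 ^+ n @[n --> \oo] --> (0 : R).
Proof.
rewrite -[X in _ --> X](mulr0 t); apply: cvgMr.
under eq_cvg do rewrite -exprVn.
by apply: cvg_expr; rewrite ger0_norm ?invr_ge0// invf_lt1// ltr1n.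
Qed.

Section monotone_limit.
Variables (m : {measure set (measurableTypeR R) -> \bar R}) (t : R).
Variables (v : nat -> nat -> R) (h : R -> \bar R).
Hypothesis t0 : 0 <= t.
Hypothesis v0 : forall n k, 0 <= v n k.
Hypothesis v_nd : forall n k, (k < 2 ^ n.+1)%N -> v n k./2 <= v n.+1 k.
Hypothesis v_cvg : forall u (k : nat -> nat), 0 < u <= t ->
  (forall n, dyadic_cell t n (k n) u) -> (v n (k n))%:E @[n --> \oo] --> h u.

(** Monotone convergence for step functions increasing to h. It is stated for
    every measure since it serves for the Stieltjes measures of the paths and,
    for ln (1 + l h), for the Lebesgue measure. *)
Lemma cvg_dyadic_sum :
  (\sum_(k < 2 ^ n) ((v n k)%:E * m (dyadic_cell t n k)))%E @[n --> \oo] -->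
  (\int[m]_(u in `]0%R, t]) h u)%E.
Proof.
have mc n k : measurable (dyadic_cell t n k : set (measurableTypeR R)).
  exact: measurable_itv.
have D u : `]0, t]%classic u -> 0 < u <= t by rewrite /= in_itv.
have mD : measurable (`]0, t]%classic : set (measurableTypeR R)) by [].
have mi n k : measurable_fun (`]0, t]%classic : set (measurableTypeR R))
    (fun u => (v n k * \1_(dyadic_cell t n k) u)%:E).
  by apply/measurable_EFinP; apply: measurable_funM => //; exact: measurable_indic.
have s0 n u : (0 <= (dyadic_step t n (v n) u)%:E)%E.
  by rewrite lee_fin; apply: sumr_ge0 => k _; rewrite mulr_ge0.
have ms n : measurable_fun (`]0, t]%classic : set (measurableTypeR R))
    (fun u => (dyadic_step t n (v n) u)%:E).
  rewrite (_ : (fun u => _) = (fun u =>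
      \sum_(k < 2 ^ n) (v n k * \1_(dyadic_cell t n k) u)%:E)%E); last first.
    by apply/funext => u; rewrite sumEFin.
  exact: emeasurable_sum.
have nd u : `]0, t]%classic u ->
    {homo (fun n => (dyadic_step t n (v n) u)%:E) : x y / (x <= y)%N >-> (x <= y)%E}.
  move=> /D ut; apply/nondecreasing_seqP => n; rewrite lee_fin.
  have [k kn uk] := dyadic_cell_exists n.+1 t0 ut.
  rewrite (dyadic_stepE _ t0 kn uk) (dyadic_stepE _ t0 _ (dyadic_cell_half t0 uk)).
    exact: v_nd.
  by rewrite ltn_half_double -mul2n -expnS.
have := @cvg_monotone_convergence _ _ R m _ mD _ ms (fun n u _ => s0 n u) nd.
rewrite (_ : (\int[m]_(u in `]0%R, t]) limn _)%E = (\int[m]_(u in `]0%R, t]) h u)%E); last first.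
  apply: eq_integral => u; rewrite inE => /D ut.
  have [k Hk] : {k : nat -> nat & forall n, (k n < 2 ^ n)%N /\ dyadic_cell t n (k n) u}.
    apply: (@choice _ _ (fun n k => (k < 2 ^ n)%N /\ dyadic_cell t n k u)) => n.
    by have [k] := dyadic_cell_exists n t0 ut; exists k.
  rewrite (_ : (fun n => _) = (fun n => (v n (k n))%:E)); last first.
    by apply/funext => n; rewrite (dyadic_stepE _ t0 (Hk n).1 (Hk n).2).
  by apply/cvg_lim => //; apply: v_cvg => // n; exact: (Hk n).2.
rewrite (_ : (fun n => \int[m]_(u in _) _)%E =
    (fun n => \sum_(k < 2 ^ n) ((v n k)%:E * m (dyadic_cell t n k)))%E)//.
apply/funext => n; under eq_integral do rewrite -sumEFin.
rewrite ge0_integral_sum//; last first.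
  by move=> k u _; rewrite lee_fin mulr_ge0.
apply: eq_bigr => k _; under eq_integral do rewrite EFinM.
rewrite ge0_integralZl//; last 2 first.
- by apply/measurable_EFinP; exact: measurable_indic.
- by rewrite lee_fin.
rewrite integral_indic//; congr (_ * m _)%E.
by apply/setIidl; exact: dyadic_cell_sub.
Qed.

End monotone_limit.
End dyadic.

Lemma lebesgue_stieltjes_itv (R : realType) (F : cumulative R R) (a b : R) :
  a <= b -> lebesgue_stieltjes_measure F `]a, b]%classic = (F b - F a)%:E.
Proof.
move=> ab; rewrite /lebesgue_stieltjes_measure/= /measure_extension/=.
rewrite measurable_mu_extE//=; last exact: is_ocitv.
by rewrite wlength_itv_bnd.
Qed.

Lemma sum_double (V : nmodType) (f : nat -> V) (n : nat) :
  \sum_(k < n.*2) f k = \sum_(k < n) (f k.*2 + f k.*2.+1).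
Proof.
elim: n => [|n IH]; first by rewrite !big_ord0.
by rewrite doubleS !big_ord_recr/= IH addrA.
Qed.

Section wiener_gamma.
Context (R : realType).
Notation mu := (@lebesgue_measure R).
Context d1 (T1 : measurableType d1) (P1 : probability T1 R) (g : R -> {RV P1 >-> R}).
Hypothesis hg : gamma_process g.
Implicit Types (t l : R) (v : nat -> R).

Lemma gamma_process_nd :
  {ae P1, forall w s u, 0 <= s -> s <= u -> g s w <= g u w}.
Proof.
have [[_ Hc _ _] _] := hg; apply: filterS Hc => w [nd _] s u s0 su.
have := nd s u su; rewrite /extend_below0 (max_r s0).
by rewrite (max_r (le_trans s0 su)).
Qed.

Definition increment (s u : R) : {RV P1 >-> R} :=
  HB.pack (fun w => g u w - g s w)
    (isMeasurableFun.Build _ _ _ _ _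
      (measurable_funB (measurable_funPT (g u)) (measurable_funPT (g s)))).

Lemma laplace_gamma_increment (s u c : R) : 0 <= s -> s <= u -> 0 <= c ->
  (\int[P1]_w (expR (- (c * increment s u w)))%:E = ((1 + c) `^ (- (u - s)))%:E)%E.
Proof.
move=> s0 su c0; have us0 : 0 <= u - s by rewrite subr_ge0.
have [[_ _ _ st] lap] := hg.
have mh : measurable_fun [set: R] (fun x : R => (expR (- (c * x)))%:E).
  apply/measurable_EFinP; apply: measurableT_comp => //; apply: measurable_funN.
  exact: measurable_funM.
have e : eq_law P1 (increment s u) P1 (g (u - s)).
  by have := st s (u - s) s0 us0; rewrite addrC subrK.
rewrite (integral_eq_law e mh (fun x => expR_ge0 _)).
rewrite -laplace_transformE lap// gamma_process_exponent//.
rewrite -EFinM -EFinN/=; congr (_%:E).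
by rewrite /powR gt_eqF ?mulNr// ltr_wpDr.
Qed.

Section dyadic_sums.
Variables (t : R) (v : nat -> nat -> R).
Hypothesis t0 : 0 <= t.
Hypothesis v0 : forall n k, 0 <= v n k.
Hypothesis v_nd : forall n k, (k < 2 ^ n.+1)%N -> v n k./2 <= v n.+1 k.

Let inc n k := increment (dyadic t n k) (dyadic t n k.+1).

Lemma measurable_gamma_sum n :
  measurable_fun [set: T1] (fun w => \sum_(k < 2 ^ n) v n k * inc n k w).
Proof.
by apply: measurable_sum => k; apply: measurable_funM.
Qed.

Definition gamma_sum n : {RV P1 >-> R} :=
  HB.pack (fun w => \sum_(k < 2 ^ n) v n k * inc n k w)
    (isMeasurableFun.Build _ _ _ _ _ (measurable_gamma_sum n)).

(** Splitting each increment in two and raising its coefficients can only increase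
    the sum. *)
Lemma gamma_sum_nd : {ae P1, forall w, (forall n, 0 <= gamma_sum n w) /\
  nondecreasing_seq (fun n => gamma_sum n w)}.
Proof.
apply: filterS gamma_process_nd => w nd.
have inc0 n k : 0 <= inc n k w.
  by rewrite /inc/increment/= subr_ge0 nd ?le_dyadic// -(dyadic0 t n) le_dyadic.
split=> [n|].
  by rewrite /gamma_sum/=; apply: sumr_ge0 => k _; exact: (mulr_ge0 (v0 n k) (inc0 n k)).
apply/nondecreasing_seqP => n; rewrite /gamma_sum/=.
(* cell k of level n is the union of cells 2 k and 2 k + 1 of level n + 1 *)
have -> : \sum_(k < 2 ^ n) v n k * inc n k w =
    \sum_(k < 2 ^ n.+1) v n k./2 * inc n.+1 k w.
  rewrite expnS mul2n (sum_double (fun k => v n k./2 * inc n.+1 k w)).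
  apply: eq_bigr => k _; rewrite doubleK -[k.*2.+1]/(1 + k.*2)%N.
  rewrite (half_bit_double k true) -mulrDr; congr (_ * _).
  rewrite /inc/increment/= -(dyadic_double t n k) -(dyadic_double t n k.+1) doubleS.
  by move: (g _ w) (g _ w) (g _ w) => a b c; ring.
by apply: ler_sum => k _; exact: (ler_wpM2r (inc0 _ _) (v_nd (ltn_ord k))).
Qed.

(** Increments are independent, each with transform (1 + c)^(- t / 2^n). *)
Lemma laplace_gamma_sum n l : 0 < l ->
  (\int[P1]_w (expR (- (l * gamma_sum n w)))%:E =
   (expR (- (\sum_(k < 2 ^ n) ln (1 + l * v n k) * (t / 2 ^+ n))))%:E)%E.
Proof.
move=> l0; have [[_ _ ind _] _] := hg.
have indX : mutually_independent P1 (2 ^ n) (fun k w => inc n k w).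
  by apply: (ind _ (dyadic t n)) => [|i]; [exact: dyadic0|exact: le_dyadic].
(* the indicator of the whole line beyond the last increment leaves the product
   unchanged *)
pose h k (x : R) : R := if (k < 2 ^ n)%N then expR (- (l * v n k * x)) else \1_[set: R] x.
pose e k : R := if (k < 2 ^ n)%N then expR (- (ln (1 + l * v n k) * (t / 2 ^+ n))) else 1.
have := @mutually_independent_prod _ _ _ P1 (2 ^ n) (inc n) indX (2 ^ n) h e.
have lv k : 0 < 1 + l * v n k by rewrite ltr_wpDr// mulr_ge0// ltW.
move=> H; transitivity (\int[P1]_w (\prod_(i < 2 ^ n) h i (inc n i w))%:E)%E.
  apply: eq_integral => w _; rewrite /gamma_sum/=; congr (_%:E).
  rewrite mulr_sumr -sumrN expR_sum; apply: eq_bigr => k _.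
  by rewrite /h ltn_ord mulrA.
rewrite H => [||||].
- congr (_%:E); rewrite -sumrN expR_sum; apply: eq_bigr => k _.
  by rewrite /e ltn_ord.
- move=> k; rewrite /h; case: (k < 2 ^ n)%N; last exact: measurable_indic.
  apply: measurableT_comp => //; apply: measurable_funN; exact: measurable_funM.
- by move=> k x; rewrite /h; case: ifP.
- move=> k; rewrite /h /e; case: (k < 2 ^ n)%N.
    have d0 : 0 <= dyadic t n k by rewrite -(dyadic0 t n) le_dyadic.
    have dd : dyadic t n k <= dyadic t n k.+1 by exact: le_dyadic.
    rewrite (laplace_gamma_increment d0 dd (mulr_ge0 (ltW l0) (v0 n k))).
    congr (_%:E); rewrite /powR gt_eqF//; congr expR.
    rewrite mulNr mulrC; congr (- (_ * _)).
    by rewrite /dyadic -natr1 mulrDr mulr1 mulrDl addrAC subrr add0r.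
  transitivity (\int[P1]_w (cst 1%E w))%E.
    by apply: eq_integral => w _; rewrite indicT.
  by rewrite integral_cst// mul1e; exact: probability_setT.
- move=> k kn; exists setT => //; apply/funext => x.
  by rewrite /h ltnNge kn.
Qed.

Lemma gamma_sum_stieltjes (h : R -> \bar R) :
  (forall u (k : nat -> nat), 0 < u <= t ->
    (forall n, dyadic_cell t n (k n) u) -> (v n (k n))%:E @[n --> \oo] --> h u) ->
  {ae P1, forall w, (gamma_sum n w)%:E @[n --> \oo] -->
    stieltjes_integral (fun u => g u w) t h}.
Proof.
move=> vh; have [[_ Hc _ _] _] := hg; apply: filterS Hc => w Hw.
rewrite /stieltjes_integral; case: pselect => // H.
pose m := lebesgue_stieltjes_measure (cumulative_of H).
have E : (fun n => (gamma_sum n w)%:E) =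
    (fun n => \sum_(k < 2 ^ n) ((v n k)%:E * m (dyadic_cell t n k)))%E; last first.
  by rewrite E; exact: (@cvg_dyadic_sum R m t v h t0 v0 v_nd vh).
apply/funext => n; rewrite /gamma_sum/= -sumEFin.
apply: eq_bigr => k _; rewrite EFinM; congr (_ * _)%E.
rewrite /m lebesgue_stieltjes_itv; last exact: le_dyadic.
rewrite /inc/increment/= /extend_below0.
have d0 j : 0 <= dyadic t n j by rewrite -(dyadic0 t n) le_dyadic.
by rewrite !max_r.
Qed.

End dyadic_sums.
End wiener_gamma.

(** * Wiener-Gamma integrals with arc sine integrands *)

Section elog.
Context (R : realType).
Implicit Types (l : R).

(** The continuous extension of x |-> ln (1 + l x) to x = +oo, the value of
    1 / cos^2 at the end of the interval. *)
Definition elog1p l (x : \bar R) : \bar R :=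
  match x with r%:E => (ln (1 + l * r))%:E | +oo%E => +oo%E | -oo%E => 0%E end.

Lemma cvg_elog1p l (x : nat -> R) (y : \bar R) : 0 < l -> (forall n, 0 <= x n) ->
  (x n)%:E @[n --> \oo] --> y -> (ln (1 + l * x n))%:E @[n --> \oo] --> elog1p l y.
Proof.
move=> l0 x0; case: y => [r| |] xy /=.
- have r0 : 0 <= r.
    rewrite -lee_fin -(cvg_lim _ xy)//; apply: lime_ge; first by apply/cvg_ex; exists r%:E.
    by apply: nearW => n; rewrite lee_fin.
  apply: cvg_EFin; first by apply: nearW.
  have {}xy : x n @[n --> \oo] --> r by move/fine_cvgP : xy => [_ +].
  have lr : 0 < 1 + l * r by rewrite ltr_wpDr// mulr_ge0// ltW.
  have lx : 1 + l * x n @[n --> \oo] --> 1 + l * r.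
    by apply: cvgD; [exact: cvg_cst|exact: cvgMr].
  exact: (@continuous_cvg _ _ _ _ _ _ (@ln R) _ (continuous_ln lr) lx).
- apply/cvgeryP/cvgryPge => A; move/cvgeryP : xy => /cvgryPge/(_ (expR A / l)).
  apply: filterS => n; rewrite ler_pdivrMr// mulrC => xA.
  rewrite -[A]expRK ler_ln ?posrE ?expR_gt0//; first by rewrite (le_trans xA)// lerDr.
  by rewrite ltr_wpDr// mulr_ge0// ltW.
exfalso; have : (0 <= -oo :> \bar R)%E; last by [].
rewrite -(cvg_lim _ xy)//; apply: lime_ge; first by apply/cvg_ex; exists -oo%E.
by apply: nearW => n; rewrite lee_fin.
Qed.

End elog.

Section wiener_gamma.
Context (R : realType).
Notation mu := (@lebesgue_measure R).
Context d0 (T0 : measurableType d0) (P0 : probability T0 R) (G : {RV P0 >-> R}).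
Hypothesis hG : has_density P0 G (@arcsine_pdf R).
Context d (T : measurableType d) (P : probability T R) (Gam : R -> {RV P >-> R}).
Hypothesis hGam : driftless_subordinator Gam
  (fun x => ((x^-1)%:E * laplace_transform P0 G x)%E).
Context d1 (T1 : measurableType d1) (P1 : probability T1 R) (g : R -> {RV P1 >-> R}).
Hypothesis hg : gamma_process g.
Variables (t : R) (psi : R -> R) (v : nat -> nat -> R).
Hypothesis t0 : 0 < t.
Hypothesis mpsi : measurable_fun [set: R] psi.
Hypothesis psi_gt0 : forall u, 0 < u < t -> 0 < psi u.
Hypothesis psi_law : forall f : R -> \bar R, measurable_fun [set: R] f ->
  (forall x, 0 <= f x)%E ->
  (\int[mu]_(u in `]0%R, t[) f (psi u) = t%:E * \int[P0]_w f (G w))%E.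
Hypothesis v0 : forall n k, 0 <= v n k.
Hypothesis v_nd : forall n k, (k < 2 ^ n.+1)%N -> v n k./2 <= v n.+1 k.
Hypothesis v_cvg : forall u (k : nat -> nat), 0 < u <= t ->
    (forall n, dyadic_cell t n (k n) u) ->
  (v n (k n))%:E @[n --> \oo] --> ((psi u)%:E^-1)%E.

Let w2 l : R := (Num.sqrt (1 + l) - Num.sqrt l) `^ (2 * t).

(** The endpoint t, where psi may vanish, is a null set; elsewhere the integrand is
    a function of psi, whose law is arc sine. *)
Lemma integral_elog1p l : 0 < l ->
  (\int[mu]_(u in `]0%R, t]) elog1p l ((psi u)%:E^-1) =
   (t * ln ((Num.sqrt (1 + l) + Num.sqrt l) ^+ 2))%:E)%E.
Proof.
move=> l0; pose f (x : R) : \bar R := (`|ln (1 + l * x^-1)|)%:E.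
have mf : measurable_fun [set: R] f.
  apply/measurable_EFinP; apply: measurableT_comp => //.
  apply: (measurableT_comp (@measurable_ln R)).
  apply: measurable_funD => //; apply: measurable_funM => //; exact: measurable_invr.
have f0 x : (0 <= f x)%E by rewrite lee_fin.
have fE x : 0 < x -> f x = (ln (1 + l / x))%:E.
  move=> x0; rewrite /f ger0_norm// ln_ge0// lerDl divr_ge0 ?ltW//.
have E : {in `]0, t[%classic, (fun u => f (psi u)) =1
    (fun u => elog1p l ((psi u)%:E^-1)%E)}.
  move=> u; rewrite inE/= in_itv/= => /psi_gt0 pu.
  by rewrite inver gt_eqF//= fE.
rewrite integral_itv_bndoo; last first.
  apply: (eq_measurable_fun _ E); apply: measurable_funTS.
  exact: (measurableT_comp mf).
transitivity (\int[mu]_(u in `]0%R, t[) f (psi u))%E.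
  by apply/esym; apply: eq_integral => u; exact: E.
rewrite psi_law// EFinM; congr (_ * _)%E.
rewrite -(integral_ln_arcsine hG (ltW l0)); apply: (ae_eq_ge0_integral hG).
- exact: (measurableT_comp mf).
- apply/measurable_EFinP; apply: (measurableT_comp (@measurable_ln R)).
  apply: measurable_funD => //; apply: measurable_funM => //.
  exact: (measurableT_comp (@measurable_invr R)).
by move=> w /andP[w0 _]; rewrite fE.
Qed.

Lemma cvg_laplace_gamma_sum l : 0 < l ->
  (\int[P1]_w (expR (- (l * gamma_sum g t v n w)))%:E)%E @[n --> \oo] --> (w2 l)%:E.
Proof.
move=> l0; have lv n k : 1 <= 1 + l * v n k by rewrite lerDl mulr_ge0// ltW.
under eq_cvg do rewrite (laplace_gamma_sum hg (ltW t0) v0)//.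
apply: cvg_EFin; first by apply: nearW.
have := @cvg_dyadic_sum R mu t (fun n k => ln (1 + l * v n k))
  (fun u => elog1p l ((psi u)%:E^-1)%E) (ltW t0) _ _ _.
rewrite (integral_elog1p l0) => H.
have -> : w2 l = expR (- (t * ln ((Num.sqrt (1 + l) + Num.sqrt l) ^+ 2))).
  rewrite /w2 sqrt_sub_powR ?ltW// /powR gt_eqF ?mulNr//.
  by rewrite exprn_gt0// sqrt_add_gt0// ltW.
apply: continuous_cvg; first exact: continuous_expR.
apply: cvgN.
have {}H : (\sum_(k < 2 ^ n) ln (1 + l * v n k) * (t / 2 ^+ n))%:E @[n --> \oo] -->
    (t * ln ((Num.sqrt (1 + l) + Num.sqrt l) ^+ 2))%:E.
  have mE n : (\sum_(k < 2 ^ n) ln (1 + l * v n k) * (t / 2 ^+ n))%:E =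
      (\sum_(k < 2 ^ n) ((ln (1 + l * v n k))%:E * mu (dyadic_cell t n k)))%E.
    rewrite -sumEFin; apply: eq_bigr => k _; rewrite EFinM; congr (_ * _)%E.
    have -> : mu (dyadic_cell t n k) = (dyadic t n k.+1 - dyadic t n k)%:E.
      exact: (@lebesgue_stieltjes_itv R idfun _ _ (le_dyadic n (ltW t0) (leqnSn k))).
    congr (_%:E).
    by rewrite /dyadic -(@natr1 _ k) mulrDr mulr1 mulrDl addrAC subrr add0r.
  under eq_cvg do rewrite mE; apply: H.
  - by move=> n k; rewrite ln_ge0.
  - move=> n k kn; rewrite ler_ln ?posrE ?(lt_le_trans ltr01)//.
    by rewrite lerD2l; apply: ler_wpM2l; [exact: ltW|exact: v_nd].
  - by move=> u k ut uk; apply: cvg_elog1p => //; exact: v_cvg.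
by move/fine_cvgP : H => [_ +].
Qed.

(** Since the subordinator is finite, its Laplace transform tends to 1 at 0; this
    is what makes the Stieltjes integral almost surely finite. *)
Lemma laplace_near1 e : 0 < e -> exists2 l, 0 < l & 1 - e <= w2 l.
Proof.
move=> e0.
have Gam0 := subordinator_ge0 hGam.1 (ltW t0).
have := @cvg_laplace R _ _ P (Gam t) Gam0 harmonic 0 harmonic_ge0 (@cvg_harmonic R).
rewrite (_ : (\int[P]_w _)%E = 1%E); last first.
  under eq_integral do rewrite mul0r oppr0 expR0.
  rewrite (@integral_cst _ _ _ P)// mul1e; exact: probability_setT.
under eq_cvg do rewrite (arcsine_subordinator_laplace hG hGam (harmonic_ge0 _) (ltW t0)).
move/fine_cvgP => [_ /cvgrPdist_le /(_ e e0)] [N _ /(_ N (leqnn N))] /= H.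
exists (harmonic N); first exact: harmonic_gt0.
by move: H; rewrite ler_norml => /andP[_]; rewrite lerBlDr => H; rewrite lerBlDl.
Qed.

(** The dyadic sums increase to the Stieltjes integral, and their Laplace
    transforms converge to that of the subordinator. *)
Lemma wiener_gamma_representation :
  ae_eq_law P (Gam t) P1
    (fun w => stieltjes_integral (fun u => g u w) t (fun u => ((psi u)%:E^-1)%E)).
Proof.
have Snd := gamma_sum_nd hg (ltW t0) v0 v_nd.
have [X' [XS X0 XL]] := nondecreasing_limit_laplace Snd cvg_laplace_gamma_sum laplace_near1.
have SI := gamma_sum_stieltjes hg (ltW t0) v0 v_nd v_cvg.
exists X'; split.
  apply: filterS2 XS SI => w XS SI.
  exact: (cvg_unique _ SI XS).
move=> A mA; apply: laplace_unique => //.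
- by apply: (le_lt_trans (probability_le1 P measurableT)); rewrite ltry.
- exact: subordinator_ge0 hGam.1 (ltW t0).
move=> l; rewrite le_eqVlt => /orP[/eqP <-|l0].
  under eq_integral do rewrite mul0r oppr0 expR0.
  under [RHS]eq_integral do rewrite mul0r oppr0 expR0.
  transitivity (1%E : \bar R).
    rewrite (@integral_cst _ _ _ P)// mul1e; exact: probability_setT.
  apply/esym; rewrite (@integral_cst _ _ _ P1)// mul1e; exact: probability_setT.
by rewrite XL// (arcsine_subordinator_laplace hG hGam (ltW l0) (ltW t0)).
Qed.

End wiener_gamma.

(** * Trigonometric integrands *)

Section quarter_wave.
Context (R : realType).
Notation mu := (@lebesgue_measure R).
Implicit Types (e u x y : R).
Variable t : R.
Hypothesis t0 : 0 < t.

(** Decreasing from 1 to 0 on [0, t]; reflected at t / 2 it becomes sin^2, so both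
    representations reduce to this function. *)
Definition quarter_wave x : R := cos (pi * x / (2 * t)) ^+ 2.

Let arg_ge0 x : 0 <= x -> 0 <= pi * x / (2 * t).
Proof. by move=> x0; rewrite divr_ge0 ?mulr_ge0 ?pi_ge0// ltW. Qed.

Let arg_le x y : x <= y -> pi * x / (2 * t) <= pi * y / (2 * t).
Proof.
move=> xy; rewrite ler_pM2r ?invr_gt0 ?mulr_gt0//.
by rewrite ler_pM2l ?pi_gt0.
Qed.

Let arg_lt x y : (pi * x / (2 * t) < pi * y / (2 * t)) = (x < y).
Proof. by rewrite ltr_pM2r ?invr_gt0 ?mulr_gt0// ltr_pM2l ?pi_gt0. Qed.

Let arg_t : pi * t / (2 * t) = pi / 2.
Proof. by rewrite -mulf_div divff ?mulr1// gt_eqF. Qed.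

Let cos_arg_ge0 x : 0 <= x <= t -> 0 <= cos (pi * x / (2 * t)).
Proof.
move=> /andP[x0 xt]; apply: cos_ge0_pihalf; rewrite -arg_t arg_le// andbT.
by rewrite (le_trans _ (arg_ge0 x0))// oppr_le0 arg_ge0// ltW.
Qed.

Let arg_pi x : 0 <= x <= t -> pi * x / (2 * t) \in `[0, pi].
Proof.
move=> /andP[x0 xt]; rewrite in_itv/= arg_ge0//= (le_trans (arg_le xt))// arg_t.
by have := pi_ge0 R; lra.
Qed.

Lemma quarter_waveE e x : 0 <= e <= pi / 2 -> 0 <= x <= t ->
  (cos e ^+ 2 < quarter_wave x) = (x < 2 / pi * e * t).
Proof.
move=> e0 xt; have p0 := pi_gt0 R.
have ce : 0 <= cos e.
  by apply: cos_ge0_pihalf; case/andP: e0 => e0 e1; rewrite e1 andbT; lra.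
have ep : e \in `[0, pi].
  by rewrite in_itv/=; case/andP: e0 => e0 e1; apply/andP; split; lra.
rewrite /quarter_wave ltr_pXn2r ?nnegrE ?cos_arg_ge0// ltr_cos ?arg_pi//.
have {1}-> : e = pi * (2 / pi * e * t) / (2 * t).
  move: (pi : R) p0 => p p0; by field; rewrite !gt_eqF.
exact: arg_lt.
Qed.

Lemma le_quarter_wave x y : 0 <= x -> x <= y -> y <= t ->
  quarter_wave y <= quarter_wave x.
Proof.
move=> x0 xy yt; have xt : 0 <= x <= t by rewrite x0 (le_trans xy).
have yt' : 0 <= y <= t by rewrite yt (le_trans x0).
rewrite /quarter_wave ler_pXn2r ?nnegrE ?cos_arg_ge0//.
by rewrite leNgt ltr_cos ?arg_pi// -leNgt arg_le.
Qed.

Lemma quarter_wave_gt0 x : 0 <= x -> x < t -> 0 < quarter_wave x.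
Proof.
move=> x0 xt; rewrite exprn_gt0//; apply: cos_gt0_pihalf.
rewrite -arg_t arg_lt xt andbT (lt_le_trans _ (arg_ge0 x0))// oppr_lt0 arg_t.
by rewrite divr_gt0 ?pi_gt0.
Qed.

Lemma quarter_wave_ge0 x : 0 <= quarter_wave x.
Proof. exact: sqr_ge0. Qed.

Lemma quarter_wave_le1 x : quarter_wave x <= 1.
Proof. by rewrite /quarter_wave cos2sin2 lerBlDr lerDl sqr_ge0. Qed.

Lemma continuous_quarter_wave : continuous quarter_wave.
Proof.
move=> x; rewrite /quarter_wave.
apply: (@continuous_comp _ _ _ (fun x => cos (pi * x / (2 * t))) (fun y => y ^+ 2)).
  apply: (@continuous_comp _ _ _ (fun x => pi * x / (2 * t)) cos); last exact: continuous_cos.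
  by apply: continuousM; [exact: mulrl_continuous|exact: cvg_cst].
exact: exprn_continuous.
Qed.

Lemma sin2_quarter_wave u : sin (pi * u / (2 * t)) ^+ 2 = quarter_wave (t - u).
Proof.
rewrite /quarter_wave mulrBr mulrBl arg_t -(opprB _ (pi / 2)) cosN.
by rewrite cosBpihalf.
Qed.

Context d (T : measurableType d) (P : probability T R) (G : {RV P >-> R}).
Hypothesis hG : has_density P G (@arcsine_pdf R).

(** Under the Lebesgue measure of ]0, t[ the image of psi has mass t and tails
    linear in the angle, which characterises t times the arc sine law. *)
Lemma quarter_wave_arcsine (psi : R -> R) : measurable_fun [set: R] psi ->
  (forall u, 0 <= psi u) -> (forall u, psi u <= 1) ->
  (forall e, 0 < e <= pi / 2 ->
    mu (`]0, t[%classic `&` psi @^-1` `]cos e ^+ 2, +oo[) = (t * (2 / pi * e))%:E) ->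
  forall f : R -> \bar R, measurable_fun [set: R] f -> (forall x, (0 <= f x)%E) ->
  (\int[mu]_(u in `]0%R, t[) f (psi u) = t%:E * \int[P]_w f (G w))%E.
Proof.
move=> mpsi p0 p1 tail f mf f0.
have mD : measurable (`]0, t[%classic : set (measurableTypeR R)) by exact: measurable_itv.
have mpsi' : measurable_fun [set: measurableTypeR R] (psi : measurableTypeR R -> R) by [].
pose I : measurableTypeR R -> R := \1_(`]0, t[%classic).
have mI : measurable_fun [set: measurableTypeR R] I by exact: measurable_indic.
have I0 u : 0 <= I u by [].
pose mr : {measure set (measurableTypeR R) -> \bar R} := density_measure mu mI I0.
pose nu := measure_function_pushforward__canonical__measure_function_Measure mr mpsi'.
pose c : {nonneg R} := NngNum (ltW t0).
have nuE A : measurable A -> nu A = mu (`]0, t[ `&` psi @^-1` A).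
  move=> mA; rewrite /nu/= /pushforward /mr/= /density_measure integral_indic//.
  by rewrite -[_ @^-1` _]setTI; exact: mpsi.
have muD : mu `]0, t[%classic = t%:E.
  by rewrite lebesgue_measure_itv/= lte_fin t0 -EFinB subr0.
have H A : measurable A -> nu A = (c%:num%:E * P (G @^-1` A))%E.
  apply: (arcsine_law_unique hG).
  - move=> a a0; rewrite nuE// (_ : _ `&` _ = `]0, t[%classic) ?muD//.
    apply/setIidl => u _ /=; rewrite in_itv/= andbT; exact: lt_le_trans (p0 u).
  - by move=> e e0; rewrite nuE//; exact: tail.
  - move=> a a1; rewrite nuE// (_ : _ `&` _ = set0) ?measure0//.
    apply/seteqP; split => // u [_ /=]; rewrite in_itv/= andbT => au.
    by have := lt_le_trans au (le_trans (p1 u) a1); rewrite ltxx.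
transitivity (\int[nu]_x f x)%E.
  have mfp : measurable_fun [set: measurableTypeR R] (fun u => f (psi u)).
    exact: (measurableT_comp mf).
  rewrite ge0_integral_pushforward// preimage_setT ge0_integral_density_measure//.
    rewrite [LHS]integral_mkcond; apply: eq_integral => u _; rewrite patchE /I indicE.
    by case: ifP => _; rewrite ?mul1e ?mul0e.
  by move=> u /=.
transitivity (\int[mscale c (distribution P G)]_x f x)%E.
  by apply: eq_measure_integral => A mA _; exact: H.
by rewrite ge0_integral_mscale// ge0_integral_distribution.
Qed.

End quarter_wave.

Lemma cvg_inve (R : realType) (x : nat -> R) (y : R) :
  (y = 0 -> forall n, 0 < x n) -> x n @[n --> \oo] --> y ->
  ((x n)^-1)%:E @[n --> \oo] --> ((y%:E)^-1)%E.
Proof.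
rewrite inver; case: eqVneq => [-> /(_ erefl) x0 xy|y0 _ xy].
  apply/cvgeryP/cvgryPge => A.
  have B0 : 0 < (`|A| + 1)^-1 by rewrite invr_gt0 ltr_wpDl.
  move/cvgrPdist_le : xy => /(_ _ B0); apply: filterS => n.
  rewrite sub0r normrN gtr0_norm// => xB.
  apply: (@le_trans _ _ (`|A| + 1)); first by have := ler_norm A; lra.
  by rewrite -[leLHS]invrK lef_pV2// posrE.
by apply: cvg_EFin; [exact: nearW|exact: cvgV].
Qed.

Section wiener_gamma_trigonometric.
Context (R : realType).
Notation mu := (@lebesgue_measure R).
Context d0 (T0 : measurableType d0) (P0 : probability T0 R) (G : {RV P0 >-> R}).
Hypothesis hG : has_density P0 G (@arcsine_pdf R).
Context d (T : measurableType d) (P : probability T R) (Gam : R -> {RV P >-> R}).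
Hypothesis hGam : driftless_subordinator Gam
  (fun x => ((x^-1)%:E * laplace_transform P0 G x)%E).
Context d1 (T1 : measurableType d1) (P1 : probability T1 R) (g : R -> {RV P1 >-> R}).
Hypothesis hg : gamma_process g.
Variable t : R.
Hypothesis t0 : 0 < t.

Let tail_bound e : 0 < e <= pi / 2 -> 0 < 2 / pi * e * t <= t.
Proof.
move=> /andP[e0 e1]; have p0 := pi_gt0 R.
rewrite !mulr_gt0 ?invr_gt0//= ler_piMl ?(ltW t0)//.
have -> : 2 / pi * e = 2 * e / pi by rewrite mulrAC.
by rewrite ler_pdivrMr// mul1r; lra.
Qed.

Let dyadic_ge0 n k : 0 <= dyadic t n k.
Proof. by rewrite -(dyadic0 t n) le_dyadic// ltW. Qed.

Lemma cvg_dyadic_end u (k : nat -> nat) :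
  (forall n, dyadic_cell t n (k n) u) ->
  dyadic t n (k n) @[n --> \oo] --> u /\ dyadic t n (k n).+1 @[n --> \oo] --> u.
Proof.
move=> uk; have H (x : nat -> R) : (forall n, `|x n - u| <= t / 2 ^+ n) ->
    x n @[n --> \oo] --> u.
  move=> xu; apply/cvgrPdist_le => e e0.
  move/cvgrPdist_le : (@cvg_dyadic_mesh R t) => /(_ e e0); apply: filterS => n.
  rewrite sub0r normrN => te; rewrite distrC (le_trans (xu n))// (le_trans _ te)//.
  exact: ler_norm.
by split; apply: H => n; have [] := dyadic_near (ltW t0) (uk n).
Qed.

(** 1 / cos^2 increases on ]0, t], so left endpoints approximate it from below. *)
Lemma wiener_gamma_cos : ae_eq_law P (Gam t) P1
  (fun w => stieltjes_integral (fun u => g u w) t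
    (fun u => ((cos (pi * u / (2 * t)) ^+ 2)%:E^-1)%E)).
Proof.
apply: (@wiener_gamma_representation R _ _ _ _ hG _ _ _ _ hGam _ _ _ _ hg t
  (quarter_wave t) (fun n k => (quarter_wave t (dyadic t n k))^-1)) => //.
- apply: continuous_measurable_fun; exact: continuous_quarter_wave.
- by move=> u /andP[u0 ut]; apply: (quarter_wave_gt0 t0 (ltW u0) ut).
- apply: (quarter_wave_arcsine t0 hG).
  + apply: continuous_measurable_fun; exact: continuous_quarter_wave.
  + exact: quarter_wave_ge0.
  + exact: quarter_wave_le1.
  move=> e e0; have /andP[b0 bt] := tail_bound e0.
  have e0' : 0 <= e <= pi / 2 by case/andP: e0 => /ltW -> ->.
  rewrite (_ : _ `&` _ = `]0, 2 / pi * e * t[%classic); last first.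
    apply/seteqP; split => u /=; rewrite !in_itv/= ?andbT.
      move=> [/andP[u0 ut]]; rewrite u0 quarter_waveE// !ltW//.
    move=> /andP[u0 ub]; have ut := lt_le_trans ub bt.
    by rewrite u0 ut quarter_waveE// !ltW.
  by rewrite lebesgue_measure_itv/= lte_fin b0 -EFinB subr0 mulrC.
- by move=> n k; rewrite invr_ge0 quarter_wave_ge0.
- move=> n k kn; have lt_t : dyadic t n.+1 k < t.
    rewrite -[ltRHS](dyadic_last t n.+1) /dyadic ltr_pM2r ?invr_gt0 ?exprn_gt0//.
    by rewrite ltr_pM2l// ltr_nat.
  have le_h : dyadic t n k./2 <= dyadic t n.+1 k.
    rewrite -(dyadic_double t n) le_dyadic ?ltW//.
    by rewrite -{2}(odd_double_half k) leq_addl.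
  rewrite lef_pV2 ?posrE ?quarter_wave_gt0// ?(le_lt_trans le_h)//.
  by apply: le_quarter_wave => //; exact: ltW.
- move=> u k /andP[u0 ut] uk; apply: cvg_inve.
    move=> _ n; apply: quarter_wave_gt0 => //.
    by have := uk n; rewrite /dyadic_cell/= in_itv/= => /andP[uk1 _]; exact: lt_le_trans ut.
  apply: continuous_cvg; first exact: continuous_quarter_wave.
  by have [] := cvg_dyadic_end uk.
Qed.

(** 1 / sin^2 decreases on ]0, t], so right endpoints approximate it from below. *)
Lemma wiener_gamma_sin : ae_eq_law P (Gam t) P1
  (fun w => stieltjes_integral (fun u => g u w) t
    (fun u => ((sin (pi * u / (2 * t)) ^+ 2)%:E^-1)%E)).
Proof.
have -> : (fun u => ((sin (pi * u / (2 * t)) ^+ 2)%:E^-1)%E) =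
    (fun u => ((quarter_wave t (t - u))%:E^-1)%E).
  by apply/funext => u; rewrite (sin2_quarter_wave t0).
have cw : continuous (fun u => quarter_wave t (t - u)).
  move=> u; apply: (@continuous_comp _ _ _ (fun u => t - u) (quarter_wave t)).
    by apply: continuousB; [exact: cvg_cst|exact: cvg_id].
  exact: continuous_quarter_wave.
apply: (@wiener_gamma_representation R _ _ _ _ hG _ _ _ _ hGam _ _ _ _ hg t
  (fun u => quarter_wave t (t - u))
  (fun n k => (quarter_wave t (t - dyadic t n k.+1))^-1)) => //.
- exact: continuous_measurable_fun.
- move=> u /andP[u0 ut]; apply: quarter_wave_gt0 => //; first by rewrite subr_ge0 ltW.
  by rewrite ltrBlDr ltrDl.
- apply: (quarter_wave_arcsine t0 hG).
  + exact: continuous_measurable_fun.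
  + by move=> u; exact: quarter_wave_ge0.
  + by move=> u; exact: quarter_wave_le1.
  move=> e e0; have /andP[b0 bt] := tail_bound e0.
  have e0' : 0 <= e <= pi / 2 by case/andP: e0 => /ltW -> ->.
  rewrite (_ : _ `&` _ = `]t - 2 / pi * e * t, t[%classic); last first.
    apply/seteqP; split => u /=; rewrite !in_itv/= ?andbT.
      move=> [/andP[u0 ut]]; rewrite ut quarter_waveE//; last first.
        by rewrite subr_ge0 (ltW ut) lerBlDr lerDl ltW.
      by rewrite andbT => ub; lra.
    move=> /andP[ub ut]; have u0 : 0 < u by lra.
    rewrite u0 ut quarter_waveE//; first by split => //; lra.
    by rewrite subr_ge0 (ltW ut) lerBlDr lerDl ltW.
  rewrite lebesgue_measure_itv/= lte_fin ltrBlDr ltrDl b0 -EFinB opprB.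
  by congr (_%:E); rewrite addrCA subrr addr0 mulrC.
- by move=> n k; rewrite invr_ge0 quarter_wave_ge0.
- move=> n k kn; have d_gt0 m j : 0 < dyadic t m j.+1.
    by rewrite /dyadic divr_gt0 ?mulr_gt0 ?exprn_gt0.
  have le_t m j : (j < 2 ^ m)%N -> dyadic t m j.+1 <= t.
    by move=> jm; rewrite -[leRHS](dyadic_last t m) le_dyadic// ltW.
  have kn2 : (k./2 < 2 ^ n)%N by rewrite ltn_half_double -mul2n -expnS.
  have le_h : dyadic t n.+1 k.+1 <= dyadic t n k./2.+1.
    rewrite -(dyadic_double t n k./2.+1) le_dyadic ?ltW// doubleS ltnS.
    by rewrite -{1}(odd_double_half k); case: (odd k).
  have h1 := le_t _ _ kn; have h2 := le_t _ _ kn2.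
  have h3 := d_gt0 n.+1 k; have h4 := d_gt0 n k./2.
  rewrite lef_pV2 ?posrE ?quarter_wave_gt0 ?subr_ge0//; try by rewrite ltrBlDr ltrDl.
  by apply: le_quarter_wave; lra.
- move=> u k /andP[u0 ut] uk; apply: cvg_inve.
    move=> q0; exfalso; have : 0 < quarter_wave t (t - u).
      by apply: quarter_wave_gt0; lra.
    by rewrite q0 ltxx.
  apply: (@continuous_cvg _ _ _ _ _ _ (fun u => quarter_wave t (t - u))); first exact: cw.
  by have [] := cvg_dyadic_end uk.
Qed.

End wiener_gamma_trigonometric.

Theorem theorem3p1 (R : realType)
  (d0 : measure_display) (T0 : measurableType d0) (P0 : probability T0 R)
  (G : {RV P0 >-> R}) (hG : has_density P0 G (@arcsine_pdf R))
  (d : measure_display) (T : measurableType d) (P : probability T R)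
  (Gam : R -> {RV P >-> R})
  (hGam : driftless_subordinator Gam
            (fun x => ((x^-1)%:E * laplace_transform P0 G x)%E)) :
  (* 1: Laplace transform *)
  (forall l t : R, 0 <= l -> 0 <= t ->
    [/\ laplace_transform P (Gam t) l =
          expeR (- (t%:E * laplace_exponent
            (fun x => (x^-1 * (bessel_I0 (x / 2) * expR (- (x / 2))))%:E) l))%E,
        expeR (- (t%:E * laplace_exponent
            (fun x => (x^-1 * (bessel_I0 (x / 2) * expR (- (x / 2))))%:E) l))%E =
          ((Num.sqrt (1 + l) - Num.sqrt l) `^ (2 * t))%:E,
        (Num.sqrt (1 + l) - Num.sqrt l) `^ (2 * t) =
          (1 / (Num.sqrt (1 + l) + Num.sqrt l)) `^ (2 * t) &
        (1 / (Num.sqrt (1 + l) + Num.sqrt l)) `^ (2 * t) =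
          (1 + 2 * l + 2 * Num.sqrt (l * (1 + l))) `^ (- t)]) /\
  (* 2: laws *)
  (forall t : R, 0 < t ->
    [/\ (* Gamma_t = gamma_t / beta_{1/2, 1/2+t} in law *)
        (forall (d1 : measure_display) (T1 : measurableType d1)
           (P1 : probability T1 R) (g b : {RV P1 >-> R}),
           has_density P1 g (gamma_pdf t) ->
           has_density P1 b (rbeta_pdf (1 / 2) (1 / 2 + t)) ->
           independent2 P1 g b ->
           eq_law P (Gam t) P1 (fun w => g w / b w)),
        (* D_t = 1 / beta_{1/2, 1/2+t} in law *)
        (forall (d1 : measure_display) (T1 : measurableType d1)
           (P1 : probability T1 R) (g D : {RV P1 >-> R})
           (d2 : measure_display) (T2 : measurableType d2)
           (P2 : probability T2 R) (b : {RV P2 >-> R}),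
           has_density P1 g (gamma_pdf t) ->
           independent2 P1 g D ->
           eq_law P (Gam t) P1 (fun w => g w * D w) ->
           has_density P2 b (rbeta_pdf (1 / 2) (1 / 2 + t)) ->
           eq_law P1 D P2 (fun w => 1 / b w)),
        (* 1 / beta_{1/2, 1/2+t} = 1 + gamma_{t+1/2} / gamma_{1/2} in law *)
        (forall (d1 : measure_display) (T1 : measurableType d1)
           (P1 : probability T1 R) (b : {RV P1 >-> R})
           (d2 : measure_display) (T2 : measurableType d2)
           (P2 : probability T2 R) (g g' : {RV P2 >-> R}),
           has_density P1 b (rbeta_pdf (1 / 2) (1 / 2 + t)) ->
           has_density P2 g (gamma_pdf (t + 1 / 2)) ->
           has_density P2 g' (gamma_pdf (1 / 2)) ->
           independent2 P2 g g' ->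
           eq_law P1 (fun w => 1 / b w) P2 (fun w => 1 + g w / g' w)) &
        has_density P (Gam t) (fun x =>
          (2 `^ (2 * t) * gamma_fun (1 + t)) / (2 * pi * gamma_fun (2 * t))
          * x `^ (t - 1)
          * (\int[lebesgue_measure]_(y in `[0, 1])
               (expR (- (x * y)) * (y * (1 - y)) `^ (t - 1 / 2)))
          * \1_(`[0, +oo[%classic : set R) x)]) /\
  (* 3: Wiener-Gamma representations *)
  (forall (d1 : measure_display) (T1 : measurableType d1)
     (P1 : probability T1 R) (g : R -> {RV P1 >-> R}),
     gamma_process g ->
     forall t : R, 0 < t ->
       ae_eq_law P (Gam t) P1 (fun w => stieltjes_integral (fun u => g u w) t
         (fun u => ((sin (pi * u / (2 * t)) ^+ 2)%:E^-1)%E)) /\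
       ae_eq_law P (Gam t) P1 (fun w => stieltjes_integral (fun u => g u w) t
         (fun u => ((cos (pi * u / (2 * t)) ^+ 2)%:E^-1)%E))).
Proof.
split=> [l t l0 t0|].
  have LE : laplace_transform P (Gam t) l =
      expeR (- (t%:E * laplace_exponent
        (fun x => (x^-1 * (bessel_I0 (x / 2) * expR (- (x / 2))))%:E) l))%E.
    by rewrite (arcsine_bessel_exponent hG) hGam.2.
  split=> //.
  - by rewrite -LE laplace_transformE (arcsine_subordinator_laplace hG hGam).
  - exact: sqrt_sub_powRE.
  - exact: sqrt_add_powRE.
split=> [t t0|d1 T1 P1 g hg t t0].
  split.
  - move=> d1 T1 P1 g b; exact: (subordinator_gamma_over_beta hG hGam t0).
  - move=> d1 T1 P1 g D d2 T2 P2 b.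
    exact: (mixing_variable_law hG hGam t0).
  - move=> d1 T1 P1 b d2 T2 P2 g g'; rewrite (addrC (1 / 2)).
    by apply: beta_gamma_ratio => //; exact: addr_gt0.
  - exact: (subordinator_has_density hG hGam t0).
by split; [exact: (wiener_gamma_sin hG hGam hg t0)|exact: (wiener_gamma_cos hG hGam hg t0)].
Qed.
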